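(* Let $(M,P_M^{\mathfrak h},\mu)$ be a quasi-hamiltonian space (for the connected quasi-Poisson Lie group $G_D^{\mathfrak h}$) such that the bivector $P_M^{\mathfrak h}$ is everywhere nondegenerate. Let $p:M\to M/G$ be the projection onto the space of $G$-orbits. Assume that $M/G$ is a smooth manifold in a neighbourhood $U$ of $p(x_0)$, where $x_0\in M$. Let $m\in M$ be such that $p(m)\in U$ and $s=\mu(m)\in D/G$ is a regular value of the moment map $\mu$. Then the symplectic leaf through $p(m)$ in the Poisson manifold $U$ is the connected component (containing $p(m)$) of the intersection with $U$ of the projection $p(\mu^{-1}(s))$ of the manifold $\mu^{-1}(s)$.
   Context: Everything is real, finite-dimensional and smooth; ''bivector'' on a manifold means bivector field. $a\wedge b=a\otimes b-b\otimes a$. Manin pair $(\mathfrak d,\mathfrak g)$: a Lie algebra $\mathfrak d$ of dimension $2n$ with an invariant nondegenerate symmetric bilinear form $(\cdot|\cdot)$ of signature $(n,n)$, and a Lie subalgebra $\mathfrak g\subset\mathfrak d$ that is a maximal isotropic subspace. A Manin quasi-triple $(\mathfrak d,\mathfrak g,\mathfrak h)$ is a Manin pair with an isotropic linear complement $\mathfrak h$, $\mathfrak d=\mathfrak g\oplus\mathfrak h$. $p_{\mathfrak g},p_{\mathfrak h}$ are the projections; $j:\mathfrak g^*\to\mathfrak h$ is the isomorphism with $(j(\xi)|x)=\langle\xi,x\rangle$. $F_{\mathfrak h}:\mathfrak g\to\bigwedge^2\mathfrak g$ is given by $F_{\mathfrak h}(x)(\xi,\eta)=\langle j^{-1}p_{\mathfrak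 h}[j\xi,j\eta],x\rangle$ and $\varphi_{\mathfrak h}\in\bigwedge^3\mathfrak g$ by $\varphi_{\mathfrak h}(\xi,\eta,\zeta)=\langle\zeta,p_{\mathfrak g}[j\xi,j\eta]\rangle$. If $\mathfrak h'$ is another isotropic complement with isomorphism $j'$, the twist from $\mathfrak h$ to $\mathfrak h'$ is $t=j'-j:\mathfrak g^*\to\mathfrak g$, regarded as $t\in\bigwedge^2\mathfrak g$ via $t(\xi,\eta)=\langle t(\xi),\eta\rangle$. Group pair $(D,G)$: a connected Lie group $D$ with a bi-invariant scalar product and a connected closed Lie subgroup $G$ whose Lie algebras form a Manin pair $(\mathfrak d,\mathfrak g)$. With a basis $(e_i)$ of $\mathfrak g$ and dual basis $(\varepsilon^i)$ of $\mathfrak g^*$, $r_{\mathfrak d}=\sum_i e_i\otimes j(\varepsilon^i)$. $G_D^{\mathfrak h}$ is $G$ with the bivector obtained by restricting $P_D^{\mathfrak h}=r_{\mathfrak d}^\lambda-r_{\mathfrak d}^\rho$ (left- minus right-invariant tensors) to $G$ and with $\varphi_{\mathfrak h}$ (a quasi-Poisson Lie group). $S=D/G$; the dressing action is the action of $D$ (and of $G\subset D$) on $S$ induced by left multiplication. For an action on a manifold $M$, $x_M$ is the vector field $(x_Mf)(m)=\frac{d}{dt}f(\exp(-tx)m)|_{t=0}$, extended multiplicatively to tensors; likewise $X_S$ for $X\in\mathfrak d$. $\mathfrak h$ is admissible at $s\in S$ if $\mathfrak h\to T_sS$, $\xi\mapsto\xi_S(s)$, is an isomorphism, and admissible on a subset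 if admissible at each of its points. Where $\mathfrak h$ is admissible, for $x\in\mathfrak g$ the $1$-form $\hat x_{\mathfrak h}$ on $S$ is defined by $\langle\hat x_{\mathfrak h},\xi_S\rangle=-(x|\xi)$ for all $\xi\in\mathfrak h$. The action of $G_D^{\mathfrak h}$ on $(M,P_M^{\mathfrak h})$ is quasi-Poisson if $\frac12[P_M^{\mathfrak h},P_M^{\mathfrak h}]=(\varphi_{\mathfrak h})_M$ and $\mathcal L_{x_M}P_M^{\mathfrak h}=-F_{\mathfrak h}(x)_M$ for $x\in\mathfrak g$ (Schouten bracket normalized by $\frac12[P,P](df,dg,dh)=\{f,\{g,h\}\}+$cyclic, $\{f,g\}=P(df,dg)$). When $\mathfrak h$ is replaced by $\mathfrak h'$, $P_M^{\mathfrak h}$ is replaced by $P_M^{\mathfrak h'}=P_M^{\mathfrak h}-t_M$. For a bivector $P$, $P^\sharp$ maps $1$-forms to vector fields by $\langle P^\sharp\alpha,\beta\rangle=P(\beta,\alpha)$. A moment map for a quasi-Poisson action is a map $\mu:M\to S$, equivariant for the $G$-action on $M$ and the dressing action of $G$ on $S$, such that on any open $\Omega\subset M$, $(P_M^{\mathfrak h})^\sharp(\mu^*\hat x_{\mathfrak h})=x_M$ for all $x\in\mathfrak g$ and any $\mathfrak h$ admissible on $\mu(\Omega)$. A quasi-hamiltonian space is a manifold with bivector carrying a quasi-Poisson action that admits a moment map. The family $P_M^{\mathfrak h}$ is called nondegenerate at $m$ if $(P_M^{\mathfrak h})^\sharp_m:T^*_mM\to T_mM$ is an isomorphism for an $\mathfrak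 h$ admissible at $\mu(m)$ (this does not depend on the admissible $\mathfrak h$; an admissible $\mathfrak h$ exists at every point). The bracket $P_M^{\mathfrak h}(df_1,df_2)$ of $G$-invariant functions is a Poisson bracket independent of $\mathfrak h$; where $M/G$ is a smooth manifold (with $p$ a smooth submersion) it defines the Poisson structure on $U\subset M/G$ used in the statement.
   Formalization: The connected component of p(μ⁻¹(s)) ∩ U is taken in the quotient topology coming from the manifold μ⁻¹(s), not the topology induced by U; with the induced topology the claim fails when leaves are not embedded (e.g. coadjoint orbits of the Mautner group). *)

(* Defs.v *)
From HB Require Import structures.
From mathcomp Require Import all_boot all_order all_algebra generic_quotient.
From mathcomp Require Import all_classical all_reals all_analysis.
From Stdlib Require Import Relation_Operators.

Set Implicit Arguments.
Unset Strict Implicit.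
Unset Printing Implicit Defensive.

Import Order.TTheory GRing.Theory Num.Theory.
Import numFieldNormedType.Exports.

Local Open Scope classical_set_scope.
Local Open Scope ring_scope.

(** ** Calculus *)

(* On an open set [A] of a finite-dimensional [V], this is class C^k. *)
Fixpoint Ck (R : realType) (V W : normedModType R) (k : nat) (A : set V)
    (f : V -> W) : Prop :=
  match k with
  | 0%N => forall x, A x -> {for x, continuous f}
  | k'.+1 => (forall x, A x -> differentiable f x) /\
             (forall v, Ck k' A (fun x => 'd f x v))
  end.

Definition smooth_at (R : realType) (V W : normedModType R) (f : V -> W)
    (x : V) : Prop :=
  exists A : set V, [/\ open A, A x & forall k, Ck k A f].

(** ** Smooth manifolds *)

(* [cinv] is only meaningful on [cmap @` cdom], and [cmap] on [cdom]. *)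
Record chart (R : realType) (T : topologicalType) (n : nat) := Chart {
  cdom : set T;
  cmap :> T -> 'rV[R]_n;
  cinv : 'rV[R]_n -> T;
  cdom_open : open cdom;
  cimg_open : open (cmap @` cdom);
  cmapK : forall x, cdom x -> cinv (cmap x) = x;
  cmap_continuous : forall x, cdom x -> {for x, continuous cmap};
  cinv_continuous : forall u, (cmap @` cdom) u -> {for u, continuous cinv} }.

(* A smooth structure on the open subset [U] of [T]: the charts [chart_at x],
   for [x] in [U], form a smooth atlas of [U], and [U] is Hausdorff and second
   countable.  The values of [chart_at] outside [U] are irrelevant.
   The tangent space at [x] is identified with ['rV[R]_n] through the
   distinguished chart [chart_at x], and so is the cotangent space, by means of
   the basis dual to the coordinate vectors. *)
Record manifold_on (R : realType) (T : topologicalType) (U : set T) (n : nat) :=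
  Manifold {
  chart_at : T -> chart R T n;
  mf_open : open U;
  mf_chart : forall x, U x -> cdom (chart_at x) x;
  mf_dom : forall x, U x -> cdom (chart_at x) `<=` U;
  mf_transition : forall x y, U x -> U y ->
    forall z, cdom (chart_at x) z -> cdom (chart_at y) z ->
    smooth_at (chart_at y \o cinv (chart_at x)) (chart_at x z);
  mf_hausdorff : hausdorff_space (set_type U);
  mf_second_countable : @second_countable (set_type U) }.

(* Pairing of a covector with a vector, or of an element of R^n seen as the dual
   of R^n with an element of R^n. *)
Definition dotv (R : realType) (n : nat) (a v : 'rV[R]_n) : R :=
  (a *m v^T) 0 0.

Definition bform (R : realType) (n : nat) (P : 'M[R]_n) (a b : 'rV[R]_n) : R :=
  (a *m P *m b^T) 0 0.

(* <P^# a, b> = P(b, a) *)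
Definition sharp (R : realType) (n : nat) (P : 'M[R]_n) (a : 'rV[R]_n) :
  'rV[R]_n := a *m P^T.

Section Manifolds.
Variable R : realType.

Definition local_rep (T1 T2 : topologicalType) (U1 : set T1) (U2 : set T2)
    (n1 n2 : nat) (M1 : manifold_on R U1 n1) (M2 : manifold_on R U2 n2)
    (f : T1 -> T2) (x : T1) : 'rV[R]_n1 -> 'rV[R]_n2 :=
  chart_at M2 (f x) \o f \o cinv (chart_at M1 x).

Definition smooth_map (T1 T2 : topologicalType) (U1 : set T1) (U2 : set T2)
    (n1 n2 : nat) (M1 : manifold_on R U1 n1) (M2 : manifold_on R U2 n2)
    (W : set T1) (f : T1 -> T2) : Prop :=
  forall x, W x -> [/\ U2 (f x), {for x, continuous f} &
    smooth_at (local_rep M1 M2 f x) (chart_at M1 x x)].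

Definition smooth_map2 (T1 T2 T3 : topologicalType) (n1 n2 n3 : nat)
    (M1 : manifold_on R [set: T1] n1) (M2 : manifold_on R [set: T2] n2)
    (M3 : manifold_on R [set: T3] n3) (f : T1 -> T2 -> T3) : Prop :=
  forall x y, {for (x, y), continuous (fun z : T1 * T2 => f z.1 z.2)} /\
    smooth_at (fun w : 'rV[R]_n1 * 'rV[R]_n2 =>
                 chart_at M3 (f x y)
                   (f (cinv (chart_at M1 x) w.1) (cinv (chart_at M2 y) w.2)))
              (chart_at M1 x x, chart_at M2 y y).

(* Vectors are rows, so that the tangent map is [v |-> v *m tmap M1 M2 f x]. *)
Definition tmap (T1 T2 : topologicalType) (U1 : set T1) (U2 : set T2)
    (n1 n2 : nat) (M1 : manifold_on R U1 n1) (M2 : manifold_on R U2 n2)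
    (f : T1 -> T2) (x : T1) : 'M[R]_(n1, n2) :=
  jacobian (local_rep M1 M2 f x) (chart_at M1 x x).

Definition submersion (T1 T2 : topologicalType) (U1 : set T1) (U2 : set T2)
    (n1 n2 : nat) (M1 : manifold_on R U1 n1) (M2 : manifold_on R U2 n2)
    (W : set T1) (f : T1 -> T2) : Prop :=
  smooth_map M1 M2 W f /\ forall x, W x -> row_full (tmap M1 M2 f x).

Definition regular_value (T1 T2 : topologicalType) (U1 : set T1) (U2 : set T2)
    (n1 n2 : nat) (M1 : manifold_on R U1 n1) (M2 : manifold_on R U2 n2)
    (f : T1 -> T2) (s : T2) : Prop :=
  forall x, U1 x -> f x = s -> row_full (tmap M1 M2 f x).

Section OneManifold.
Variables (T : topologicalType) (U : set T) (n : nat) (M : manifold_on R U n).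

Definition smooth_fun (W : set T) (f : T -> R) : Prop :=
  forall x, W x ->
    smooth_at (f \o cinv (chart_at M x) : 'rV[R]_n -> R^o) (chart_at M x x).

Definition dfun (f : T -> R) (x : T) : 'rV[R]_n :=
  \row_i 'D_(delta_mx 0 i) (f \o cinv (chart_at M x) : 'rV[R]_n -> R^o)
           (chart_at M x x).

Definition has_velocity (c : R -> T) (t : R) (v : 'rV[R]_n) : Prop :=
  {for t, continuous c} /\
  is_derive (t : R^o) (1 : R^o) (chart_at M (c t) \o c : R^o -> 'rV[R]_n) v.

Definition smooth_curve (c : R -> T) : Prop :=
  forall t, {for t, continuous c} /\
    smooth_at (chart_at M (c t) \o c : R^o -> 'rV[R]_n) t.

Definition vapp (X : T -> 'rV[R]_n) (f : T -> R) : T -> R :=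
  fun x => dotv (dfun f x) (X x).

(* Bracket of vector fields, [X,Y]f = X(Yf) - Y(Xf), computed on the coordinate
   functions of the chart at [x]. *)
Definition vf_bracket (X Y : T -> 'rV[R]_n) (x : T) : 'rV[R]_n :=
  \row_i let f := fun y => chart_at M x y 0 i in
         vapp X (vapp Y f) x - vapp Y (vapp X f) x.

(* The value at [x] of a bivector field [P] is the matrix of the bilinear form
   on the cotangent space at [x]. *)
Definition bracket (P : T -> 'M[R]_n) (f g : T -> R) : T -> R :=
  fun x => bform (P x) (dfun f x) (dfun g x).

Definition bivector_field (P : T -> 'M[R]_n) : Prop :=
  (forall x, U x -> (P x)^T = - P x) /\
  (forall f g, smooth_fun U f -> smooth_fun U g -> smooth_fun U (bracket P f g)).

(* [u] and [v] are joined by an integral curve of the Hamiltonian vector field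
   sharp P (df) of some locally defined smooth function [f]. *)
Definition hamiltonian_step (P : T -> 'M[R]_n) (u v : T) : Prop :=
  exists (V : set T) (f : T -> R) (c : R -> T) (e : R),
    [/\ open V, V `<=` U, smooth_fun V f, 0 < e & [/\ c 0 = u, c 1 = v &
      forall t, - e < t -> t < 1 + e ->
        V (c t) /\ has_velocity c t (sharp (P (c t)) (dfun f (c t)))]].

(* Leaf of a Poisson manifold: the points that can be joined to [u] by a
   piecewise smooth curve, each piece of which is an integral curve of a locally
   defined Hamiltonian vector field. *)
Definition symplectic_leaf (P : T -> 'M[R]_n) (u : T) : set T :=
  [set v | clos_refl_trans T (hamiltonian_step P) u v].

End OneManifold.
End Manifolds.

(** ** Lie groups *)

(* No compatibility between product and topology is required here: it comes from
   the smoothness of the operations in [lie_group]. *)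
#[short(type="spaceGroupType")]
HB.structure Definition SpaceGroup :=
  {G of Topological G & Group G}.

Record lie_group (R : realType) (n : nat) (D : spaceGroupType) := LieGroup {
  lie_manifold :> manifold_on R [set: D] n;
  lie_mul_smooth : smooth_map2 lie_manifold lie_manifold lie_manifold
                     (fun a b : D => (a * b)%g);
  lie_inv_smooth : smooth_map lie_manifold lie_manifold [set: D]
                     (fun a : D => (a^-1)%g) }.

Record lie_action (R : realType) (n k : nat) (G : spaceGroupType)
    (LG : lie_group R n G) (M : topologicalType)
    (MM : manifold_on R [set: M] k) := LieAction {
  act :> G -> M -> M;
  act1 : forall m, act 1%g m = m;
  actM : forall a b m, act (a * b)%g m = act a (act b m);
  act_smooth : smooth_map2 LG MM MM act }.

Section LieGroups.
Variables (R : realType) (n : nat) (D : spaceGroupType).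
Variable (LD : lie_group R n D).

(* The Lie algebra is the tangent space at 1, i.e. ['rV[R]_n] through the chart
   at 1. *)
Definition left_invariant (x : 'rV[R]_n) (d : D) : 'rV[R]_n :=
  x *m tmap LD LD (fun b : D => (d * b)%g) 1%g.

Definition lie_br (x y : 'rV[R]_n) : 'rV[R]_n :=
  vf_bracket LD (left_invariant x) (left_invariant y) 1%g.

Definition one_parameter_subgroup (x : 'rV[R]_n) (c : R -> D) : Prop :=
  [/\ forall s t, c (s + t) = (c s * c t)%g, smooth_curve LD c &
      has_velocity LD c 0 x].

Definition lexp (x : 'rV[R]_n) : D :=
  xget (fun=> 1%g) [set c : R -> D | one_parameter_subgroup x c] 1.

Section Generators.
Variables (M : topologicalType) (k : nat) (MM : manifold_on R [set: M] k).
Variable (a : D -> M -> M).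

(* x_M(m) is the velocity at t = 0 of exp(-tx).m *)
Definition generator (x : 'rV[R]_n) (m : M) : 'rV[R]_k :=
  'D_(1 : R^o) (fun t : R^o => chart_at MM m (a (lexp (- t *: x)) m)) (0 : R^o).

(* The rows are (e_i)_M(m), for the standard basis (e_i). *)
Definition generator_mx (m : M) : 'M[R]_(n, k) :=
  \matrix_(i < n) generator (delta_mx 0 i) m.

Definition tensor2_M (t : 'M[R]_n) (m : M) : 'M[R]_k :=
  (generator_mx m)^T *m t *m generator_mx m.

Definition tensor3_M (t : 'I_n -> 'I_n -> 'I_n -> R) (m : M)
    (u v w : 'rV[R]_k) : R :=
  \sum_(i < n) \sum_(j < n) \sum_(l < n)
    t i j l * dotv u (row i (generator_mx m))
            * dotv v (row j (generator_mx m))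
            * dotv w (row l (generator_mx m)).

End Generators.
End LieGroups.

(** ** Manin pairs and quasi-triples *)

(* d = R^(n+n) with bracket [br] and form of Gram matrix [B]; g = R^n is included
   in d by the matrix [E], whose rows are the basis (e_i). Its dual g^* is R^n,
   with the dual basis.  Subspaces of d are row spaces of matrices. *)
Section Manin.
Variables (R : realType) (n : nat).
Variables (br : 'rV[R]_(n + n) -> 'rV[R]_(n + n) -> 'rV[R]_(n + n)).
Variables (B : 'M[R]_(n + n)) (E : 'M[R]_(n, n + n)).

Definition isotropic (p : nat) (W : 'M[R]_(p, n + n)) : Prop :=
  W *m B *m W^T = 0.

Definition manin_pair : Prop :=
  [/\ [/\ B^T = B, B \in unitmx,
          (exists2 Q, Q \in unitmx &
            Q *m B *m Q^T = block_mx 1%:M 0 0 (- 1%:M)) &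
          forall x y z, bform B (br x y) z = bform B x (br y z)],
      row_free E,
      (forall x y, (x <= E)%MS -> (y <= E)%MS -> (br x y <= E)%MS),
      isotropic E &
      forall W : 'M[R]_(n + n), isotropic W -> (E <= W)%MS -> (W <= E)%MS].

Definition isotropic_complement (h : 'M[R]_(n + n)) : Prop :=
  [/\ isotropic h, (1%:M <= E + h)%MS & (E :&: h)%MS = 0].

(* The rows of [jmx h] are the j(eps^i): j maps g^* to h and satisfies
   (j xi | x) = <xi, x>. *)
Definition jmx (h : 'M[R]_(n + n)) : 'M[R]_(n, n + n) :=
  xget 0 [set J : 'M[R]_(n, n + n) | (J <= h)%MS /\ J *m B *m E^T = 1%:M].

(* coordinates of p_g v in g, and of j^-1 (p_h v) in g^* *)
Definition gcoord (h : 'M[R]_(n + n)) (v : 'rV[R]_(n + n)) : 'rV[R]_n :=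
  v *m proj_mx <<E>>%MS h *m pinvmx E.
Definition hcoord (h : 'M[R]_(n + n)) (v : 'rV[R]_(n + n)) : 'rV[R]_n :=
  v *m proj_mx h <<E>>%MS *m pinvmx (jmx h).

Definition Fh (h : 'M[R]_(n + n)) (x : 'rV[R]_n) : 'M[R]_n :=
  \matrix_(i < n, j < n)
    dotv (hcoord h (br (row i (jmx h)) (row j (jmx h)))) x.

Definition phih (h : 'M[R]_(n + n)) (i j l : 'I_n) : R :=
  gcoord h (br (row i (jmx h)) (row j (jmx h))) 0 l.

(* twist from h to h': the row i is (j' - j)(eps^i), in coordinates of g *)
Definition twist (h h' : 'M[R]_(n + n)) : 'M[R]_n :=
  (jmx h' - jmx h) *m pinvmx E.

End Manin.

(** ** Quotient spaces *)

Section Quotients.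
Variables (T : topologicalType) (c : T -> set T).

Lemma same_class_equiv :
  equiv_class_of (fun x y : T => `[< c x = c y >]).
Proof.
split=> [x|x y|y x z]; first exact/asboolP.
- by apply/asboolP/asboolP.
- by move=> /asboolP ->; apply/asboolP/asboolP => ->.
Qed.

Canonical same_class := EquivRelPack same_class_equiv.

(* Quotient, with the quotient topology, of [T] by the relation "same class";
   [c] is meant to be the map sending a point to its orbit (or coset). *)
Definition class_space := quotient_topology {eq_quot same_class}%qT.

Definition qproj : T -> class_space := \pi_class_space%qT.

End Quotients.

(* [X] with the finest topology such that the restriction of [p] to the subspace
   [N] of [T] is continuous.  On [p @` N] it is the quotient topology coming
   from [N], which may be strictly finer than the topology induced by [X]: when
   [N] is a level set of the moment map, [p @` N] need not be embedded. *)
Definition final_space (T : topologicalType) (X : choiceType) (p : T -> X)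
  (N : set T) : Type := X.

Section FinalSpace.
Variables (T : topologicalType) (X : choiceType) (p : T -> X) (N : set T).

HB.instance Definition _ := Choice.on (final_space p N).

Definition final_open (A : set X) : Prop :=
  open ((p \o set_val : set_type N -> X) @^-1` A).

Lemma final_openT : final_open setT.
Proof. by rewrite /final_open preimage_setT; exact: openT. Qed.
Lemma final_openI A A' : final_open A -> final_open A' -> final_open (A `&` A').
Proof. exact: openI. Qed.
Lemma final_open_bigU (I : Type) (F : I -> set X) :
  (forall i, final_open (F i)) -> final_open (\bigcup_i F i).
Proof.
by move=> oF; rewrite /final_open preimage_bigcup; apply: bigcup_open => i _; exact: oF.
Qed.

HB.instance Definition _ := isOpenTopological.Build (final_space p N)
  final_openT final_openI final_open_bigU.

End FinalSpace.

(** ** Group pairs and quasi-hamiltonian spaces *)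

(* A closed Lie subgroup is given as a Lie group with an injective immersive
   morphism of closed image.  [gp_metric] is the bi-invariant scalar product on
   the manifold D; its value at 1 is the form of the Manin pair. *)
Record group_pair (R : realType) (n : nat) (D G : spaceGroupType) := GroupPair {
  gpD : lie_group R (n + n) D;
  gpG : lie_group R n G;
  gp_incl : G -> D;
  gp_metric : D -> 'M[R]_(n + n);
  gp_D_connected : connected [set: D];
  gp_G_connected : connected [set: G];
  gp_inclM : forall a b, gp_incl (a * b)%g = (gp_incl a * gp_incl b)%g;
  gp_incl_inj : injective gp_incl;
  gp_incl_smooth : smooth_map gpG gpD [set: G] gp_incl;
  gp_incl_immersion : forall a, row_free (tmap gpG gpD gp_incl a);
  gp_incl_closed : closed (range gp_incl);
  gp_metric_left : forall a b,
    let L := tmap gpD gpD (fun z : D => (a * z)%g) b in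
    L *m gp_metric (a * b)%g *m L^T = gp_metric b;
  gp_metric_right : forall a b,
    let L := tmap gpD gpD (fun z : D => (z * a)%g) b in
    L *m gp_metric (b * a)%g *m L^T = gp_metric b;
  gp_manin : manin_pair (lie_br gpD) (gp_metric 1%g) (tmap gpG gpD gp_incl 1%g) }.

Section GroupPair.
Variables (R : realType) (n : nat) (D G : spaceGroupType).
Variable (gp : group_pair R n D G).

Definition gp_form : 'M[R]_(n + n) := gp_metric gp 1%g.
Definition gp_E : 'M[R]_(n, n + n) := tmap (gpG gp) (gpD gp) (gp_incl gp) 1%g.
Definition gp_br := lie_br (gpD gp).
Definition gp_complement := isotropic_complement gp_form gp_E.

(* S = D/G, as a topological space *)
Definition left_coset (d : D) : set D := [set (d * gp_incl gp g)%g | g in [set: G]].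
Definition DG := class_space left_coset.

Definition dressing (d : D) (s : DG) : DG := qproj left_coset (d * repr s)%g.

(* The smooth structure of D/G is the one for which D -> D/G is a submersion. *)
Record DG_manifold := DGManifold {
  DG_mf :> manifold_on R [set: DG] n;
  DG_submersion : submersion (gpD gp) DG_mf [set: D] (qproj left_coset) }.

Variable (MS : DG_manifold).

Definition admissible (h : 'M[R]_(n + n)) (s : DG) : Prop :=
  forall v : 'rV[R]_n, exists! xi : 'rV[R]_(n + n),
    (xi <= h)%MS /\ generator (gpD gp) MS dressing xi s = v.

Definition hat_form (h : 'M[R]_(n + n)) (x : 'rV[R]_n) (s : DG) : 'rV[R]_n :=
  xget 0 [set a : 'rV[R]_n | forall xi : 'rV[R]_(n + n), (xi <= h)%MS ->
    dotv a (generator (gpD gp) MS dressing xi s)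
      = - bform gp_form (x *m gp_E) xi].

Variables (M : topologicalType) (k : nat) (MM : manifold_on R [set: M] k).
Variable (a : lie_action (gpG gp) MM).

Definition quasi_poisson (h : 'M[R]_(n + n)) (P : M -> 'M[R]_k) : Prop :=
  [/\ bivector_field MM P,
      (forall f1 f2 f3, smooth_fun MM setT f1 -> smooth_fun MM setT f2 ->
         smooth_fun MM setT f3 -> forall m,
         bracket MM P f1 (bracket MM P f2 f3) m
         + bracket MM P f2 (bracket MM P f3 f1) m
         + bracket MM P f3 (bracket MM P f1 f2) m
         = tensor3_M (gpG gp) MM a (phih gp_br gp_form gp_E h) m
             (dfun MM f1 m) (dfun MM f2 m) (dfun MM f3 m)) &
      (forall (x : 'rV[R]_n) f1 f2, smooth_fun MM setT f1 ->
         smooth_fun MM setT f2 -> forall m,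
         let xM := vapp MM (generator (gpG gp) MM a x) in
         xM (bracket MM P f1 f2) m
         - bracket MM P (xM f1) f2 m - bracket MM P f1 (xM f2) m
         = bform (- tensor2_M (gpG gp) MM a (Fh gp_br gp_form gp_E h x) m)
             (dfun MM f1 m) (dfun MM f2 m))].

(* The bivector field attached to the complement [h], given the one, [P0],
   attached to [h0]. *)
Definition twisted_bivector (h0 : 'M[R]_(n + n)) (P0 : M -> 'M[R]_k)
    (h : 'M[R]_(n + n)) : M -> 'M[R]_k :=
  fun m => P0 m - tensor2_M (gpG gp) MM a (twist gp_form gp_E h0 h) m.

Definition moment_map (h0 : 'M[R]_(n + n)) (P0 : M -> 'M[R]_k) (mu : M -> DG) :
    Prop :=
  [/\ smooth_map MM MS setT mu,
      (forall g m, mu (a g m) = dressing (gp_incl gp g) (mu m)) &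
      forall (Omega : set M) (h : 'M[R]_(n + n)), open Omega ->
        gp_complement h -> (forall s, (mu @` Omega) s -> admissible h s) ->
        forall (x : 'rV[R]_n) (m : M), Omega m ->
          sharp (twisted_bivector h0 P0 h m)
                (hat_form h x (mu m) *m (tmap MM MS mu m)^T)
          = generator (gpG gp) MM a x m].

Definition quasi_hamiltonian (h0 : 'M[R]_(n + n)) (P0 : M -> 'M[R]_k)
    (mu : M -> DG) : Prop :=
  [/\ gp_complement h0, quasi_poisson h0 P0 & moment_map h0 P0 mu].

Definition nondegenerate_at (h0 : 'M[R]_(n + n)) (P0 : M -> 'M[R]_k)
    (mu : M -> DG) (m : M) : Prop :=
  exists h, [/\ gp_complement h, admissible h (mu m) &
    bijective (sharp (twisted_bivector h0 P0 h m))].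

Definition G_orbit (m : M) : set M := [set a g m | g in [set: G]].
Definition MG := class_space G_orbit.

(* [PU] is the bivector field on the manifold [U] in M/G whose bracket is the
   bracket of G-invariant functions on M. *)
Definition reduced_bivector (P0 : M -> 'M[R]_k) (U : set MG) (q : nat)
    (MU : manifold_on R U q) (PU : MG -> 'M[R]_q) : Prop :=
  bivector_field MU PU /\
  forall f1 f2, smooth_fun MU U f1 -> smooth_fun MU U f2 ->
    forall m, U (qproj G_orbit m) ->
      bracket MU PU f1 f2 (qproj G_orbit m)
      = bracket MM P0 (f1 \o qproj G_orbit) (f2 \o qproj G_orbit) m.

End GroupPair.

(* Main.v *)
(* On a point m over U, the moment map equation says that the fields P^#(mu^* l) are tangent to the
   G-orbits, so functions pulled back by mu and by p Poisson commute. When mu is submersive at m and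
   P is nondegenerate, the Hamiltonian vectors P^#(p^* b) therefore span the kernel of d mu, as soon
   as dim M <= n + dim U; that inequality holds because the fibres of p are G-orbits, and a
   countable union of Lipschitz images of n-dimensional balls has empty interior in R^d for d > n.
   A Hamiltonian curve in U then lifts to a Hamiltonian curve in M along which mu is constant, and
   which equivariance moves into mu^-1(s): the leaf lies in the component. Conversely, flows of
   pulled back functions reach a neighbourhood in mu^-1(s) of each of its points, so the leaf is
   open and closed in the part of p(mu^-1(s)) over U, for the final topology. *)

Require Import Defs.
From HB Require Import structures.
From mathcomp Require Import all_boot all_order all_algebra.
From mathcomp Require Import all_classical all_reals all_analysis.
From mathcomp Require Import ring lra.
From Stdlib Require Import Relation_Operators.

Set Implicit Arguments.
Unset Strict Implicit.
Unset Printing Implicit Defensive.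

Import Order.TTheory GRing.Theory Num.Theory.
Import numFieldNormedType.Exports.

Local Open Scope classical_set_scope.
Local Open Scope ring_scope.

(** Three definitions force detours. The moment map equation is asserted only over open sets on
    which one complement is admissible, so admissibility has to be an open condition. The bivector
    axioms and the reduced bracket are tested on globally smooth functions, so local computations
    pass through extensions by bump functions. [generator] goes through [lexp], which has a default
    value: a direction without a one-parameter subgroup has zero generator, and admissibility, which
    makes generators injective on the complement, excludes such directions there. The fibre of p
    through a point is known to be an orbit only as a set: of the kernel of dp one knows that it
    contains the generators, not that they span it. This is why the bound on dim M rests on a Baire
    argument and not on a count of tangent vectors. For time-one maps, strict differentiability at
    the zero Hamiltonian takes the place of smooth dependence on parameters. It feeds a contraction
    argument, which serves once more to solve for points in the fibres of p. *)

HB.instance Definition _ (R : realType) m n :=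
  Uniform_isComplete.Build 'M[R]_(m, n) (@mx_complete _ m n).

(** * Differential calculus *)

Section Differentials.
Variable R : realType.
Implicit Types U V W : normedModType R.

Lemma diff_eps V W (f : V -> W) x : differentiable f x ->
  forall e : R, 0 < e ->
  \forall y \near x, `|f y - f x - 'd f x (y - x)| <= e * `|y - x|.
Proof.
move=> df e e0; have /eqaddoP/(_ e e0) := diff_locally df.
rewrite near_simpl => /nbhs_normP[d /= d0 H]; apply/nbhs_normP.
exists d => //= y xy.
have := H (y - x); rewrite /= sub0r normrN distrC => /(_ xy).
by rewrite !fctE /= subrK opprD addrA.
Qed.

Lemma eps_diff V W (f : V -> W) x (L : {linear V -> W}) : continuous L ->
  (forall e : R, 0 < e ->
    \forall y \near x, `|f y - f x - L (y - x)| <= e * `|y - x|) ->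
  differentiable f x /\ 'd f x = L :> (V -> W).
Proof.
move=> cL H.
have E : f \o shift x = cst (f x) + L +o_ 0 id.
  apply/eqaddoP => e e0; have /nbhs_normP[d /= d0 Hd] := H e e0.
  rewrite near_simpl; apply/nbhs_normP; exists d => //= y.
  rewrite /= sub0r normrN => yd; have := Hd (y + x).
  by rewrite /= addrK opprD addrCA subrr addr0 normrN => /(_ yd); rewrite !fctE /= opprD addrA.
have D := diff_unique cL E; split => //.
apply/diff_locallyP; rewrite D; split => //.
Qed.

Lemma near_eq_diff V W (f g : V -> W) x : (\forall y \near x, f y = g y) ->
  differentiable f x -> differentiable g x /\ 'd g x = 'd f x :> (V -> W).
Proof.
move=> fg df; apply: eps_diff; first by apply: diff_continuous.
move=> e e0; have H := diff_eps df e0; have fx := nbhs_singleton fg.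
by near=> y; rewrite -fx -(near fg y) //; near: y.
Unshelve. all: by end_near. Qed.

End Differentials.

Section Ck_theory.
Variable R : realType.
Implicit Types U V W : normedModType R.

(** Openness of A is what lets equality on A pass to the differentials, which depend on a whole
    neighbourhood. *)
Lemma Ck_eq U W k (A : set U) (f g : U -> W) :
  open A -> (forall x, A x -> f x = g x) -> Ck k A f -> Ck k A g.
Proof.
move=> oA; elim: k f g => [|k IH] f g fg.
  move=> Cf x Ax; have nA : nbhs x A by exact: open_nbhs_nbhs.
  have := Cf x Ax; rewrite /prop_for /continuous_at -fg //; apply: cvg_trans.
  by apply: near_eq_cvg; near=> y; apply: fg; near: y.
have E x : A x -> \forall y \near x, f y = g y.
  move=> Ax; have nA : nbhs x A by exact: open_nbhs_nbhs.
  by near=> y; apply: fg; near: y.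
case=> df Cf; split=> [x Ax|v]; first by have [] := near_eq_diff (E x Ax) (df x Ax).
apply: IH (Cf v) => x Ax.
by have [_ ->] := near_eq_diff (E x Ax) (df x Ax).
Unshelve. all: by end_near. Qed.

Lemma Ck_S U W k (A : set U) (f : U -> W) : Ck k.+1 A f -> Ck k A f.
Proof.
elim: k f => [|k IH] f [df Cf]; last by split=> // v; exact/IH.
by move=> x Ax; apply: differentiable_continuous; exact: df.
Qed.

Lemma Ck_sub U W k (A B : set U) (f : U -> W) : B `<=` A -> Ck k A f -> Ck k B f.
Proof.
move=> BA; elim: k f => [|k IH] f; first by move=> Cf x /BA; exact: Cf.
by case=> df Cf; split=> [x /BA/df//|v]; apply: IH (Cf v).
Qed.

Lemma Ck_cst U W k (A : set U) (c : W) : Ck k A (fun _ : U => c).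
Proof.
elim: k c => [|k IH] c; first by move=> x _; exact: cvg_cst.
split=> [x _|v]; first exact: differentiable_cst.
rewrite (_ : (fun x => _) = fun=> 0) //.
by apply/funext => x; rewrite diff_cst.
Qed.

Lemma Ck_lin U V W k (A : set U) (f : U -> V) (L : {linear V -> W}) :
  continuous L -> open A -> Ck k A f -> Ck k A (L \o f).
Proof.
move=> cL oA; elim: k f => [|k IH] f.
  by move=> Cf x Ax; apply: continuous_comp; [exact: Cf|exact: cL].
case=> df Cf; split=> [x Ax|v].
  by apply: differentiable_comp; [exact: df|exact: linear_differentiable].
apply: Ck_eq (IH _ (Cf v)) => // x Ax.
by rewrite diff_comp ?diff_lin//; [exact: df|exact: linear_differentiable].
Qed.

Lemma Ck_D U W k (A : set U) (f g : U -> W) : open A ->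
  Ck k A f -> Ck k A g -> Ck k A (fun x => f x + g x).
Proof.
move=> oA; elim: k f g => [|k IH] f g.
  by move=> Cf Cg x Ax; apply: cvgD; [exact: Cf|exact: Cg].
case=> df Cf [dg Cg]; split=> [x Ax|v].
  by apply: differentiableD; [exact: df|exact: dg].
apply: Ck_eq (IH _ _ (Cf v) (Cg v)) => // x Ax.
by rewrite diffD; [|exact: df|exact: dg].
Qed.

Lemma Ck_sum U W k (A : set U) (I : Type) (s : seq I) (f : I -> U -> W) : open A ->
  (forall i, Ck k A (f i)) -> Ck k A (fun x => \sum_(i <- s) f i x).
Proof.
move=> oA Cf; elim: s => [|i s IH].
  by under eq_fun do rewrite big_nil; exact: Ck_cst.
under eq_fun do rewrite big_cons.
by apply: (Ck_D oA).
Qed.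

Lemma Ck_M U k (A : set U) (f g : U -> R^o) : open A ->
  Ck k A f -> Ck k A g -> Ck k A (fun x => f x * g x : R^o).
Proof.
move=> oA; elim: k f g => [|k IH] f g.
  by move=> Cf Cg x Ax; apply: cvgM; [exact: Cf|exact: Cg].
move=> Cf Cg; have [df Df] := Cf; have [dg Dg] := Cg; split=> [x Ax|v].
  by apply: differentiableM; [exact: df|exact: dg].
have H := Ck_D oA (IH _ _ (Ck_S Cf) (Dg v)) (IH _ _ (Ck_S Cg) (Df v)).
apply: Ck_eq H => // x Ax.
by rewrite diffM; [|exact: df|exact: dg].
Qed.

(** Finite dimension in the form used by the chain rule: continuous coordinates that reconstruct
    each vector. One proof of [Ck_comp] then covers row vectors, the line and products. *)
Definition fin_basis V := exists N (e : 'I_N -> V) (c : 'I_N -> {linear V -> R^o}),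
  (forall i, continuous (c i)) /\ forall v, v = \sum_i c i v *: e i.

Lemma linear_pack V W (f : V -> W) : linear f -> exists g : {linear V -> W}, g = f :> (V -> W).
Proof.
move=> lf; pose fM := GRing.isLinear.Build _ _ _ _ _ lf.
by exists (HB.pack_for {linear V -> W} f fM).
Qed.

Lemma fin_basis_rV n : fin_basis 'rV[R]_n.
Proof.
have /choice[c Hc] : forall i : 'I_n, exists g : {linear 'rV[R]_n -> R^o}, g = (fun v => v 0 i) :> (_ -> _).
  by move=> i; apply: linear_pack => a u v; rewrite !mxE.
exists n, (fun i => delta_mx 0 i), c; split=> [i|v].
  by rewrite Hc; exact: coord_continuous.
by rewrite {1}(row_sum_delta v); apply: eq_bigr => i _; rewrite Hc.
Qed.

Lemma fin_basis_R : fin_basis R^o.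
Proof.
have [c Hc] : exists g : {linear R^o -> R^o}, g = id :> (_ -> _).
  by apply: linear_pack => a u v.
exists 1%N, (fun=> 1), (fun=> c); split=> [i|v]; first by rewrite Hc => ?; exact: cvg_id.
by rewrite big_ord1 Hc /= /GRing.scale /= mulr1.
Qed.

Lemma fin_basis_prod V W : fin_basis V -> fin_basis W -> fin_basis (V * W)%type.
Proof.
case=> n1 [e1 [c1 [C1 E1]]] [n2 [e2 [c2 [C2 E2]]]].
have /choice[c Hc] : forall i : 'I_(n1 + n2), exists g : {linear (V * W)%type -> R^o},
    g = (fun v => match fintype.split i with inl i => c1 i v.1 | inr i => c2 i v.2 end) :> (_ -> _).
  move=> i; case: (fintype.split i) => j; apply: linear_pack => a u v; exact: linearP.
exists (n1 + n2)%N, (fun i => match fintype.split i with inl i => (e1 i, 0) | inr i => (0, e2 i) end), c;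
    split=> [i|[v w]].
  rewrite Hc; case: (fintype.split i) => j u.
    apply: continuous_comp; [exact: cvg_fst|exact: C1].
  apply: continuous_comp; [exact: cvg_snd|exact: C2].
rewrite big_split_ord /=.
under eq_bigr do rewrite Hc (unsplitK (inl _)) /=.
under [X in _ + X]eq_bigr do rewrite Hc (unsplitK (inr _)) /=.
rewrite {1}(E1 v) {1}(E2 w).
have -> (I := 'I_n1) (F : I -> R) (G : I -> V) : \sum_i F i *: (G i, 0 : W) = (\sum_i F i *: G i, 0).
  elim/big_rec2: _ => // i x y _ H; rewrite H; rewrite -[F i *: (G i, 0)]/(F i *: G i, F i *: 0) scaler0.
  by rewrite -[LHS]/(_ + _, _ + _) addr0.
have -> (I := 'I_n2) (F : I -> R) (G : I -> W) : \sum_i F i *: (0 : V, G i) = (0, \sum_i F i *: G i).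
  elim/big_rec2: _ => // i x y _ H; rewrite H; rewrite -[F i *: (0, G i)]/(F i *: 0, F i *: G i) scaler0.
  by rewrite -[LHS]/(_ + _, _ + _) addr0.
by rewrite -[RHS]/(_ + _, _ + _) addr0 add0r.
Qed.

(** In coordinates of V, the differential of the composite in a direction v is a sum of products of
    a coordinate of df(v) and a partial derivative of g composed with f. Both factors are of class
    one less, so induction on k closes with the product rule. *)
Lemma Ck_comp U V k (A : set U) (B : set V) (f : U -> V) (g : V -> R^o) :
  fin_basis V -> open A -> (forall x, A x -> B (f x)) ->
  Ck k A f -> Ck k B g -> Ck k A (g \o f).
Proof.
case=> N [e [c [Cc E]]] oA AB; elim: k f g AB => [|k IH] f g AB.
  by move=> Cf Cg x Ax; apply: continuous_comp; [exact: Cf|exact/Cg/AB].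
move=> Cf Cg; have [df Df] := Cf; have [dg Dg] := Cg; split=> [x Ax|v].
  by apply: differentiable_comp; [exact: df|exact/dg/AB].
have H : Ck k A (fun x => \sum_i c i ('d f x v) * 'd g (f x) (e i) : R^o).
  apply: Ck_sum => // i; apply: (@Ck_M _ _ _ (fun x => c i ('d f x v)) (fun x => 'd g (f x) (e i))) => //.
    by apply: (@Ck_lin _ _ _ _ _ (fun x => 'd f x v) (c i)) => //; exact: Df.
  by apply: (IH f (fun y => 'd g y (e i))) => //; [exact: Ck_S|exact: Dg].
apply: Ck_eq H => // x Ax /=.
rewrite (diff_comp (df x Ax) (dg (f x) (AB x Ax))).
rewrite /= {2}(E ('d f x v)) linear_sum; apply: eq_bigr => i _.
by rewrite linearZ.
Qed.
End Ck_theory.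

Section coordinates.
Variable R : realType.
Implicit Types V W : normedModType R.

Lemma rV_norm_le n (v : 'rV[R]_n) e : 0 <= e -> (`|v| <= e) <-> (forall i, `|v 0 i| <= e).
Proof.
move=> e0; rewrite /Num.Def.normr /= mx_normrE; split=> [H i|H].
  by apply: le_trans H; apply: (le_bigmax _ (fun ij : 'I_1 * 'I_n => `|v ij.1 ij.2|) (0, i)).
by apply: bigmax_le => // -[i j] _ /=; rewrite ord1; exact: H.
Qed.

Lemma mulmx_bound n m (A : 'M[R]_(n, m)) : exists2 C, 0 < C & forall v : 'rV[R]_n, `|v *m A| <= C * `|v|.
Proof.
exists (1 + \sum_i \sum_j `|A i j|).
  by rewrite ltr_pwDl// sumr_ge0 // => i _; apply: sumr_ge0.
move=> v; have C0 : 0 <= \sum_i \sum_j `|A i j| by rewrite sumr_ge0 // => i _; apply: sumr_ge0.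
apply/rV_norm_le; first by rewrite mulr_ge0 // addr_ge0.
move=> j; rewrite mxE; apply: le_trans (ler_norm_sum _ _ _) _.
apply: (@le_trans _ _ (\sum_i `|A i j| * `|v|)).
  apply: ler_sum => i _; rewrite normrM mulrC ler_wpM2l //.
  by apply: (rV_norm_le v (normr_ge0 v)).1.
rewrite -mulr_suml ler_wpM2r //.
apply: (@le_trans _ _ (\sum_i \sum_j `|A i j|)); last by rewrite lerDr.
apply: ler_sum => i _; rewrite (bigD1 j) //= lerDl; exact: sumr_ge0.
Qed.

Lemma linear_coord n (i : 'I_n) : exists2 c : {linear 'rV[R]_n -> R^o}, continuous c & c = (fun v => v 0 i)
    :> (_ -> _).
Proof.
have [c Hc] : exists g : {linear 'rV[R]_n -> R^o}, g = (fun v => v 0 i) :> (_ -> _).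
  by apply: linear_pack => a u v; rewrite !mxE.
by exists c => //; rewrite Hc; exact: coord_continuous.
Qed.

Lemma Ck_coord V n k (A : set V) (f : V -> 'rV[R]_n) : open A ->
  Ck k A f <-> forall i, Ck k A (fun x => f x 0 i : R^o).
Proof.
move=> oA; split=> [Cf i|Cf].
  by have [c cc E] := linear_coord i; have := Ck_lin cc oA Cf; rewrite E.
have /choice[e He] : forall i, exists e : {linear R^o -> 'rV[R]_n}, e = (fun x => x *: delta_mx 0 i) :> (_
    -> _).
  by move=> i; apply: linear_pack => a u v; rewrite scalerDl scalerA.
have H : Ck k A (fun x => \sum_i e i (f x 0 i)).
  apply: Ck_sum => // i; apply: (@Ck_lin _ _ _ _ _ _ (fun x => f x 0 i : R^o)) => //.
  by rewrite He => x; apply: continuousZl; exact: cvg_id.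
apply: Ck_eq H => // x Ax; rewrite [RHS]row_sum_delta; apply: eq_bigr => i _.
by rewrite He.
Qed.

Lemma smooth_coord V n (f : V -> 'rV[R]_n) x : smooth_at f x -> forall i, smooth_at (fun x => f x 0 i : R^o) x.
Proof. by case=> A [oA Ax Cf] i; exists A; split=> // k; apply/(Ck_coord _ _ oA).1. Qed.

Lemma smooth_comp V W (f : V -> W) (g : W -> R^o) x : fin_basis W ->
  smooth_at f x -> smooth_at g (f x) -> smooth_at (g \o f) x.
Proof.
move=> bW [A [oA Ax Cf]] [B [oB Bx Cg]].
have oAB : open (A `&` f @^-1` B).
  rewrite openE => y [Ay By]; apply: filterI; first exact: open_nbhs_nbhs.
  have := Cf 0%N y Ay; apply; exact: open_nbhs_nbhs.
exists (A `&` f @^-1` B); split => // k.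
by apply: Ck_comp bW oAB _ (Ck_sub _ (Cf k)) (Cg k) => // y [].
Qed.

Lemma smooth_rV V n (f : V -> 'rV[R]_n) x : (forall i, smooth_at (fun x => f x 0 i : R^o) x) -> smooth_at f x.
Proof.
move=> /choice[A HA]; exists (\bigcap_i A i); have oA : open (\bigcap_i A i).
  rewrite openE => y Ay.
  have : \forall z \near y, forall i, A i z.
    apply: filter_forall => i; have [oA _ _] := HA i.
    by apply: open_nbhs_nbhs; split => //; exact: Ay.
  by apply: filterS => z + i _; apply.
split=> //; first by move=> i _; have [] := HA i.
move=> k; apply/Ck_coord => // i; have [_ _ /(_ k)] := HA i.
by apply: Ck_sub => y /(_ i); exact.
Qed.

Lemma smooth_comp_rV V W n (f : V -> W) (g : W -> 'rV[R]_n) x : fin_basis W ->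
  smooth_at f x -> smooth_at g (f x) -> smooth_at (g \o f) x.
Proof.
move=> bW sf sg; apply: smooth_rV => i.
by apply: (@smooth_comp _ _ f (fun y => g y 0 i) x bW sf); exact: smooth_coord.
Qed.
End coordinates.

(** * Curves and ordinary differential equations *)

Section curves.
Variable R : realType.
Implicit Types V W : normedModType R.

Lemma for_continuous_near V W (f : V -> W) x (e : R) : {for x, continuous f} -> 0 < e ->
  \forall y \near x, `|f y - f x| <= e.
Proof. by move=> /cvgrPdist_le fx /fx; apply: filterS => y; rewrite distrC. Qed.

Lemma near_for_continuous V W (f : V -> W) x : (forall e : R, 0 < e ->
  \forall y \near x, `|f y - f x| <= e) -> {for x, continuous f}.
Proof. by move=> H; apply/cvgrPdist_le => e /H; apply: filterS => y; rewrite distrC. Qed.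

Lemma near_dist V (x : V) (P : V -> Prop) : (\forall y \near x, P y) <->
  exists2 d : R, 0 < d & forall y, `|y - x| < d -> P y.
Proof.
split=> [/nbhs_normP[d /= d0 H]|[d d0 H]].
  by exists d => // y; rewrite distrC => /H.
by apply/nbhs_normP; exists d => // y /=; rewrite /= distrC => /H.
Qed.

Lemma near_ord V (x : V) n (P : 'I_n -> V -> Prop) : (forall i, \forall y \near x, P i y) ->
  \forall y \near x, forall i, P i y.
Proof. exact: filter_forall. Qed.

Lemma near_and V (x : V) (P Q : V -> Prop) : (\forall y \near x, P y) -> (\forall y \near x, Q y) ->
  \forall y \near x, P y /\ Q y.
Proof. exact: filterI. Qed.

Lemma open_near V (x : V) (A : set V) : open A -> A x -> \forall y \near x, A y.
Proof. by move=> oA Ax; exact: open_nbhs_nbhs. Qed.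

Lemma is_derive_diff V (c : R -> V) (t : R) (v : V) :
  is_derive (t : R^o) (1 : R^o) (c : R^o -> V) v <->
  differentiable (c : R^o -> V) t /\ 'd (c : R^o -> V) (t : R^o) 1 = v.
Proof.
split=> [[dc <-]|[dc E]].
  by have dd := (derivable1_diffP (c : R^o -> V) t).1 dc; split; rewrite // deriveE.
split; first exact: diff_derivable.
by rewrite deriveE.
Qed.

Lemma is_derive_near V (c d : R -> V) (t : R) (v : V) : (\forall s \near (t : R^o), c s = d s) ->
  is_derive (t : R^o) (1 : R^o) (c : R^o -> V) v -> is_derive (t : R^o) (1 : R^o) (d : R^o -> V) v.
Proof.
move=> cd /is_derive_diff[dc E]; apply/is_derive_diff.
have [dd E'] := near_eq_diff cd dc.
by split; [exact: dd | rewrite E'].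
Qed.

Lemma is_derive_comp V W (c : R -> V) (f : V -> W) (t : R) (v : V) :
  differentiable f (c t) ->
  is_derive (t : R^o) (1 : R^o) (c : R^o -> V) v ->
  is_derive (t : R^o) (1 : R^o) (f \o c : R^o -> W) ('d f (c t) v).
Proof.
move=> df /is_derive_diff[dc E]; apply/is_derive_diff; split.
  exact: differentiable_comp.
by rewrite diff_comp //= E.
Qed.

Lemma is_derive_line V (x v : V) (t : R) :
  is_derive (t : R^o) (1 : R^o) (fun s : R^o => x + s *: v : V) v.
Proof.
rewrite -[X in is_derive _ _ _ X]add0r; apply: is_deriveD.
apply/is_derive_diff; have H := is_diff_scalel (t : R^o) v.
by split; [exact: ex_diff | rewrite diff_val scale1r].
Qed.

Lemma is_derive_coord n (c : R -> 'rV[R]_n) (t : R) (v : 'rV[R]_n) :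
  is_derive (t : R^o) (1 : R^o) (c : R^o -> _) v <->
  forall i, is_derive (t : R^o) (1 : R^o) (fun s => c s 0 i : R^o) (v 0 i).
Proof.
split=> [[dc <-] i|H].
  split; first exact: (derivable_mxP (c : R^o -> _) t 1).1.
  by rewrite (derive_mx dc) mxE.
have dc : derivable (c : R^o -> 'rV[R]_n) t 1.
  by apply/derivable_mxP => i j; rewrite ord1; have [] := H j.
split => //; apply/rowP => i; rewrite (derive_mx dc) mxE.
by have [_ ->] := H i.
Qed.

Lemma is_derive_cont V (c : R -> V) (t : R) (v : V) :
  is_derive (t : R^o) (1 : R^o) (c : R^o -> V) v -> {for t, continuous c}.
Proof. by move/is_derive_diff => [/differentiable_continuous]. Qed.

Lemma real_mvt (f : R -> R) (df : R -> R) (a b : R) : a <= b ->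
  (forall t, a <= t <= b -> is_derive (t : R^o) (1 : R^o) (f : R^o -> R^o) (df t)) ->
  exists2 t, a <= t <= b & f b - f a = df t * (b - a).
Proof.
move=> ab H; have [||c + E] := @MVT_segment R f df a b ab.
- move=> t /[!in_itv] /andP[/ltW at_ /ltW tb];
  by apply: H; rewrite at_.
- apply: continuous_in_subspaceT => t /[!inE] /= /[!in_itv] /H /is_derive_cont.
  exact.
by rewrite in_itv /= => ?; exists c.
Qed.

Lemma curve_mvt n (c : R -> 'rV[R]_n) (dc : R -> 'rV[R]_n) (a b K : R) (v : 'rV[R]_n) : a <= b -> 0 <= K ->
  (forall t, a <= t <= b -> is_derive (t : R^o) (1 : R^o) (c : R^o -> _) (dc t)) ->
  (forall t, a <= t <= b -> `|dc t - v| <= K) ->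
  `|c b - c a - (b - a) *: v| <= K * (b - a).
Proof.
move=> ab K0 H HK; apply/rV_norm_le; first by rewrite mulr_ge0 // subr_ge0.
move=> i; have [t tab E] := @real_mvt (fun t => c t 0 i) (fun t => dc t 0 i) a b ab
   (fun t tab => (is_derive_coord c t (dc t)).1 (H t tab) i).
rewrite !mxE; have -> : c b 0 i - c a 0 i - (b - a) * v 0 i = (dc t - v) 0 i * (b - a).
  by rewrite !mxE E; ring.
rewrite normrM (ger0_norm (_ : 0 <= b - a)) ?subr_ge0 // ler_wpM2r ?subr_ge0 //.
by apply: ((rV_norm_le (dc t - v) K0).1 _ i); exact: HK.
Qed.

Lemma curve_mvt_abs n (c : R -> 'rV[R]_n) (dc : R -> 'rV[R]_n) (a b K : R) (v : 'rV[R]_n) : 0 <= K ->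
  (forall t, `|t - a| <= `|b - a| -> is_derive (t : R^o) (1 : R^o) (c : R^o -> _) (dc t)) ->
  (forall t, `|t - a| <= `|b - a| -> `|dc t - v| <= K) ->
  `|c b - c a - (b - a) *: v| <= K * `|b - a|.
Proof.
move=> K0 H HK; have [ab|/ltW ba] := leP a b.
  have S t : a <= t <= b -> `|t - a| <= `|b - a|.
    by move=> /andP[at_ tb]; rewrite !ger0_norm ?subr_ge0 // lerD2r.
  rewrite ger0_norm ?subr_ge0 //; apply: (@curve_mvt _ c dc) => // t /S; [exact: H|exact: HK].
have S t : b <= t <= a -> `|t - a| <= `|b - a|.
  by move=> /andP[at_ tb]; rewrite !(distrC _ a) !ger0_norm ?subr_ge0 // lerD2l lerN2.
have := @curve_mvt _ c dc b a K v ba K0 (fun t h => H t (S t h)) (fun t h => HK t (S t h)).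
rewrite -normrN (distrC b a) (ger0_norm (_ : 0 <= a - b)) ?subr_ge0 //; congr (_ <= _).
by congr `|_|; apply/rowP => i; rewrite !mxE; ring.
Qed.

End curves.

(** * Strict differentiability and local Lipschitz bounds *)

Section strict_diff.
Variable R : realType.

Lemma min_radius n (P : 'I_n -> R -> Prop) :
  (forall i, exists2 d, 0 < d & P i d) -> (forall i d d', d' <= d -> P i d -> P i d') ->
  exists2 d, 0 < d & forall i, P i d.
Proof.
move=> H mono; have /choice[d Hd] : forall i, exists d, 0 < d /\ P i d.
  by move=> i; have [d ? ?] := H i; exists d.
exists (\big[Num.min/1]_i d i).
  by apply/bigmin_gtP; split => // i _; have [] := Hd i.
move=> i; have [_] := Hd i; apply: mono.
exact: bigmin_le.
Qed.

Lemma linear_row (W : normedModType R) n (v : 'rV[R]_n) (L : {linear 'rV[R]_n -> W}) :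
  L v = \sum_i v 0 i *: L (delta_mx 0 i).
Proof. by rewrite {1}(row_sum_delta v) linear_sum; apply: eq_bigr => i _; rewrite linearZ. Qed.

Lemma linear_close (W : normedModType R) n (L1 L2 : {linear 'rV[R]_n -> W}) (v : 'rV[R]_n) (e : R) : 0 < e ->
  (forall i, `|L1 (delta_mx 0 i) - L2 (delta_mx 0 i)| <= e) ->
  `|L1 v - L2 v| <= n%:R * e * `|v|.
Proof.
move=> e0 H; rewrite (linear_row v L1) (linear_row v L2) -sumrB.
apply: le_trans (ler_norm_sum _ _ _) _.
apply: (@le_trans _ _ (\sum_(i < n) e * `|v|)).
  apply: ler_sum => i _; rewrite -scalerBr normrZ mulrC.
  by apply: ler_pM => //; apply: (rV_norm_le v (normr_ge0 _)).1.
by rewrite sumr_const card_ord -[X in X <= _]mulr_natl mulrA.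
Qed.

(** Strict differentiability at x: both points move. This gives Lipschitz bounds near x, contraction
    estimates, and injectivity transversally to the kernel of A, none of which follow from
    differentiability at x alone. *)
Definition sdiff n m (f : 'rV[R]_n -> 'rV[R]_m) x (A : 'M[R]_(n, m)) :=
  forall e : R, 0 < e -> exists2 d : R, 0 < d & forall y z,
    `|y - x| < d -> `|z - x| < d -> `|f y - f z - (y - z) *m A| <= e * `|y - z|.

Lemma sdiff_real n (f : 'rV[R]_n -> R^o) (A : set 'rV[R]_n) x : open A -> A x -> Ck 1 A f ->
  forall e : R, 0 < e -> exists2 d : R, 0 < d & forall y z,
    `|y - x| < d -> `|z - x| < d -> `|(f y : R) - (f z : R) - ('d f x (y - z) : R)| <= e * `|y - z|.
Proof.
move=> oA Ax [df Df] e e0.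
(* [linear_close] adds up n coordinate errors; n + 1 keeps the quotient meaningful for n = 0. *)
pose e' := e / (n.+1)%:R.
have e'0 : 0 < e' by rewrite divr_gt0.
have [d d0 Hd] := (near_dist _ _).1 (near_and (open_near oA Ax)
  (near_ord (fun i : 'I_n => for_continuous_near (Df (delta_mx 0 i) x Ax) e'0))).
exists d => // y z yx zx.
have Hs t : 0 <= t <= 1 -> `|z + t *: (y - z) - x| < d.
  move=> /andP[t0 t1];
  have -> : z + t *: (y - z) - x = t *: (y - x) + (1 - t) *: (z - x).
    by apply/rowP => i; rewrite !mxE; ring.
  apply: le_lt_trans (ler_normD _ _) _.
  rewrite !normrZ (ger0_norm t0) ger0_norm ?subr_ge0 //.
  have [->|tn0] := eqVneq t 0.
    by rewrite mul0r add0r subr0 mul1r.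
  have tp : 0 < t by rewrite lt_neqAle eq_sym tn0.
  have -> : d = t * d + (1 - t) * d by ring.
  by rewrite ltr_leD // ?ltr_pM2l // ?ler_wpM2l ?subr_ge0 // ltW.
have [t t01 E] := @real_mvt _ (fun t => f (z + t *: (y - z))) (fun t => 'd f (z + t *: (y - z)) (y - z)) 0
    1 ler01
  (fun t h => @is_derive_comp R _ _ (fun t => z + t *: (y - z)) f t (y - z) (df _ (Hd _ (Hs t h)).1)
      (is_derive_line z (y - z) t)).
move: E; rewrite scale1r scale0r addr0 addrCA subrr addr0 subr0 mulr1 => ->.
have [_ H] := Hd _ (Hs t t01).
move: (z + t *: (y - z)) H => w H; move: (y - z) => v.
have H2 := @linear_close R^o n ('d f w) ('d f x) v e' e'0 H.
apply: le_trans (H2 : `|('d f w v : R) - ('d f x v : R)| <= _) _.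
by rewrite ler_wpM2r // /e' mulrA ler_pdivrMr // mulrC ler_wpM2l ?ler_nat // ltW.
Qed.

Lemma smooth_C1 (V W : normedModType R) (f : V -> W) x : smooth_at f x -> exists A, [/\ open A, A x & Ck 1 A f].
Proof. by case=> A [oA Ax Cf]; exists A; split=> //; exact: (Cf 1%N). Qed.

Lemma smooth_diff (V W : normedModType R) (f : V -> W) x : smooth_at f x -> differentiable f x.
Proof. by case/smooth_C1 => A [oA Ax [df _]]; exact: df. Qed.

Lemma mul_jacobian n m (f : 'rV[R]_n -> 'rV[R]_m) x v : differentiable f x -> v *m jacobian f x = 'd f x v.
Proof. by move=> df; rewrite -deriveEjacobian // deriveE. Qed.

Lemma diff_coord (V : normedModType R) n (f : V -> 'rV[R]_n) x v i : differentiable f x ->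
  differentiable (fun y => f y 0 i : R^o) x /\ 'd (fun y => f y 0 i : R^o) x v = 'd f x v 0 i.
Proof.
move=> df; have [c cc E] := linear_coord R i.
have -> : (fun y => f y 0 i : R^o) = c \o f by apply/funext => y /=; rewrite E.
split; first by apply: differentiable_comp => //; exact: linear_differentiable.
by rewrite (diff_comp df (linear_differentiable _ cc)) diff_lin //= E.
Qed.

Lemma smooth_sdiff n m (f : 'rV[R]_n -> 'rV[R]_m) x : smooth_at f x -> sdiff f x (jacobian f x).
Proof.
move=> sf e e0; have df := smooth_diff sf; have [A [oA Ax Cf]] := smooth_C1 sf.
have [|i d d' d'd Hd y z yd zd|d d0 Hd] := @min_radius m (fun i d => forall y z, `|y - x| < d -> `|z - x| < d ->
    `|f y 0 i - f z 0 i - 'd (fun y => f y 0 i : R^o) x (y - z)| <= e * `|y - z|).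
- by move=> i; have [d d0 H] := sdiff_real oA Ax ((Ck_coord _ _ oA).1 Cf i) e0; exists d.
- by apply: Hd; exact: lt_le_trans d'd.
exists d => // y z yd zd; apply/rV_norm_le; first by rewrite mulr_ge0 // ltW.
move=> i; rewrite mul_jacobian // !mxE.
have [_ <-] := diff_coord (y - z) i df.
exact: Hd.
Qed.

Lemma sdiff_lip n m (f : 'rV[R]_n -> 'rV[R]_m) x A : sdiff f x A ->
  exists2 d : R, 0 < d & exists2 C : R, 0 < C & forall y z,
    `|y - x| < d -> `|z - x| < d -> `|f y - f z| <= C * `|y - z|.
Proof.
move=> /(_ 1 ltr01)[d d0 H]; exists d => //; have [C C0 HC] := mulmx_bound A.
exists (1 + C); first exact: addr_gt0.
move=> y z yd zd; rewrite -[f y - f z](subrK ((y - z) *m A)).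
by apply: le_trans (ler_normD _ _) _; rewrite mulrDl lerD // H.
Qed.

End strict_diff.

(** * Geometric convergence, antiderivatives and truncation *)

Section ode.
Variable R : realType.

Lemma geo_small (K e : R) : 0 < e -> exists j : nat, K / 2 ^+ j <= e.
Proof.
move=> e0; have [N HN] : exists N : nat, `|K| / e <= N%:R.
  exists (Num.truncn (`|K| / e)).+1; apply: ltW; exact: truncnS_gt.
exists N; rewrite ler_pdivrMr ?exprn_gt0 //.
apply: le_trans (ler_norm _) _; rewrite mulrC -ler_pdivrMr //.
apply: (le_trans HN); rewrite -natrX ler_nat; apply: ltnW; exact: ltn_expl.
Qed.

Lemma le_geo0 (x K : R) : (forall j : nat, x <= K / 2 ^+ j) -> x <= 0.
Proof.
move=> H; rewrite leNgt; apply/negP => x0.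
have [j Hj] := geo_small K (divr_gt0 x0 (ltr0n R 2)).
have := le_trans (H j) Hj; lra.
Qed.

(** The tail of the geometric series bounds the later displacements, so each coordinate runs through
    intervals of radius 2C/2^j around u j that pairwise meet. The limit is the supremum of their
    left ends. *)
Lemma geo_limit n (u : nat -> 'rV[R]_n) (C : R) : 0 <= C ->
  (forall j, `|u j.+1 - u j| <= C / 2 ^+ j) ->
  exists l, forall j, `|u j - l| <= 2 * C / 2 ^+ j.
Proof.
move=> C0 H.
have P j : 0 < (2 : R) ^+ j by rewrite exprn_gt0.
have D j m : `|u (j + m)%N - u j| <= 2 * C / 2 ^+ j - 2 * C / 2 ^+ (j + m).
  elim: m => [|m IH]; first by rewrite addn0 !subrr normr0.
  rewrite addnS -(subrKA (u (j + m)%N)); apply: le_trans (ler_normD _ _) _.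
  have := H (j + m)%N; rewrite exprS.
  have -> : 2 * C / (2 * 2 ^+ (j + m)) = C / 2 ^+ (j + m) by field; rewrite gt_eqF.
  move: IH; set a := 2 * C / _; set b := 2 * C / _; have -> : b = 2 * (C / 2 ^+ (j + m)) by rewrite /b mulrA.
  lra.
have D' j m : (j <= m)%N -> `|u m - u j| <= 2 * C / 2 ^+ j.
  move=> jm; have := D j (m - j)%N; rewrite subnKC //.
  have : 0 <= 2 * C / 2 ^+ m by rewrite divr_ge0 ?mulr_ge0 // ltW.
  lra.
have E m : exists l : R, forall j, `|u j 0 m - l| <= 2 * C / 2 ^+ j.
  pose S := [set u j 0 m - 2 * C / 2 ^+ j | j in [set: nat]].
  have D2 i j : u i 0 m - 2 * C / 2 ^+ i <= u j 0 m + 2 * C / 2 ^+ j.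
    have D3 i' j' : (i' <= j')%N -> `|u j' 0 m - u i' 0 m| <= 2 * C / 2 ^+ i'.
      move=> /D'; have K0 : 0 <= 2 * C / 2 ^+ i' by rewrite divr_ge0 ?mulr_ge0 // ltW.
      by move=> /(rV_norm_le _ K0).1 /(_ m); rewrite !mxE.
    have K0 k : 0 <= 2 * C / 2 ^+ k by rewrite divr_ge0 ?mulr_ge0 // ltW.
    have [ij|/ltnW ji] := leqP i j.
      by have := D3 i j ij; have := K0 j; rewrite ler_norml => ? /andP[]; lra.
    by have := D3 j i ji; have := K0 i; rewrite ler_norml => ? /andP[]; lra.
  have sS : has_sup S.
    split; first by exists (u 0%N 0 m - 2 * C / 2 ^+ 0), 0%N.
    by exists (u 0%N 0 m + 2 * C / 2 ^+ 0) => _ [j _ <-].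
  exists (sup S) => j.
  have h1 : u j 0 m - 2 * C / 2 ^+ j <= sup S.
    by apply: ub_le_sup; [case: sS | exists j].
  have h2 : sup S <= u j 0 m + 2 * C / 2 ^+ j.
    by apply: ge_sup; [case: sS | move=> _ [i _ <-]].
  by rewrite ler_norml; apply/andP; split; lra.
have [l Hl] := choice E; exists (\row_m l m) => j.
apply/rV_norm_le; first by rewrite divr_ge0 ?mulr_ge0 // ltW.
by move=> i; rewrite !mxE.
Qed.

Lemma antiderivative_real (f : R -> R) : continuous f -> exists2 A : R -> R, A 0 = 0 &
  forall t, `|t| < 3 -> is_derive (t : R^o) (1 : R^o) (A : R^o -> R^o) (f t).
Proof.
move=> cf; pose mu := @lebesgue_measure R.
(* The interval is wider than the range of t, so that t stays interior, as the fundamental theorem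
   of calculus requires. *)
have fi : mu.-integrable `[-4, 4] (EFin \o f).
  by apply: continuous_compact_integrable; [exact: segment_compact|exact: continuous_subspaceT].
pose B y := (\int[mu]_(t in `[-4, y]) f t)%R.
exists (fun y => B y - B 0); first by rewrite subrr.
move=> t; rewrite ltr_norml => /andP[t1 t2].
have t4 : t < 4 by lra.
have t4' : -4 < t by lra.
have [d E] := continuous_FTC1_closed t4 fi t4' (cf t).
rewrite -[f t]subr0; apply: is_deriveB.
by rewrite derive1E in E; exact: (DeriveDef d E).
Qed.

Lemma antiderivative n (f : R -> 'rV[R]_n) : continuous f -> exists2 A : R -> 'rV[R]_n, A 0 = 0 &
  forall t, `|t| < 3 -> is_derive (t : R^o) (1 : R^o) (A : R^o -> _) (f t).
Proof.
move=> cf; have /choice[A HA] : forall i : 'I_n, exists A : R -> R, A 0 = 0 /\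
  forall t, `|t| < 3 -> is_derive (t : R^o) (1 : R^o) (A : R^o -> R^o) (f t 0 i).
  move=> i; have [|A A0 HA] := @antiderivative_real (fun t => f t 0 i); last by exists A.
  by move=> t; apply: (@continuous_comp _ _ _ f (fun v : 'rV[R]_n => v 0 i)); [exact: cf|exact:
      coord_continuous].
exists (fun t => \row_i A i t).
  by apply/rowP => i; rewrite !mxE; have [] := HA i.
move=> t t3; apply/is_derive_coord => i.
rewrite (_ : (fun s => _) = A i); first by have [_] := HA i; apply.
by apply/funext => s; rewrite mxE.
Qed.

(** The 1-Lipschitz retraction of the line onto [a - r, a + r]. Composing with it turns data that
    are controlled only locally into globally Lipschitz data. *)
Definition clamp (a r t : R) : R := Num.max (a - r) (Num.min (a + r) t).

Lemma clamp_id a r t : `|t - a| <= r -> clamp a r t = t.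
Proof.
by rewrite ler_norml /clamp => /andP[h1 h2]; rewrite min_r; [rewrite max_r; lra|lra].
Qed.

Lemma clamp_in a r t : 0 <= r -> `|clamp a r t - a| <= r.
Proof.
rewrite /clamp => r0; rewrite ler_norml.
by case: (leP (a + r) t) => h1; [case: (leP (a - r) (a + r)) => h2|case: (leP (a - r) t) => h2];
    apply/andP; split; lra.
Qed.

Lemma clamp_lip a r s t : `|clamp a r s - clamp a r t| <= `|s - t|.
Proof.
wlog st : s t / s <= t => [H|].
  by have [/H//|/ltW /H] := leP s t; rewrite distrC (distrC s).
rewrite !(distrC s) (distrC (clamp a r s)) (ger0_norm (_ : 0 <= t - s)) ?subr_ge0 //.
rewrite /clamp; case: (leP (a + r) t) => h1; case: (leP (a + r) s) => h2.
- by rewrite subrr normr0 subr_ge0.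
- case: (leP (a - r) (a + r)) => h3; case: (leP (a - r) s) => h4; rewrite ler_norml; apply/andP; split; lra.
- lra.
- case: (leP (a - r) s) => h3; case: (leP (a - r) t) => h4; rewrite ler_norml; apply/andP; split; lra.
Qed.

End ode.

(** * Picard iteration *)

Section picard.
Variable R : realType.

Lemma lip_continuous (V W : normedModType R) (F : V -> W) (L : R) : 0 <= L ->
  (forall x y, `|F x - F y| <= L * `|x - y|) -> continuous F.
Proof.
move=> L0 FL x; apply: near_for_continuous => e e0.
apply/near_dist; exists (e / (L + 1)); first by rewrite divr_gt0 // ltr_wpDl.
move=> y yx; apply: le_trans (FL _ _) _.
move: yx; rewrite ltr_pdivlMr ?ltr_wpDl // => yx; have := normr_ge0 (y - x); nra.
Qed.

Lemma clamp_continuous (a r : R) : continuous (clamp a r).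
Proof.
apply: (@lip_continuous R^o R^o _ 1) => // x y; rewrite mul1r; exact: clamp_lip.
Qed.

(** The integral operator is clamped to times in [-2, 2], where a Lipschitz constant of at most 1/4
    makes it contract by 1/2. The normalization costs nothing, since fields are made small by
    scaling; times beyond 1 leave room around the time-one map. *)
Lemma picard n (F : 'rV[R]_n -> 'rV[R]_n) (L : R) (x0 : 'rV[R]_n) : 0 <= L -> L <= 1/4 ->
  (forall x y, `|F x - F y| <= L * `|x - y|) ->
  exists2 z : R -> 'rV[R]_n, z 0 = x0 &
  forall t, `|t| < 2 -> is_derive (t : R^o) (1 : R^o) (z : R^o -> _) (F (z t)).
Proof.
move=> L0 L4 FL; have cF := lip_continuous L0 FL.
have c0 : clamp 0 2 0 = 0 :> R by rewrite clamp_id // subrr normr0.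
have c3 t : `|clamp 0 2 t : R| <= 2 by have := @clamp_in R 0 2 t (ler0n _ 2); rewrite subr0.
have /choice[S HS] : forall z : R -> 'rV[R]_n, exists w : R -> 'rV[R]_n, continuous z ->
  [/\ continuous w, w 0 = x0 & exists2 A : R -> 'rV[R]_n, (forall t, `|t| < 3 ->
    is_derive (t : R^o) (1 : R^o) (A : R^o -> _) (F (z t))) & forall t, w t = A (clamp 0 2 t)].
  move=> z; have [cz|ncz] := pselect (continuous z); last by exists z => /ncz.
  have [|A A0 HA] := @antiderivative R n (F \o z).
    by move=> t; apply: continuous_comp; [exact: cz | exact: cF].
  have HB t : `|t| < 3 -> is_derive (t : R^o) (1 : R^o) (fun t : R^o => x0 + A t) (F (z t)).
    by move=> t3; rewrite -[F _]add0r; apply: is_deriveD; exact: HA.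
  exists (fun t => x0 + A (clamp 0 2 t)) => _; split.
  - move=> t; apply: (@continuous_comp _ _ _ (clamp 0 2) (fun t => x0 + A t)).
      exact: clamp_continuous.
    by apply: is_derive_cont (HB _ _); apply: le_lt_trans (c3 t) _; rewrite ltr_nat.
  - by rewrite c0 A0 addr0.
  - by exists (fun t => x0 + A t).
have S_contr z w K : continuous z -> continuous w -> (forall t, `|z t - w t| <= K) ->
    forall t, `|S z t - S w t| <= K / 2.
  move=> cz cw H t; have [_ Sz0 [A HA EA]] := HS z cz; have [_ Sw0 [B HB EB]] := HS w cw.
  have K0 : 0 <= K by apply: le_trans (H 0).
  have bound (s : R) : `|s| <= `|clamp 0 2 t : R| -> `|s| < 3.
    by move=> h; apply: le_lt_trans h _; apply: le_lt_trans (c3 t) _; rewrite ltr_nat.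
  have := @curve_mvt_abs R n (fun t => A t - B t) (fun t => F (z t) - F (w t)) 0 (clamp 0 2 t) (L * K) 0.
  rewrite !subr0 scaler0 subr0 EA EB.
  have -> : A 0 - B 0 = 0 by move: Sz0 Sw0; rewrite EA EB c0 => -> ->; rewrite subrr.
  rewrite subr0 => /(_ (mulr_ge0 L0 K0)) h; apply: le_trans (h _ _) _.
  - move=> s; rewrite !subr0 => /bound s3; apply: is_deriveB; [exact: HA|exact: HB].
  - move=> s _; rewrite subr0; apply: le_trans (FL _ _) _; apply: ler_wpM2l => //; exact: H.
  apply: (@le_trans _ _ (1 / 4 * K * 2)); last by lra.
  by apply: ler_pM => //; [exact: mulr_ge0|exact: ler_wpM2r].
pose u j := iter j S (fun=> x0).
have cu j : continuous (u j).
  elim: j => [|j IH] /=; first by move=> t; exact: cvg_cst.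
  by have [] := HS _ IH.
have [C0 [C0p HC]] : exists C, 0 <= C /\ forall t, `|u 1%N t - u 0%N t| <= C.
  have [_ S0 [A HA EA]] := HS _ (cu 0%N); exists (`|F x0| * 2); split; first by rewrite mulr_ge0.
  move=> t; rewrite /u /= EA.
  have bound (s : R) : `|s| <= `|clamp 0 2 t : R| -> `|s| < 3.
    by move=> h; apply: le_lt_trans h _; apply: le_lt_trans (c3 t) _; rewrite ltr_nat.
  have := @curve_mvt_abs R n A (fun t => F x0) 0 (clamp 0 2 t) (`|F x0|) 0.
  rewrite !subr0 scaler0 subr0.
  have -> : A 0 = x0 by rewrite -S0 EA c0.
  move=> h; apply: le_trans (h _ _ _) _ => //.
  - by move=> s; rewrite subr0 => /bound s3; exact: HA.
  - by rewrite ler_wpM2l.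
have D j t : `|u j.+1 t - u j t| <= C0 / 2 ^+ j.
  elim: j t => [|j IH] t; first by rewrite expr0 divr1.
  have := @S_contr (u j.+1) (u j) _ (cu _) (cu _) IH t.
  by rewrite exprS invfM mulrCA mulrC mulrA.
have /choice[l Hl] t := @geo_limit R n (fun j => u j t) C0 C0p (fun j => D j t).
have cl : continuous l.
  move=> t; apply: (@near_for_continuous R R^o) => e e0.
  have [j Hj] := geo_small (2 * C0) (divr_gt0 e0 (ltr0n R 3)).
  have := @for_continuous_near R R^o _ (u j) t _ (cu j t) (divr_gt0 e0 (ltr0n R 3)).
  apply: filterS => s Hs.
  have -> : l s - l t = - (u j s - l s) + (u j t - l t) + (u j s - u j t).
    by apply/rowP => i; rewrite !mxE; ring.
  apply: le_trans (ler_normD _ _) _; apply: le_trans (lerD (ler_normD _ _) (lexx _)) _.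
  rewrite normrN; have := Hl s j; have := Hl t j; move: Hs Hj; rewrite ![_ / 3]mulrC.
  move: (`|_|) (`|_|) (`|_|) (_ / _ ^+ _) => a b c d; lra.
have [_ Sl0 [A HA EA]] := HS l cl.
have fix_l t : S l t = l t.
  apply/eqP; rewrite -subr_eq0 -normr_le0; apply: (@le_geo0 R _ (4 * C0)) => j.
  rewrite -(subrKA (u j.+1 t)); apply: le_trans (ler_normD _ _) _.
  have := @S_contr l (u j) _ cl (cu j) (fun t => eq_ind _ (fun x => x <= _) (Hl t j) _ (distrC _ _)) t.
  have := Hl t j.+1; rewrite -/(u j.+1) exprS invfM.
  have -> : 4 * C0 / 2 ^+ j = 2 * (2 * C0 / 2 ^+ j) by ring.
  have -> : 2 * C0 * (2^-1 * (2 ^+ j)^-1) = (2 * C0 / 2 ^+ j) / 2 by ring.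
  have : 0 <= 2 * C0 / 2 ^+ j by rewrite divr_ge0 ?mulr_ge0 // exprn_ge0.
  move: (`|_|) (`|_|) (_ / _ ^+ _) => a b d; lra.
exists l; first by rewrite -fix_l.
move=> t t2; have t3 : `|t| < 3 by apply: lt_trans t2 _; rewrite ltr_nat.
have [dA E] := HA t t3.
have ev : \forall s \near (t : R^o), A s = l s.
  apply/near_dist; exists (2 - `|t|); first by rewrite subr_gt0.
  move=> s st; rewrite -fix_l EA clamp_id // subr0.
  rewrite -[s](subrK t); apply: le_trans (ler_normD _ _) _; lra.
exact: is_derive_near ev (HA t t3).
Qed.
End picard.

(** * Existence and uniqueness of integral curves *)

Section flows.
Variable R : realType.

Lemma mulmx_norm q k (a : 'rV[R]_q) (A : 'M[R]_(q, k)) : `|a *m A| <= q%:R * `|a| * `|A|.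
Proof.
apply/rV_norm_le; first by rewrite !mulr_ge0.
move=> j; rewrite mxE; apply: le_trans (ler_norm_sum _ _ _) _.
apply: (@le_trans _ _ (\sum_(i < q) `|a| * `|A|)).
  apply: ler_sum => i _; rewrite normrM; apply: ler_pM => //.
    by apply: (rV_norm_le a (normr_ge0 _)).1.
  rewrite [leRHS]/Num.Def.normr /= mx_normrE.
  exact: (le_bigmax _ (fun ij : 'I_q * 'I_k => `|A ij.1 ij.2|) (i, j)).
by rewrite sumr_const card_ord -[X in X <= _]mulr_natl mulrA.
Qed.

Lemma mx_norm_le q k (A : 'M[R]_(q, k)) e : 0 <= e -> (forall i j, `|A i j| <= e) -> `|A| <= e.
Proof.
by move=> e0 H; rewrite [leLHS]/Num.Def.normr /= mx_normrE; apply: bigmax_le => // -[i j] _ /=.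
Qed.

(** A substitute for Gronwall's inequality: iterating the improvement of a bound K into A + K/2,
    from any initial bound B, converges to 2A. *)
Lemma halving (T : Type) (S : T -> Prop) (f : T -> R) (A B : R) :
  (forall t, S t -> f t <= B) ->
  (forall K, (forall t, S t -> f t <= K) -> forall t, S t -> f t <= A + K / 2) ->
  forall t, S t -> f t <= 2 * A.
Proof.
move=> HB HK t St; rewrite -subr_le0; apply: (@le_geo0 _ _ (B - 2 * A)) => j.
elim: j t St => [|j IH] t St; first by rewrite expr0 divr1 lerD2r; exact: HB.
have IH' t' : S t' -> f t' <= 2 * A + (B - 2 * A) / 2 ^+ j by move=> St'; rewrite -lerBlDl; exact: IH.
have := HK _ IH' t St; rewrite exprS invfM.
have -> : (B - 2 * A) * (2^-1 * (2 ^+ j)^-1) = ((B - 2 * A) / 2 ^+ j) / 2 by ring.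
move: (_ / _ ^+ _) => x; lra.
Qed.

Definition rclamp k (u0 : 'rV[R]_k) (r : R) (u : 'rV[R]_k) : 'rV[R]_k :=
  \row_i clamp (u0 0 i) r (u 0 i).

Lemma rclamp_id k (u0 u : 'rV[R]_k) r : `|u - u0| <= r -> rclamp u0 r u = u.
Proof.
move=> H; apply/rowP => i; rewrite mxE clamp_id //.
have r0 : 0 <= r by apply: le_trans H.
by have := (rV_norm_le _ r0).1 H i; rewrite !mxE.
Qed.

Lemma rclamp_in k (u0 u : 'rV[R]_k) r : 0 <= r -> `|rclamp u0 r u - u0| <= r.
Proof. by move=> r0; apply/rV_norm_le => // i; rewrite !mxE; exact: clamp_in. Qed.

Lemma rclamp_lip k (u0 u v : 'rV[R]_k) r : `|rclamp u0 r u - rclamp u0 r v| <= `|u - v|.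
Proof.
apply/rV_norm_le => // i; rewrite !mxE; apply: le_trans (clamp_lip _ _ _ _) _.
by have := (rV_norm_le _ (normr_ge0 (u - v))).1 (lexx _) i; rewrite !mxE.
Qed.

(** The rows of Y are q vector fields and a holds the coefficients of a combination. Picard
    iteration is run on the clamped field; for small a the solution never leaves the ball where
    clamping does nothing. M is fixed before d, so the bound by M|a| does not deteriorate when d
    shrinks. *)
Lemma flow_exists q k (Y : 'rV[R]_k -> 'M[R]_(q, k)) (u0 : 'rV[R]_k) (r L : R) :
  0 < r -> 0 < L ->
  (forall u v, `|u - u0| <= r -> `|v - u0| <= r -> `|Y u - Y v| <= L * `|u - v|) ->
  exists2 M, 0 < M & forall d : R, 0 < d -> exists2 rho, 0 < rho & forall a : 'rV[R]_q, `|a| <= rho ->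
    exists z : R -> 'rV[R]_k, z 0 = u0 /\ forall t, `|t| < 2 ->
      [/\ `|z t - u0| <= d, `|z t - u0| <= M * `|a|, `|Y (z t)| <= M &
      is_derive (t : R^o) (1 : R^o) (z : R^o -> _) (a *m Y (z t))].
Proof.
move=> r0 L0 HL; pose c := rclamp u0 r.
have cin u : `|c u - u0| <= r by apply: rclamp_in; exact: ltW.
have HL' u v : `|Y (c u) - Y (c v)| <= L * `|u - v|.
  apply: le_trans (HL _ _ (cin u) (cin v)) _; apply: ler_wpM2l; [exact: ltW|exact: rclamp_lip].
have cu0 : c u0 = u0 by rewrite /c rclamp_id // subrr normr0 ltW.
pose M0 := `|Y u0| + L * r.
have HM u : `|Y (c u)| <= M0.
  rewrite -[Y (c u)](subrK (Y u0)); apply: le_trans (ler_normD _ _) _.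
  rewrite addrC lerD // -cu0; apply: le_trans (HL _ _ (cin u) (cin _)) _.
  by rewrite cu0 ler_wpM2l // ltW.
have M00 : 0 < M0 by rewrite ltr_wpDl // mulr_gt0.
have q0 : 0 <= (q%:R : R) by rewrite ler0n.
(* The speed is at most q|a| M0 and times are below 2, hence 2q; the summand 1 makes M dominate Y as
   well. *)
pose M := M0 * (1 + 2 * q%:R).
have M0M : M0 <= M by rewrite /M ler_peMr ?(ltW M00) //; lra.
have Mp : 0 < M by apply: lt_le_trans M0M.
exists M => // d d0.
pose m := Num.min d r; have m0 : 0 < m by rewrite lt_min d0.
(* The first bound on |a| gives the Lipschitz constant 1/4 that [picard] asks for; the second keeps
   the curve within m of u0. *)
exists (Num.min (1 / 4 / (L * (q%:R + 1))) (m / M)).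
  rewrite lt_min !divr_gt0 // mulr_gt0 //; lra.
move=> a; rewrite le_min => /andP[a1 a2].
have aL : q%:R * `|a| * L <= 1 / 4.
  move: a1; rewrite ler_pdivlMr; last by rewrite mulr_gt0 //; lra.
  apply: le_trans; have -> : `|a| * (L * (q%:R + 1)) = q%:R * `|a| * L + `|a| * L by ring.
  by rewrite lerDl mulr_ge0 // ltW.
have aM : M * `|a| <= m by rewrite mulrC -ler_pdivlMr.
have [||z z0 Hz] := @picard R k (fun u => a *m Y (c u)) (q%:R * `|a| * L) u0 _ aL.
- by rewrite !mulr_ge0 // ltW.
- move=> u v; rewrite -mulmxBr; apply: le_trans (mulmx_norm _ _) _.
  by rewrite -[leRHS]mulrA ler_wpM2l // mulr_ge0.
exists z; split => // t t2.
have zM : `|z t - u0| <= M * `|a|.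
  have := @curve_mvt_abs R k z (fun t => a *m Y (c (z t))) 0 t (q%:R * `|a| * M0) 0.
  rewrite scaler0 subr0 !subr0 z0 => h; apply: le_trans (h _ _ _) _.
  - by rewrite !mulr_ge0 // ltW.
  - by move=> s; rewrite subr0 => st; apply: Hz; exact: le_lt_trans t2.
  - move=> s _; rewrite subr0; apply: le_trans (mulmx_norm _ _) _.
    by rewrite ler_wpM2l // mulr_ge0.
  apply: (@le_trans _ _ (q%:R * `|a| * M0 * 2)).
    by rewrite ler_wpM2l ?mulr_ge0 // ltW.
  have -> : q%:R * `|a| * M0 * 2 = (2 * q%:R) * (M0 * `|a|) by ring.
  have -> : M * `|a| = (1 + 2 * q%:R) * (M0 * `|a|) by rewrite /M; ring.
  by rewrite ler_wpM2r ?mulr_ge0 ?(ltW M00) //; lra.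
have zm : `|z t - u0| <= m by exact: le_trans aM.
have [zd zr] : `|z t - u0| <= d /\ `|z t - u0| <= r by move: zm; rewrite le_min => /andP.
have cz : c (z t) = z t by exact: rclamp_id.
split => //; first by rewrite -cz; exact: le_trans M0M.
by have := Hz t t2; rewrite cz.
Qed.

Lemma ode_unique k (F : 'rV[R]_k -> 'rV[R]_k) (c1 c2 : R -> 'rV[R]_k) (t0 d r L : R) :
  0 < d -> 0 < r -> 0 < L ->
  (forall u v, `|u - c1 t0| <= r -> `|v - c1 t0| <= r -> `|F u - F v| <= L * `|u - v|) ->
  c1 t0 = c2 t0 ->
  (forall t, `|t - t0| < d -> is_derive (t : R^o) (1 : R^o) (c1 : R^o -> _) (F (c1 t))) ->
  (forall t, `|t - t0| < d -> is_derive (t : R^o) (1 : R^o) (c2 : R^o -> _) (F (c2 t))) ->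
  exists2 d', 0 < d' & forall t, `|t - t0| < d' -> c1 t = c2 t.
Proof.
move=> d0 r0 L0 HL E H1 H2.
have t0d : `|t0 - t0| < d by rewrite subrr normr0.
have [e1 e10 He1] := (near_dist (t0 : R^o) _).1 (for_continuous_near (is_derive_cont (H1 _ t0d)) r0).
have [e2 e20 He2] := (near_dist (t0 : R^o) _).1 (for_continuous_near (is_derive_cont (H2 _ t0d)) r0).
(* Within time 1/(2L), integrating the Lipschitz estimate halves any bound on the difference, so
   [halving] applies with A = 0. The other terms keep both curves in the Lipschitz ball. *)
exists (Num.min (Num.min e1 e2) (Num.min d (1 / 2 / L))).
  by rewrite !lt_min e10 e20 d0 divr_gt0.
move=> s; rewrite !lt_min => /andP[/andP[s1 s2] /andP[sd sL]].
pose S t := `|t - t0| <= `|s - t0|.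
have SS t : S t -> [/\ `|t - t0| < e1, `|t - t0| < e2 & `|t - t0| < d].
  by move=> St; split; apply: le_lt_trans St _.
apply/eqP; rewrite -subr_eq0 -normr_le0 -(mulr0 2).
apply: (@halving R S (fun t => `|c1 t - c2 t|) 0 (r + r)) => //; last exact: (lexx _ : S s).
  move=> t /SS[t1 t2 td]; rewrite -(subrKA (c1 t0)); apply: le_trans (ler_normD _ _) _.
  by apply: lerD; [exact: He1|rewrite E distrC; exact: He2].
move=> K HK t St; have K0 : 0 <= K by exact: le_trans (HK _ St).
rewrite add0r.
have := @curve_mvt_abs R k (fun t => c1 t - c2 t) (fun t => F (c1 t) - F (c2 t)) t0 t (L * K) 0.
rewrite scaler0 subr0 E subrr subr0 => h; apply: le_trans (h _ _ _) _.
- by rewrite mulr_ge0 // ltW.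
- move=> x xt; have /SS[x1 x2 xd] : S x by exact: le_trans St.
  by apply: is_deriveB; [exact: H1|exact: H2].
- move=> x xt; rewrite subr0; have Sx : S x by exact: le_trans St.
  have [x1 x2 xd] := SS _ Sx.
  apply: le_trans (HL _ _ (He1 _ x1) _) _; first by rewrite E; exact: He2.
  by apply: ler_wpM2l; [exact: ltW|exact: HK].
have : L * `|t - t0| <= 1 / 2.
  by rewrite mulrC -ler_pdivlMr //; apply: le_trans St (ltW sL).
move: (normr_ge0 (t - t0)); move: (`|t - t0|) => y; nra.
Qed.

End flows.

(** * Dependence of flows on parameters, and inversion by contraction *)

Section local_surjectivity.
Variable R : realType.

(** The time-one map is strictly differentiable at a = 0, with differential Y u0. The difference of
    two velocities is (a - b) Y(z_a) + b (Y(z_a) - Y(z_b)). Near a = b = 0 the first term is close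
    to (a - b) Y u0 and the second is small compared with |a - b|. *)
Lemma flow_sdiff q k (Y : 'rV[R]_k -> 'M[R]_(q, k)) (u0 : 'rV[R]_k) (r L d : R) :
  0 < r -> 0 < L -> 0 < d ->
  (forall u v, `|u - u0| <= r -> `|v - u0| <= r -> `|Y u - Y v| <= L * `|u - v|) ->
  exists rho : R, exists z : 'rV[R]_q -> R -> 'rV[R]_k, [/\ 0 < rho,
    forall a, `|a| <= rho -> z a 0 = u0 /\ forall t, `|t| < 2 -> `|z a t - u0| <= d /\
      is_derive (t : R^o) (1 : R^o) (z a : R^o -> _) (a *m Y (z a t)) &
    forall e : R, 0 < e -> exists2 rho', 0 < rho' & forall a b, `|a| <= rho' -> `|b| <= rho' ->
      `|z a 1 - z b 1 - (a - b) *m Y u0| <= e * `|a - b|].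
Proof.
move=> r0 L0 d0 HL; have [M M0 HM] := flow_exists r0 L0 HL.
pose d' := Num.min d r; have d'0 : 0 < d' by rewrite lt_min d0.
have [rho rho0 Hrho] := HM d' d'0.
have /choice[z Hz] : forall a : 'rV[R]_q, exists z : R -> 'rV[R]_k, `|a| <= rho -> z 0 = u0 /\ forall t,
    `|t| < 2 ->
      [/\ `|z t - u0| <= d', `|z t - u0| <= M * `|a|, `|Y (z t)| <= M &
      is_derive (t : R^o) (1 : R^o) (z : R^o -> _) (a *m Y (z t))].
  move=> a; have [ar|ar] := leP `|a| rho; last by exists (fun=> u0).
  by have [z Hz] := Hrho a ar; exists z.
exists rho, z; split => //.
  move=> a ar; have [z0 Hza] := Hz a ar; split => // t t2.
  by have [+ _ _ ?] := Hza t t2; rewrite le_min => /andP[].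
move=> e e0.
have q0 : 0 <= (q%:R : R) by rewrite ler0n.
(* The two summands are the coefficients of |a - b||a| and |a - b||b| in the estimates [A1] and [A2]
   below. *)
pose K := q%:R * L * M + q%:R * L * (2 * q%:R * M).
have K0 : 0 <= K by rewrite /K addr_ge0 // !mulr_ge0 // ?ler0n // ltW.
exists (Num.min rho (Num.min (1 / 2 / (q%:R * L + 1)) (e / (K + 1)))).
  by rewrite !lt_min rho0 !divr_gt0 // ltr_wpDl // mulr_ge0 // ltW.
move=> a b; rewrite !le_min => /andP[ar /andP[a1 a2]] /andP[br /andP[b1 b2]].
have [za0 Hza] := Hz a ar; have [zb0 Hzb] := Hz b br.
have bL : q%:R * `|b| * L <= 1 / 2.
  have qL0 : 0 <= q%:R * L by rewrite mulr_ge0 // ltW.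
  move: b1; rewrite ler_pdivlMr; last by rewrite ltr_wpDl.
  by apply: le_trans; rewrite mulrAC mulrC ler_wpM2l // lerDl.
have t12 (t : R) : 0 <= t <= 1 -> `|t| < 2.
  by move=> /andP[t0 t1]; rewrite ger0_norm //; lra.
have dw t : 0 <= t <= 1 -> is_derive (t : R^o) (1 : R^o) (fun t => z a t - z b t)
   (a *m Y (z a t) - b *m Y (z b t)).
  by move=> /t12 t2; apply: is_deriveB; [have [] := Hza t t2|have [] := Hzb t t2].
have Ydiff t : 0 <= t <= 1 -> `|Y (z a t) - Y (z b t)| <= L * `|z a t - z b t|.
  move=> /t12 t2; have [+ _ _ _] := Hza t t2; have [+ _ _ _] := Hzb t t2.
  by rewrite !le_min => /andP[_ h1] /andP[_ h2]; exact: HL.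
(* An a priori Lipschitz bound in the parameter: smallness of b makes the feedback term at most half
   of any current bound. *)
have W : forall t, 0 <= t <= 1 -> `|z a t - z b t| <= 2 * (q%:R * M * `|a - b|).
  apply: (@halving R R (fun t => 0 <= t <= 1) (fun t => `|z a t - z b t|) (q%:R * M * `|a - b|) (d' + d')).
    move=> t /t12 t2; rewrite -(subrKA u0); apply: le_trans (ler_normD _ _) _; apply: lerD.
      by have [] := Hza t t2.
    by rewrite distrC; have [] := Hzb t t2.
  move=> B HB t t01; have B0 : 0 <= B by exact: le_trans (HB _ t01).
  have [t0 t1] := andP t01.
  have := @curve_mvt R k (fun t => z a t - z b t) (fun t => a *m Y (z a t) - b *m Y (z b t)) 0 t (q%:R * M
      * `|a - b| + B / 2) 0 t0.
  have C0 : 0 <= q%:R * M * `|a - b| + B / 2 by rewrite addr_ge0 ?mulr_ge0 // ltW.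
  rewrite za0 zb0 subrr !subr0 scaler0 subr0 => /(_ C0) h; apply: le_trans (h _ _) _.
  - by move=> s /andP[s0 st]; apply: dw; rewrite s0 (le_trans st).
  - move=> s /andP[s0 st]; have s01 : 0 <= s <= 1 by rewrite s0 (le_trans st).
    rewrite subr0; have -> : a *m Y (z a s) - b *m Y (z b s) = (a - b) *m Y (z a s) + b *m (Y (z a s) - Y
        (z b s)).
      by rewrite mulmxBl mulmxBr addrA subrK.
    apply: le_trans (ler_normD _ _) _; apply: lerD.
      apply: le_trans (mulmx_norm _ _) _; rewrite [leRHS]mulrAC ler_wpM2l ?mulr_ge0 //.
      by have [] := Hza s (t12 _ s01).
    apply: le_trans (mulmx_norm _ _) _; apply: (@le_trans _ _ (q%:R * `|b| * (L * B))).
      by rewrite ler_wpM2l ?mulr_ge0 // (le_trans (Ydiff _ s01)) // ler_wpM2l ?(ltW L0) // HB.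
    by rewrite mulrA [leRHS]mulrC ler_wpM2r // (le_trans bL) //; lra.
  by rewrite ler_piMr.
have := @curve_mvt R k (fun t => z a t - z b t) (fun t => a *m Y (z a t) - b *m Y (z b t)) 0 1 (e * `|a -
    b|) ((a - b) *m Y u0) ler01.
rewrite za0 zb0 subrr !subr0 scale1r mulr1; apply; first by rewrite mulr_ge0 // ltW.

- move=> s s01; have s2 := t12 _ s01.
  have -> : a *m Y (z a s) - b *m Y (z b s) - (a - b) *m Y u0 =
    (a - b) *m (Y (z a s) - Y u0) + b *m (Y (z a s) - Y (z b s)).
    by rewrite !(mulmxBl, mulmxBr); apply/rowP => i; rewrite !mxE; ring.
  have D0 := normr_ge0 (a - b).
  have qa0 : 0 <= q%:R * `|a - b| by rewrite mulr_ge0.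
  have M0' := ltW M0; have L0' := ltW L0.
  have A1 : `|(a - b) *m (Y (z a s) - Y u0)| <= q%:R * L * M * `|a - b| * `|a|.
    apply: le_trans (mulmx_norm _ _) _.
    have -> : q%:R * L * M * `|a - b| * `|a| = q%:R * `|a - b| * (L * (M * `|a|)) by ring.
    rewrite ler_wpM2l //; have [h1 h2 _ _] := Hza s s2.
    apply: le_trans (HL _ _ _ _) _; first by move: h1; rewrite le_min => /andP[].
      by rewrite subrr normr0 ltW.
    by rewrite ler_wpM2l.
  have A2 : `|b *m (Y (z a s) - Y (z b s))| <= q%:R * L * (2 * q%:R * M) * `|a - b| * `|b|.
    apply: le_trans (mulmx_norm _ _) _.
    have -> : q%:R * L * (2 * q%:R * M) * `|a - b| * `|b| = q%:R * `|b| * (L * (2 * (q%:R * M * `|a - b|)))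
        by ring.
    by rewrite ler_wpM2l ?mulr_ge0 // (le_trans (Ydiff _ s01)) // ler_wpM2l // W.
  apply: le_trans (ler_normD _ _) _; apply: le_trans (lerD A1 A2) _.
  have a2' : `|a| * (K + 1) <= e by rewrite -ler_pdivlMr // ltr_wpDl.
  have b2' : `|b| * (K + 1) <= e by rewrite -ler_pdivlMr // ltr_wpDl.
  have -> : q%:R * L * M * `|a - b| * `|a| + q%:R * L * (2 * q%:R * M) * `|a - b| * `|b| =
    (q%:R * L * M * `|a| + q%:R * L * (2 * q%:R * M) * `|b|) * `|a - b| by ring.
  apply: ler_wpM2r => //.
  have P1 : 0 <= q%:R * L * M by rewrite !mulr_ge0.
  have P2 : 0 <= q%:R * L * (2 * q%:R * M) by rewrite !mulr_ge0.
  have na := normr_ge0 a; have nb := normr_ge0 b.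
  move: K0 a2' b2'; rewrite /K; move: (q%:R * L * M) (q%:R * L * (2 * q%:R * M)) P1 P2 (`|a|) (`|b|) na nb
      => x y x0 y0 s1 s2' h1 h2 h3 h4 h5.
  have [h|h] := leP s1 s2'.
    by apply: le_trans h5; nra.
  by apply: le_trans h4; nra.
Qed.

(** The map a - Phi a + y contracts by 1/2 and its fixed points solve Phi a = y. The j-th step has
    length at most (r/2)/2^j, so the iterates stay in the ball of radius r on which the contraction
    is assumed. *)
Lemma local_inverse q (Phi : 'rV[R]_q -> 'rV[R]_q) (x0 y : 'rV[R]_q) (r : R) : 0 < r ->
  (forall a b, `|a - x0| <= r -> `|b - x0| <= r -> `|Phi a - Phi b - (a - b)| <= 1 / 2 * `|a - b|) ->
  `|y - Phi x0| <= r / 2 -> exists2 a, `|a - x0| <= r & Phi a = y.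
Proof.
move=> r0 H Hy; pose f a := a - Phi a + y; pose u j := iter j f x0.
have p2 j : 0 < (2 : R) ^+ j by rewrite exprn_gt0.
have fd a b : `|a - x0| <= r -> `|b - x0| <= r -> `|f a - f b| <= 1 / 2 * `|a - b|.
  move=> ar br; have := H a b ar br; rewrite -normrN; congr (`|_| <= _).
  by apply/rowP => i; rewrite !mxE; ring.
have I j : `|u j - x0| <= r - r / 2 ^+ j /\ `|u j.+1 - u j| <= (r / 2) / 2 ^+ j.
  elim: j => [|j [IH1 IH2]].
    rewrite /u /= subrr normr0 expr0 !divr1 subrr; split => //.
    by have -> : f x0 - x0 = y - Phi x0 by apply/rowP => i; rewrite !mxE; ring.
  have e2 : r / 2 / 2 ^+ j = r / 2 ^+ j.+1 by rewrite exprS invfM; ring.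
  have e3 : r / 2 ^+ j = r / 2 ^+ j.+1 * 2 by rewrite -e2; field; rewrite gt_eqF.
  have P : 0 < r / 2 ^+ j.+1 by rewrite divr_gt0.
  have I1 : `|u j.+1 - x0| <= r - r / 2 ^+ j.+1.
    rewrite -(subrKA (u j)); apply: le_trans (ler_normD _ _) _.
    by move: IH1 IH2; rewrite e2 e3; move: (`|_|) (`|_|) => s t; lra.
  have I1' : `|u j.+1 - x0| <= r by apply: le_trans I1 _; lra.
  have I0' : `|u j - x0| <= r by apply: le_trans IH1 _; rewrite e3; lra.
  split => //; apply: le_trans (fd _ _ I1' I0') _.
  have -> : r / 2 / 2 ^+ j.+1 = r / 2 ^+ j.+1 / 2 by ring.
  move: IH2; rewrite e2; move: (`|u j.+1 - u j|) => s; lra.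
have [l Hl] := @geo_limit R q u (r / 2) (ltW (divr_gt0 r0 (ltr0n R 2))) (fun j => (I j).2).
have lr : `|l - x0| <= r.
  rewrite -subr_le0; apply: (@le_geo0 R _ r) => j.
  have [I1 _] := I j; have := Hl j; have -> : 2 * (r / 2) = r by field.
  have := ler_normD (l - u j) (u j - x0); rewrite subrKA (distrC l (u j)).
  have : 0 < r / 2 ^+ j by rewrite divr_gt0.
  by move: I1; move: (`|_|) (`|_|) (`|_|) (_ / _) => a b c d; lra.
exists l => //; apply/eqP; rewrite -subr_eq0 -normr_le0; apply: (@le_geo0 R _ (2 * r)) => j.
have [I1 I2] := I j; have ur : `|u j - x0| <= r.
  by apply: le_trans I1 _; rewrite lerBlDr lerDl divr_ge0 // ltW.
have := H l (u j) lr ur; have := Hl j; rewrite distrC => h1 h2.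
have -> : Phi l - y = (Phi l - Phi (u j) - (l - u j)) + (l - u j) - (u j.+1 - u j).
  by rewrite /u /= -/(u j) /f; apply/rowP => i; rewrite !mxE; ring.
apply: le_trans (ler_normB _ _) _; apply: le_trans (lerD (ler_normD _ _) (lexx _)) _.
move: h1 h2 I2; have -> : 2 * (r / 2) = r by field.
have -> : r / 2 / 2 ^+ j = r / 2 ^+ j / 2 by ring.
have -> : 2 * r / 2 ^+ j = 2 * (r / 2 ^+ j) by ring.
by move: (`|_|) (`|_|) (`|_|) (r / _) => a b c d; lra.
Qed.
End local_surjectivity.

(** * Lipschitz images of lower-dimensional balls *)

Section lipschitz_images.
Variable R : realType.

Lemma truncn_itvD1 (x : R) : 0 <= x -> (Num.truncn x)%:R <= x < (Num.truncn x)%:R + 1.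
Proof. by move=> x0; rewrite natr1 (truncn_itv x0). Qed.

(** Take m^d grid points of mesh s = rho/m near y0. If each were within s/3 of a value of f, the
    chosen sources would lie in distinct cells of a subdivision of the n-dimensional ball: sources
    in one cell have images within s/3, which puts their targets at distance less than s. There are
    too few cells as d > n. *)
Lemma grid_pigeonhole n d (f : 'rV[R]_n -> 'rV[R]_d) (c : 'rV[R]_n) (y0 : 'rV[R]_d) (r C rho : R) :
  (n < d)%N -> 0 < r -> 0 < C -> 0 < rho ->
  (forall x y, `|x - c| <= r -> `|y - c| <= r -> `|f x - f y| <= C * `|x - y|) ->
  exists y, exists2 s, 0 < s & `|y - y0| <= rho /\ forall x, `|x - c| <= r -> s <= `|f x - y|.
Proof.
move=> nd r0 C0 rho0 Hf.
(* With N = Km cells along each axis, a cell has side 2r/N, and this K gives C(2r/N) <= s/3. The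
   choice of m makes m larger than (K + 1)^n, which decides the final count. *)
pose K := (Num.truncn (6 * r * C / rho)).+1.
have HK : 6 * r * C / rho <= K%:R by apply/ltW/truncnS_gt.
pose m := (K.+1 ^ n).+1; pose N := (K * m)%N.
have m0 : 0 < (m%:R : R) by rewrite ltr0n.
have N0 : 0 < (N%:R : R) by rewrite ltr0n muln_gt0.
pose y (g : {ffun 'I_d -> 'I_m}) : 'rV[R]_d := \row_i (y0 0 i + rho * (g i)%:R / m%:R).
pose s := rho / m%:R; have s0 : 0 < s by rewrite divr_gt0.
have s3 : 0 < s / 3 by rewrite divr_gt0.
apply: contrapT => nex.
have H g : exists x, `|x - c| <= r /\ `|f x - y g| < s / 3.
  apply: contrapT => nx; apply: nex; exists (y g), (s / 3) => //; split.
    apply/rV_norm_le; first exact: ltW.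
    move=> i; rewrite !mxE addrAC subrr add0r ger0_norm; last by rewrite divr_ge0 // mulr_ge0 // ltW.
    by rewrite ler_pdivrMr // ler_pM2l // ler_nat ltnW.
  by move=> x xr; rewrite leNgt; apply/negP => h; apply: nx; exists x.
have [x Hx] := choice H.
have Hidx g i : (Num.truncn ((x g 0 i - c 0 i + r) / (2 * r) * N%:R)%R < N.+1)%N.
  have [xr _] := Hx g; have := (rV_norm_le _ (ltW r0)).1 xr i; rewrite !mxE ler_norml => /andP[h1 h2].
  have h0 : 0 <= (x g 0 i - c 0 i + r) / (2 * r) * N%:R.
    rewrite mulr_ge0 ?(ltW N0) // divr_ge0 //; [lra|lra].
  rewrite ltnS -(ler_nat R); have /andP[+ _] := truncn_itvD1 h0; move/le_trans; apply.
  rewrite ler_piMl ?(ltW N0) // ler_pdivrMr ?mulr_gt0 //; lra.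
(* There are N + 1 values, because the right end of the ball truncates to N itself. *)
pose idx g : {ffun 'I_n -> 'I_N.+1} := [ffun i => Ordinal (Hidx g i)].
have inj : injective idx.
  move=> g g' E.
  have xx : `|x g - x g'| <= 2 * r / N%:R.
    apply/rV_norm_le; first by rewrite divr_ge0 ?(ltW N0) // mulr_ge0 // ltW.
    move=> i; have := congr1 (fun h : {ffun 'I_n -> 'I_N.+1} => nat_of_ord (h i)) E; rewrite !ffunE /= => E'.
    have [xr _] := Hx g; have := (rV_norm_le _ (ltW r0)).1 xr i; rewrite !mxE ler_norml => /andP[h1 h2].
    have [xr' _] := Hx g'; have := (rV_norm_le _ (ltW r0)).1 xr' i; rewrite !mxE ler_norml => /andP[h1' h2'].
    have h0 : 0 <= (x g 0 i - c 0 i + r) / (2 * r) * N%:R.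
      rewrite mulr_ge0 ?(ltW N0) // divr_ge0 //; [lra|lra].
    have h0' : 0 <= (x g' 0 i - c 0 i + r) / (2 * r) * N%:R.
      rewrite mulr_ge0 ?(ltW N0) // divr_ge0 //; [lra|lra].
    have /andP[a1 a2] := truncn_itvD1 h0; have /andP[b1 b2] := truncn_itvD1 h0'.
    have : `|(x g 0 i - c 0 i + r) / (2 * r) * N%:R - (x g' 0 i - c 0 i + r) / (2 * r) * N%:R| <= 1.
      by move: a1 a2 b1 b2; rewrite E' ler_norml; move: (_ * N%:R) (_ * N%:R) => p p' *; apply/andP; split; lra.
    have -> : (x g 0 i - c 0 i + r) / (2 * r) * N%:R - (x g' 0 i - c 0 i + r) / (2 * r) * N%:R =
      (x g 0 i - x g' 0 i) * (N%:R / (2 * r)) by ring.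
    have P : 0 < N%:R / (2 * r) by rewrite divr_gt0 // mulr_gt0.
    by rewrite normrM (gtr0_norm P) -ler_pdivlMr // invf_div mul1r.
  have [xr fx] := Hx g; have [xr' fx'] := Hx g'.
  have ff : `|f (x g) - f (x g')| <= s / 3.
    apply: le_trans (Hf _ _ xr xr') _; apply: le_trans (ler_wpM2l (ltW C0) xx) _.
    rewrite /s mulrA ler_pdivrMr // /N natrM.
    have -> : rho / m%:R / 3 * (K%:R * m%:R) = rho * K%:R / 3 by field; rewrite gt_eqF.
    by move: HK; rewrite ler_pdivrMr // => ?; lra.
  have yy : `|y g - y g'| < s.
    have := ler_normD (y g - f (x g)) (f (x g) - f (x g')); rewrite subrKA => h.
    have := ler_normD (y g - f (x g')) (f (x g') - y g'); rewrite subrKA => h'.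
    move: h h' fx fx' ff; rewrite (distrC (y g) (f (x g))).
    by move: (`|_|) (`|_|) (`|_|) (`|_|) (`|_|) => *; lra.
  apply/ffunP => i; apply: val_inj; apply/eqP; rewrite eqn_leq; apply/andP.
  have : `|y g 0 i - y g' 0 i| < s.
    apply: le_lt_trans yy; have := (rV_norm_le _ (normr_ge0 (y g - y g'))).1 (lexx _) i.
    by rewrite !mxE.
  rewrite !mxE; have -> : y0 0 i + rho * (g i)%:R / m%:R - (y0 0 i + rho * (g' i)%:R / m%:R) =
    s * ((g i)%:R - (g' i)%:R) by rewrite /s; ring.
  rewrite normrM (gtr0_norm s0) gtr_pMr // ltr_norml => /andP[k1 k2].
  by split; rewrite -ltnS -(ltr_nat R) -natr1; lra.
have := leq_card _ inj; rewrite !card_ffun !card_ord => card.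
(* From N + 1 <= (K + 1)m. Cancelling m^n, with d >= n + 1, leaves m <= (K + 1)^n, against the
   choice of m. *)
have : (m ^ d <= K.+1 ^ n * m ^ n)%N.
  apply: leq_trans card _; rewrite -expnMn.
  have NK : (N.+1 <= K.+1 * m)%N by rewrite /N mulSn addnC -addn1 leq_add2l.
  by elim: (n) => // j IH; rewrite !expnS leq_mul.
rewrite -(subnK nd) -addSnnS expnD leq_pmul2r ?expn_gt0 //.
rewrite expnS => /(leq_trans (leq_pmulr _ _)); rewrite /m expn_gt0 /= => /(_ isT).
by rewrite ltnn.
Qed.
End lipschitz_images.

Section baire_images.
Variable R : realType.

Lemma open_dist (V : normedModType R) (A : set V) :
  (forall x, A x -> exists2 d : R, 0 < d & forall y, `|y - x| < d -> A y) -> open A.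
Proof. by move=> H; rewrite openE => x /H; exact: (near_dist x A).2. Qed.

Lemma lipschitz_not_cover n d (f : nat -> 'rV[R]_n -> 'rV[R]_d) (c : nat -> 'rV[R]_n)
    (r C : nat -> R) (y0 : 'rV[R]_d) (rho : R) :
  (n < d)%N -> 0 < rho -> (forall i, 0 < r i) -> (forall i, 0 < C i) ->
  (forall i x y, `|x - c i| <= r i -> `|y - c i| <= r i -> `|f i x - f i y| <= C i * `|x - y|) ->
  exists2 y, `|y - y0| < rho & forall i x, `|x - c i| <= r i -> f i x <> y.
Proof.
move=> nd rho0 r0 C0 Hf.
(* Positive distance to the i-th image, and not mere absence from it, makes these sets open at once;
   the pigeonhole lemma makes them dense, so Baire's theorem applies. *)
pose W i := [set y : 'rV[R]_d | exists2 s, 0 < s & forall x, `|x - c i| <= r i -> s <= `|f i x - y|].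
have HV i : open (W i) /\ dense (W i).
  split.
    apply: open_dist => y [s s0 Hs]; exists (s / 2); first by rewrite divr_gt0.
    move=> z zy; exists (s / 2); first by rewrite divr_gt0.
    move=> x xr; have := Hs x xr; have := ler_normD (f i x - z) (z - y); rewrite subrKA.
    by move: zy; move: (`|_|) (`|_|) (`|_|) => *; lra.
  move=> A [y Ay] oA; have [e e0 He] := (near_dist y A).1 (open_near oA Ay).
  have e2 : 0 < e / 2 by rewrite divr_gt0.
  have [z [s s0 [zy Hz]]] := grid_pigeonhole y nd (r0 i) (C0 i) e2 (Hf i).
  by exists z; split; [apply: He; apply: le_lt_trans zy _; lra | exists s].
pose B := [set y : 'rV[R]_d | `|y - y0| < rho].
have oB : open B.
  apply: open_dist => y yB; exists (rho - `|y - y0|); first by rewrite subr_gt0.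
  by move=> z zy; rewrite /B /= -(subrKA y); apply: le_lt_trans (ler_normD _ _) _; lra.
have B0 : B !=set0 by exists y0; rewrite /B /= subrr normr0.
have [y [By HVy]] := Baire HV B0 oB.
exists y => //.
move=> i x xr E; have [s s0 /(_ x xr)] := HVy i Logic.I.
by rewrite E subrr normr0 leNgt s0.
Qed.

End baire_images.

(** * Bump functions *)

Section flat_function.
Variable R : realType.

(* [flat j t = t^-j exp(-1/t)] for t > 0: this family is closed under differentiation. *)
Definition flat (j : nat) (t : R) : R := if 0 < t then t ^- j * expR (- t^-1) else 0.

Lemma flat_le j (t : R) : 0 < t -> flat j t <= j.+1`!%:R * t.
Proof.
move=> t0; rewrite /flat t0.
have ti : 0 < t^-1 by rewrite invr_gt0.
have fp : 0 < (j.+1`!%:R : R) by rewrite ltr0n fact_gt0.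
have H := expR_ge1Dxn j (ltW ti).
rewrite expRN ler_pdivrMr ?expR_gt0 //.
have H2 : t^-1 ^+ j.+1 / j.+1`!%:R <= expR t^-1 by apply: le_trans H; rewrite lerDr.
apply: le_trans (ler_wpM2l (ltW (mulr_gt0 fp t0)) H2).
rewrite mulrCA mulrA exprVn exprS invfM.
have pj : 0 < t ^+ j by rewrite exprn_gt0.
move: (t ^+ j) (j.+1`!%:R : R) pj fp => p F p0 F0.
have -> // : t^-1 / p * (F * t) / F = p^-1.
by field; rewrite !gt_eqF.
Qed.

Lemma flat_ge0 j (t : R) : 0 <= flat j t.
Proof.
rewrite /flat; case: ifP => // t0; rewrite mulr_ge0 ?expR_ge0 // invr_ge0 exprn_ge0 //; exact: ltW.
Qed.

Lemma flat_shift j (t : R) : flat j t = t * flat j.+1 t.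
Proof.
rewrite /flat; case: ifP => t0; last by rewrite mulr0.
by rewrite mulrA exprS invfM mulrA divff ?gt_eqF // mul1r.
Qed.

Lemma is_derive_flat j (t : R) :
  is_derive (t : R^o) (1 : R^o) (flat j : R^o -> R^o) (flat j.+2 t - j%:R * flat j.+1 t).
Proof.
have [t0|t0|t0] := ltrgt0P t.
- have E : \forall s \near (t : R^o), s ^- j * expR (- s^-1) = flat j s.
    apply/near_dist; exists t => // s; rewrite ltr_norml => /andP[s1 s2].
    by rewrite /flat (_ : 0 < s = true) //; lra.
  apply: is_derive_near E _.
  have tn : t != 0 by rewrite gt_eqF.
  have tj : t ^+ j != 0 by rewrite expf_neq0.
  have dX : is_derive (t : R) (1 : R) (fun s : R => s ^+ j) (j%:R * t ^+ j.-1).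
    split; first exact: exprn_derivable.
    by rewrite exp_derive /GRing.scale /= mulr1.
  have dXV := @is_deriveV _ (fun s : R => s ^+ j) t _ 1 tj dX.
  have dV := is_deriveN (@is_deriveV _ id t _ 1 tn (is_derive_id (t : R) (1 : R))).
  have dE := @is_derive1_comp _ expR (fun s => - s^-1) t _ _ (is_derive_expR (- t^-1)) dV.
  have := @is_deriveM _ _ (fun s : R => s ^- j) (expR \o (fun s => - s^-1)) t 1 _ _ dXV dE.
  rewrite /flat t0 /GRing.scale /= !mulr1 opprK => H.
  apply: (@is_derive_eq _ _ _ _ _ _ _ _ H).
  have pj : t ^+ j != 0 by [].
  rewrite !exprS; case: j tj {dX dXV H pj} => [|i] tj.
    by rewrite !expr0; field.
  have ti : t ^+ i != 0 by rewrite expf_neq0.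
  by rewrite /= !expr0 exprS; field; rewrite ti tn.
- have E : \forall s \near (t : R^o), 0 = flat j s.
    apply/near_dist; exists (- t); first by rewrite oppr_gt0.
    move=> s; rewrite ltr_norml => /andP[s1 s2].
    by rewrite /flat (_ : 0 < s = false) //; apply/negbTE; rewrite -leNgt; lra.
  have -> : flat j.+2 t - j%:R * flat j.+1 t = 0.
    by rewrite /flat (_ : 0 < t = false) ?mulr0 ?subrr //; apply/negbTE; rewrite -leNgt ltW.
  apply: is_derive_near E _; exact: is_derive_cst.
- have fl0 i : flat i 0 = 0 by rewrite /flat ltxx.
  rewrite t0 !fl0 mulr0 subrr.
  apply/is_derive_diff.
  have [|L HL] := @linear_pack R R^o R^o (fun=> 0).
    by move=> a u v; rewrite scaler0 addr0.
  have [| |dd ->] := @eps_diff R R^o R^o (flat j) 0 L; last by rewrite HL.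
    by rewrite HL; exact: cst_continuous.
  move=> e e0; apply/near_dist; exists (e / (j.+2`!%:R + 1)); first by rewrite divr_gt0 // ltr_wpDl.
  move=> y; rewrite !subr0 HL fl0 !subr0 => ye.
  have [y0|y0] := ltP 0 y; last by rewrite /flat ltNge y0 /= normr0 mulr_ge0 // ltW.
  rewrite ger0_norm ?flat_ge0 // flat_shift (gtr0_norm y0) mulrC ler_wpM2r ?(ltW y0) //.
  apply: le_trans (flat_le _ y0) _.
  move: ye; rewrite gtr0_norm // ltr_pdivlMr ?ltr_wpDl // => /ltW; apply: le_trans.
  by rewrite mulrC ler_wpM2l ?(ltW y0) // lerDl.
Qed.

Lemma Ck_id (V : normedModType R) k (A : set V) : Ck k A (id : V -> V).
Proof.
case: k => [x _|k]; first exact: cvg_id.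
split => [x _|v]; first by have H := is_diff_id x; exact: ex_diff.
rewrite (_ : (fun x => _) = fun=> v); first exact: Ck_cst.
by apply/funext => x; have H := is_diff_id x; rewrite diff_val.
Qed.

Lemma Ck_derive (f df : R -> R) k : (forall t, is_derive (t : R^o) (1 : R^o) (f : R^o -> R^o) (df t)) ->
  Ck k setT (df : R^o -> R^o) -> Ck k.+1 setT (f : R^o -> R^o).
Proof.
move=> H C; split=> [t _|v]; first by have /is_derive_diff[] := H t.
have E : (fun x : R^o => 'd (f : R^o -> R^o) x v : R^o) = (fun x => v * df x).
  apply/funext => x; have /is_derive_diff[_ E] := H x.
  by rewrite -{1}[v]mulr1 -[v * 1]/(v *: (1 : R^o)) linearZ /= E.
rewrite E; apply: Ck_M => //; [exact: openT | exact: Ck_cst].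
Qed.

Lemma smooth_flat k j : Ck k setT (flat j : R^o -> R^o).
Proof.
elim: k j => [|k IH] j.
  by move=> t _; exact: is_derive_cont (is_derive_flat j t).
apply: Ck_derive (is_derive_flat j) _.
apply: (@Ck_D R R^o R^o k setT (flat j.+2) (fun t => - (j%:R * flat j.+1 t))); [exact: openT| exact: IH|].
have -> : (fun t : R^o => - (j%:R * flat j.+1 t) : R^o) = (fun t : R^o => - j%:R * flat j.+1 t).
  by apply/funext => t; rewrite mulNr.
apply: (@Ck_M R R^o k setT (fun=> - j%:R) (flat j.+1)); [exact: openT|exact: Ck_cst|exact: IH].
Qed.

Lemma Ck_inv (V : normedModType R) k (A : set V) (f : V -> R^o) : open A -> (forall x, A x -> f x != 0) ->
  Ck k A f -> Ck k A (fun x => (f x)^-1 : R^o).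
Proof.
move=> oA f0; elim: k => [|k IH].
  by move=> Cf x Ax; apply: cvgV; [exact: f0|exact: Cf].
move=> Cf; have [df Df] := Cf; split=> [x Ax|v].
  by apply: differentiableV; [exact: df|exact: f0].
have H1 := IH (Ck_S Cf).
have H2 := Ck_M oA (Ck_cst k A (-1 : R^o)) (Ck_M oA (Ck_M oA H1 H1) (Df v)).
apply: Ck_eq H2 => // x Ax.
have -> : 'd (fun x0 : V => (f x0)^-1 : R^o) x v = - (f x ^- 2) *: 'd f x v by rewrite (diffV (df x Ax) (f0
    x Ax)).
move: ('d f x v) (f x) => w y; rewrite -[RHS]/(- (y ^- 2) * w) expr2 invfM; ring.
Qed.

Definition smooth_step (t : R) : R := flat 0 t / (flat 0 t + flat 0 (1 - t)).

Lemma flat_gt0 j t : 0 < t -> 0 < flat j t.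
Proof. by rewrite /flat => t0; rewrite t0 mulr_gt0 ?expR_gt0 // invr_gt0 exprn_gt0. Qed.

Lemma smooth_step_den t : flat 0 t + flat 0 (1 - t) != 0.
Proof.
rewrite gt_eqF //; have [t0|t0] := ltP 0 t.
  by apply: ltr_pwDl; [exact: flat_gt0|exact: flat_ge0].
by apply: ltr_wpDl; [exact: flat_ge0|apply: flat_gt0; lra].
Qed.

Lemma smooth_step0 t : t <= 0 -> smooth_step t = 0.
Proof. by move=> t0; rewrite /smooth_step {1}/flat ltNge t0 mul0r. Qed.

Lemma smooth_step1 t : 1 <= t -> smooth_step t = 1.
Proof.
move=> t1; have := smooth_step_den t; rewrite /smooth_step.
have -> : flat 0 (1 - t) = 0 by rewrite {1}/flat ltNge (_ : 1 - t <= 0) //; lra.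
by rewrite addr0 => h; rewrite divff.
Qed.

Lemma Ck_smooth_step k : Ck k setT (smooth_step : R^o -> R^o).
Proof.
apply: (@Ck_M R R^o k setT (flat 0) (fun t => (flat 0 t + flat 0 (1 - t))^-1)); first exact: openT.
  exact: smooth_flat.
apply: Ck_inv; [exact: openT|by move=> t _; exact: smooth_step_den|].
apply: (@Ck_D R R^o R^o k setT (flat 0) (fun t => flat 0 (1 - t))); [exact: openT|exact: smooth_flat|].
apply: (@Ck_comp R R^o R^o k setT setT (fun t => 1 - t) (flat 0)) => //; [exact: fin_basis_R|exact: openT|
    |exact: smooth_flat].
apply: (@Ck_D R R^o R^o k setT (fun=> 1) (fun t => - t)); [exact: openT|exact: Ck_cst|].
have [|L HL] := @linear_pack R R^o R^o (fun t => - t); first by move=> a u v; rewrite opprD scalerN.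
have := @Ck_lin R R^o R^o R^o k setT id L.
rewrite HL; apply; [by move=> x; apply: cvgN; exact: cvg_id|exact: openT|].
exact: Ck_id.
Qed.

(** Squares keep each factor smooth. A factor is 1 when its coordinate differs by at most r and 0
    once the difference reaches sqrt 2 times r, hence at 2r; the product matches the balls of the
    sup norm. *)
Definition bump n (u0 : 'rV[R]_n) (r : R) (u : 'rV[R]_n) : R :=
  \prod_i smooth_step (2 - (u 0 i - u0 0 i) ^+ 2 / r ^+ 2).

Lemma Ck_bump n (u0 : 'rV[R]_n) (r : R) k : Ck k setT (bump u0 r : _ -> R^o).
Proof.
have oT : open [set: 'rV[R]_n] by exact: openT.
have H i : Ck k setT (fun u : 'rV[R]_n => smooth_step (2 - (u 0 i - u0 0 i) ^+ 2 / r ^+ 2) : R^o).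
  apply: (@Ck_comp R _ R^o k setT setT (fun u : 'rV[R]_n => 2 - (u 0 i - u0 0 i) ^+ 2 / r ^+ 2)
      smooth_step) => //.
  - exact: fin_basis_R.
  - have C1 : Ck k setT (fun u : 'rV[R]_n => u 0 i - u0 0 i : R^o).
      apply: (@Ck_D R _ R^o k setT (fun u : 'rV[R]_n => u 0 i) (fun=> - u0 0 i)) => //; last exact: Ck_cst.
      by apply: (Ck_coord k id oT).1; exact: Ck_id.
    have C2 := Ck_D oT (Ck_cst k setT (2 : R^o)) (Ck_M oT (Ck_cst k setT (- r ^- 2 : R^o)) (Ck_M oT C1 C1)).
    by apply: Ck_eq C2 => // u _; rewrite expr2; ring.
  - exact: Ck_smooth_step.
rewrite /bump; elim: (index_enum _) => [|i s IH].
  by under eq_fun do rewrite big_nil; exact: Ck_cst.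
by under eq_fun do rewrite big_cons; exact: Ck_M oT (H i) IH.
Qed.

Lemma bump1 n (u0 u : 'rV[R]_n) (r : R) : 0 < r -> `|u - u0| <= r -> bump u0 r u = 1.
Proof.
move=> r0 /(rV_norm_le _ (ltW r0)).1 H; rewrite /bump big1 // => i _; apply: smooth_step1.
have := H i; rewrite !mxE => h.
have : (u 0 i - u0 0 i) ^+ 2 / r ^+ 2 <= 1.
  by rewrite ler_pdivrMr ?exprn_gt0 // mul1r; move: h; rewrite ler_norml => /andP[]; nra.
lra.
Qed.

Lemma bump0 n (u0 u : 'rV[R]_n) (r : R) : 0 < r -> 2 * r <= `|u - u0| -> bump u0 r u = 0.
Proof.
move=> r0 H.
have [i Hi] : exists i, 2 * r <= `|u 0 i - u0 0 i|.
  have [|[i1 i] Hi] := @mx_norm_neq0 _ _ _ (u - u0).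
    by rewrite -/(`|u - u0|) gt_eqF //; apply: lt_le_trans H; rewrite mulr_gt0.
  by exists i; move: H; rewrite /Num.Def.normr /= Hi !mxE ord1.
rewrite /bump (bigD1 i) //= smooth_step0 ?mul0r //.
have : 2 <= (u 0 i - u0 0 i) ^+ 2 / r ^+ 2.
  by rewrite ler_pdivlMr ?exprn_gt0 //; move: Hi; rewrite ler_normr => /orP[]; nra.
lra.
Qed.

End flat_function.

(** * Smooth functions and maps on manifolds *)

Section smooth_germs.
Variable R : realType.

Lemma smooth_near (V W : normedModType R) (f g : V -> W) x :
  (\forall y \near x, f y = g y) -> smooth_at f x -> smooth_at g x.
Proof.
move=> fg [A [oA Ax Cf]]; have [d d0 Hd] := (near_dist x _).1 fg.
pose B := A `&` [set y | `|y - x| < d].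
have oB : open B.
  apply: openI => //; apply: open_dist => y yd; exists (d - `|y - x|); first by rewrite subr_gt0.
  by move=> z zy; rewrite /= -(subrKA y); apply: le_lt_trans (ler_normD _ _) _; lra.
exists B; split => //; first by split => //; rewrite /= subrr normr0.
by move=> k; apply: (Ck_eq oB) (Ck_sub _ (Cf k)) => y []; [move=> _; exact: Hd|].
Qed.

Lemma smooth_at_open (V W : normedModType R) (f : V -> W) x :
  smooth_at f x -> \forall y \near x, smooth_at f y.
Proof.
move=> [A [oA Ax Cf]]; have : \forall y \near x, A y by exact: open_near.
by apply: filterS => y Ay; exists A.
Qed.

Variables (T : topologicalType) (U : set T) (n : nat) (M : manifold_on R U n).
Local Notation phi := (chart_at M).

Lemma chartP x : U x -> cdom (phi x) x. Proof. exact: mf_chart. Qed.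

Lemma near_chart x z : U x -> cdom (phi x) z ->
  \forall u \near (phi x z), cdom (phi x) (cinv (phi x) u) /\ phi x (cinv (phi x) u) = u.
Proof.
move=> Ux xz; have o := @cimg_open _ _ _ (phi x).
have : \forall u \near (phi x z), (phi x @` cdom (phi x)) u.
  by apply: open_near => //; exists z.
by apply: filterS => _ [y dy <-]; rewrite cmapK.
Qed.

Lemma cinvK x z : cdom (phi x) z -> cinv (phi x) (phi x z) = z.
Proof. exact: cmapK. Qed.

Lemma near_cdom x z : cdom (phi x) z -> \forall y \near z, cdom (phi x) y.
Proof. by move=> dz; apply: open_nbhs_nbhs; split => //; exact: cdom_open. Qed.

Lemma near_cinv x z (A : set T) : cdom (phi x) z -> (\forall y \near z, A y) ->
  \forall u \near (phi x z), A (cinv (phi x) u).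
Proof.
move=> dz nA; have c := @cinv_continuous _ _ _ (phi x) (phi x z).
have := c (ex_intro2 _ _ z dz erefl); rewrite /prop_for /continuous_at cinvK //.
by move/(_ A nA).
Qed.

Lemma near_cmap x z (A : set 'rV[R]_n) : cdom (phi x) z -> (\forall u \near (phi x z), A u) ->
  \forall y \near z, A (phi x y).
Proof. by move=> dz nA; exact: (cmap_continuous dz nA). Qed.

Definition smooth_fun_at (f : T -> R) (z : T) := smooth_at (f \o cinv (phi z) : 'rV[R]_n -> R^o) (phi z z).

Lemma sm_near (f g : T -> R) z : U z -> (\forall y \near z, f y = g y) -> smooth_fun_at f z ->
    smooth_fun_at g z.
Proof.
move=> Uz fg; apply: smooth_near.
by have := near_cinv (chartP Uz) fg; apply: filterS => u /=.
Qed.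

Lemma smooth_transition (f : T -> R) x y z : U x -> U y -> cdom (phi x) z -> cdom (phi y) z ->
  smooth_at (f \o cinv (phi y) : _ -> R^o) (phi y z) -> smooth_at (f \o cinv (phi x) : _ -> R^o) (phi x z).
Proof.
move=> Ux Uy xz yz sf.
have E : \forall u \near (phi x z), ((f \o cinv (phi y)) \o (phi y \o cinv (phi x))) u = (f \o cinv (phi x)) u.
  have := near_cinv xz (near_cdom yz); apply: filterS => u du /=; by rewrite cinvK.
apply: (smooth_near E); apply: smooth_comp; first exact: fin_basis_rV.
  exact: mf_transition.
by rewrite /= cinvK.
Qed.

Lemma sm_chart (f : T -> R) x z : U x -> cdom (phi x) z ->
  smooth_fun_at f z <-> smooth_at (f \o cinv (phi x) : _ -> R^o) (phi x z).
Proof.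
move=> Ux xz; have Uz : U z by exact: mf_dom xz.
split; apply: smooth_transition => //; exact: chartP.
Qed.

Lemma sm_open (f : T -> R) z : U z -> smooth_fun_at f z -> \forall y \near z, U y /\ smooth_fun_at f y.
Proof.
move=> Uz sf; have dz := chartP Uz.
have := near_cmap dz (smooth_at_open sf).
have := near_cdom dz; apply: filterS2 => y dy sy.
by split; [exact: mf_dom dy | apply/(sm_chart f Uz dy)].
Qed.

Lemma sm_coord x z j : U x -> cdom (phi x) z -> smooth_fun_at (fun y => phi x y 0 j) z.
Proof.
move=> Ux xz; apply/(sm_chart _ Ux xz).
have E : \forall u \near (phi x z), (u : 'rV[R]_n) 0 j = ((fun y => phi x y 0 j) \o cinv (phi x)) u.
  by have := near_chart Ux xz; apply: filterS => u [_ /= ->].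
apply: (smooth_near E); exists setT; split => //; [exact: openT|].
by move=> k; apply: ((Ck_coord k id _).1 (Ck_id k setT)); exact: openT.
Qed.

Lemma sm_comp m (h : T -> 'rV[R]_m) (F : 'rV[R]_m -> R) z :
  (forall j, smooth_fun_at (fun y => h y 0 j) z) -> smooth_at (F : _ -> R^o) (h z) -> U z -> smooth_fun_at
      (F \o h) z.
Proof.
move=> sh sF Uz; apply: (@smooth_comp R _ _ (h \o cinv (phi z)) F); first exact: fin_basis_rV.
  by apply: smooth_rV => j; exact: sh.
by rewrite /= cinvK //; exact: chartP.
Qed.

Lemma sm_cst (c : R) z : smooth_fun_at (fun=> c) z.
Proof. by exists setT; split => //; [exact: openT|move=> k; exact: Ck_cst]. Qed.

Lemma smooth_M (V : normedModType R) (f g : V -> R^o) x : smooth_at f x -> smooth_at g x ->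
  smooth_at (fun y => f y * g y : R^o) x.
Proof.
move=> [A [oA Ax Cf]] [B [oB Bx Cg]]; exists (A `&` B); split => //; first exact: openI.
by move=> k; apply: Ck_M; [exact: openI|apply: Ck_sub (Cf k) => y []|apply: Ck_sub (Cg k) => y []].
Qed.

Lemma smooth_D (V W : normedModType R) (f g : V -> W) x : smooth_at f x -> smooth_at g x ->
  smooth_at (fun y => f y + g y) x.
Proof.
move=> [A [oA Ax Cf]] [B [oB Bx Cg]]; exists (A `&` B); split => //; first exact: openI.
by move=> k; apply: Ck_D; [exact: openI|apply: Ck_sub (Cf k) => y []|apply: Ck_sub (Cg k) => y []].
Qed.

Lemma sm_M f g z : smooth_fun_at f z -> smooth_fun_at g z -> smooth_fun_at (fun y => f y * g y) z.
Proof. exact: smooth_M. Qed.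

Lemma sm_D f g z : smooth_fun_at f z -> smooth_fun_at g z -> smooth_fun_at (fun y => f y + g y) z.
Proof. exact: smooth_D. Qed.

Lemma sm_sum (I : Type) (s : seq I) (f : I -> T -> R) z : (forall i, smooth_fun_at (f i) z) ->
  smooth_fun_at (fun y => \sum_(i <- s) f i y) z.
Proof.
move=> H; elim: s => [|i s IH]; first by under eq_fun do rewrite big_nil; exact: sm_cst.
by under eq_fun do rewrite big_cons; exact: sm_D.
Qed.

Lemma sm_diff (f : T -> R) z : smooth_fun_at f z -> differentiable (f \o cinv (phi z) : _ -> R^o) (phi z z).
Proof. exact: smooth_diff. Qed.

Lemma dfun_diff (f : T -> R) z i : smooth_fun_at f z -> dfun M f z 0 i = 'd (f \o cinv (phi z) : _ -> R^o)
    (phi z z) (delta_mx 0 i).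
Proof. by move=> sf; rewrite mxE deriveE //; exact: sm_diff. Qed.

Lemma dfun_near (f g : T -> R) z : U z -> (\forall y \near z, f y = g y) -> smooth_fun_at f z -> dfun M f z
    = dfun M g z.
Proof.
move=> Uz fg sf; apply/rowP => i; have sg := sm_near Uz fg sf; rewrite (dfun_diff i sf) (dfun_diff i sg).
have E := near_cinv (chartP Uz) fg.
have [_ E'] := @near_eq_diff R _ R^o (f \o cinv (phi z)) (g \o cinv (phi z)) (phi z z) E (sm_diff sf).
exact: (esym (congr1 (@^~ (delta_mx 0 i)) E')).
Qed.

Lemma dfun_comp m (h : T -> 'rV[R]_m) (F : 'rV[R]_m -> R) z : U z ->
  (forall j, smooth_fun_at (fun y => h y 0 j) z) -> smooth_at (F : _ -> R^o) (h z) ->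
  dfun M (F \o h) z = \sum_j 'D_(delta_mx 0 j) (F : _ -> R^o) (h z) *: dfun M (fun y => h y 0 j) z.
Proof.
move=> Uz sh sF; apply/rowP => i; rewrite dfun_diff; last exact: sm_comp.
have hz : h (cinv (phi z) (phi z z)) = h z by rewrite cinvK //; exact: chartP.
have dh : differentiable (h \o cinv (phi z)) (phi z z).
  by apply: smooth_diff; apply: smooth_rV => j; exact: sh.
have dF : differentiable (F : _ -> R^o) ((h \o cinv (phi z)) (phi z z)) by rewrite /= hz; exact: smooth_diff.
have := @diff_comp R _ _ _ (h \o cinv (phi z)) (F : _ -> R^o) (phi z z) dh dF.
rewrite (_ : (F \o (h \o _)) = ((F \o h) \o cinv (phi z))) // => -> /=.
rewrite (@linear_row R R^o m _ ('d (F : _ -> R^o) (h (cinv (phi z) (phi z z))))) hz summxE.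
apply: eq_bigr => j _; rewrite [RHS]mxE deriveE; last exact: smooth_diff.
have [_ <-] := diff_coord (delta_mx 0 i) j dh.
by rewrite dfun_diff; [exact: mulrC | exact: sh].
Qed.

Lemma dfun_coord x i : U x -> dfun M (fun y => phi x y 0 i) x = delta_mx 0 i.
Proof.
move=> Ux; have dx := chartP Ux.
apply/rowP => j; rewrite dfun_diff; last exact: sm_coord.
have [c cc E] := linear_coord R i.
have H : \forall u \near (phi x x), c u = ((fun y => phi x y 0 i) \o cinv (phi x) : _ -> R^o) u.
  by have := near_chart Ux dx; apply: filterS => u [_ /= ->]; rewrite E.
have [_ ->] := @near_eq_diff R _ R^o _ _ _ H (linear_differentiable _ cc).
by rewrite diff_lin // E !mxE !eqxx /= eq_sym.
Qed.

(** [dfun] at z is written in the chart at z. This change of basis lets a whole neighbourhood of x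
    be treated in the single chart at x. *)
Lemma dfun_chart f x z : U x -> cdom (phi x) z -> smooth_fun_at f z ->
  dfun M f z = \sum_j 'D_(delta_mx 0 j) (f \o cinv (phi x) : _ -> R^o) (phi x z) *: dfun M (fun y => phi x
      y 0 j) z.
Proof.
move=> Ux xz sf; have Uz : U z by exact: mf_dom xz.
rewrite -dfun_comp //; [|by move=> j; exact: sm_coord|exact/(sm_chart f Ux xz)].
apply: dfun_near => //; have := near_cdom xz; apply: filterS => y dy /=; by rewrite cinvK.
Qed.

End smooth_germs.

Section manifold_calculus.
Variable R : realType.

Lemma for_near (X Y : topologicalType) (c : X -> Y) t (A : set Y) : {for t, continuous c} ->
  (\forall y \near c t, A y) -> \forall s \near t, A (c s).
Proof. by move=> cc nA; exact: (cc A nA). Qed.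

Lemma dotvE n (a v : 'rV[R]_n) : dotv a v = \sum_i a 0 i * v 0 i.
Proof. by rewrite /dotv mxE; apply: eq_bigr => i _; rewrite mxE. Qed.

Lemma dotv_sharp n (P : 'M[R]_n) (a b : 'rV[R]_n) : dotv b (sharp P a) = bform P b a.
Proof. by rewrite /dotv /sharp /bform trmx_mul trmxK mulmxA. Qed.

Section one_manifold.
Variables (T : topologicalType) (U : set T) (n : nat) (M : manifold_on R U n).
Local Notation phi := (chart_at M).

Lemma has_velocity_comp (c : R -> T) (t : R) v (g : T -> R) : U (c t) ->
  has_velocity M c t v -> smooth_fun_at M g (c t) ->
  is_derive (t : R^o) (1 : R^o) (g \o c : R^o -> R^o) (dotv (dfun M g (c t)) v).
Proof.
move=> Uc [cc dc] sg; have dct := chartP M Uc.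
have E : \forall s \near (t : R^o), ((g \o cinv (phi (c t))) \o (phi (c t) \o c)) s = (g \o c) s.
  have := for_near cc (near_cdom dct); apply: filterS => s /= ds; by rewrite cinvK.
apply: is_derive_near E _.
have := @is_derive_comp R _ R^o (phi (c t) \o c) (g \o cinv (phi (c t))) t v (sm_diff sg) dc.
rewrite (@linear_row R R^o n v) => H.
suff -> : dotv (dfun M g (c t)) v = \sum_i v 0 i *: ('d (g \o cinv (phi (c t)) : _ -> R^o) (phi (c t) (c
    t)) (delta_mx 0 i)) by exact: H.
rewrite dotvE; apply: eq_bigr => i _; rewrite (dfun_diff i sg); exact: mulrC.
Qed.

Lemma has_velocity_coord (c : R -> T) (t : R) (v : 'rV[R]_n) : {for t, continuous c} ->
  (forall j, is_derive (t : R^o) (1 : R^o) (fun s => phi (c t) (c s) 0 j : R^o) (v 0 j)) ->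
  has_velocity M c t v.
Proof. by move=> cc H; split => //; apply/is_derive_coord. Qed.

Lemma hausdorff_on y z : U y -> U z ->
  (forall A B, nbhs y A -> nbhs z B -> (A `&` B) !=set0) -> y = z.
Proof.
move=> Uy Uz H; pose p : set_type U := exist _ y (mem_set Uy); pose q : set_type U := exist _ z (mem_set Uz).
suff : p = q by move/(congr1 set_val).
apply: (mf_hausdorff M) => A B [A' [[A0 oA <-] Ay AA]] [B' [[B0 oB <-] By BB]].
have [||x [Ax Bx]] := H (A0 `&` U) (B0 `&` U).
- by apply: filterI; apply: open_nbhs_nbhs; split => //; exact: mf_open M.
- by apply: filterI; apply: open_nbhs_nbhs; split => //; exact: mf_open M.
have Ux : U x by case: Ax.
by exists (exist _ x (mem_set Ux)); split; [apply: AA; case: Ax|apply: BB; case: Bx].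
Qed.

(** A compact set in a Hausdorff space is closed. If every neighbourhood of y met the image, the
    traces of these neighbourhoods on K would form a filter whose cluster point is sent to y. This
    keeps a bump function smooth when it is extended by zero outside its chart. *)
Lemma compact_image_closed x0 y (K : set 'rV[R]_n) : U x0 -> U y -> compact K ->
  K `<=` phi x0 @` cdom (phi x0) -> (forall u, K u -> cinv (phi x0) u <> y) ->
  \forall w \near y, forall u, K u -> cinv (phi x0) u <> w.
Proof.
move=> Ux0 Uy cK Kd Ky; apply: contrapT => nH.
pose F := [set A : set 'rV[R]_n | exists2 B, nbhs y B & [set u | K u /\ B (cinv (phi x0) u)] `<=` A].
have FF : ProperFilter F.
  apply: Build_ProperFilter_ex.
    move=> A [B nB BA]; apply: contrapT => nA; apply: nH.
    apply: filterS nB => w Bw u Ku E; apply: nA; exists u; apply: BA; split => //; by rewrite E.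
  split.
  - by exists setT => //; exact: filterT.
  - move=> A A' [B nB BA] [B' nB' BA']; exists (B `&` B'); first exact: filterI.
    by move=> u [Ku [Bu Bu']]; split; [apply: BA|apply: BA'].
  - by move=> A A' AA' [B nB BA]; exists B => // u /BA /AA'.
have FK : F K by exists setT; [exact: filterT | move=> u []].
have [u [Ku cu]] := cK F FF FK.
have [z dz zu] := Kd u Ku.
apply: (Ky u Ku); apply/esym; apply: hausdorff_on => //.
  by rewrite -zu cinvK //; exact: mf_dom dz.
move=> A B nA nB; have := @cu [set u | K u /\ A (cinv (phi x0) u)] [set u | B (cinv (phi x0) u)].
case.
- by exists A.
- by move: nB; rewrite -zu cinvK // => nB; exact: near_cinv dz nB.
- by move=> v [[Kv Av] Bv]; exists (cinv (phi x0) v).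
Qed.

Lemma extension (V : set T) (f : T -> R) z : open V -> V `<=` U -> V z -> smooth_fun M V f ->
  exists2 g, smooth_fun M U g & \forall y \near z, f y = g y.
Proof.
move=> oV VU Vz sf; have Uz := VU _ Vz; have dz := chartP M Uz.
have nV : \forall y \near z, V y by exact: open_nbhs_nbhs.
have [d d0 Hd] := (near_dist _ _).1 (near_and (near_chart Uz dz) (near_cinv dz nV)).
(* The bump vanishes outside radius 2r = d/2, so its support is a compact subset of the image of the
   chart, over V. *)
pose r := d / 4; have r0 : 0 < r by rewrite divr_gt0.
pose u0 := phi z z.
pose good y := cdom (phi z) y /\ `|phi z y - u0| < d.
pose g y := if pselect (cdom (phi z) y) then bump u0 r (phi z y) * f y else 0.
have gE y : cdom (phi z) y -> g y = bump u0 r (phi z y) * f y by rewrite /g; case: pselect.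
pose K := [set u : 'rV[R]_n | `|u - u0| <= 2 * r].
have cK : compact K.
  apply: bounded_closed_compact.
    exists (`|u0| + 2 * r); split; first exact: num_real.
    move=> x hx u Ku; rewrite -(subrK u0 u); apply: le_trans (ler_normD _ _) _.
    by move: Ku hx; rewrite /K /=; lra.
  rewrite -openC; apply: open_dist => u; rewrite /K /= => /negP; rewrite -ltNge => ur.
  exists (`|u - u0| - 2 * r); first by rewrite subr_gt0.
  move=> v vu; apply/negP; rewrite -ltNge.
  by have := ler_normD (u - v) (v - u0); rewrite subrKA (distrC u v); lra.
have Kd : K `<=` phi z @` cdom (phi z).
  move=> u Ku; have [|[h1 h2] _] := Hd u; last by exists (cinv (phi z) u).
  by move: Ku; rewrite /K /= /u0 /r; lra.
exists g; last first.
  have H : \forall u \near u0, `|u - u0| < r by apply/near_dist; exists r.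
  have := near_cdom dz; have := near_cmap dz H; apply: filterS2 => y /= yr dy.
  by rewrite gE // bump1 ?mul1r // ltW.
move=> y Uy; rewrite -/(smooth_fun_at M g y).
have [Gy|nGy] := pselect (good y).
  have [dy yd] := Gy.
  have Vy : V y by have [_] := Hd _ yd; rewrite cinvK.
  have sb : smooth_fun_at M (fun w => bump u0 r (phi z w)) y.
    apply: (@sm_comp R T U n M n (phi z) (bump u0 r)) => //.
    - by move=> j; exact: sm_coord.
    - by exists setT; split => //; [exact: openT|move=> k; exact: Ck_bump].
  apply: (sm_near Uy _ (sm_M sb (sf y Vy))).
  by have := near_cdom dy; apply: filterS => w dw; rewrite gE.
apply: (@sm_near R T U n M (fun=> 0) g y Uy); last exact: sm_cst.
have nK : forall u, K u -> cinv (phi z) u <> y.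
  move=> u Ku E; apply: nGy; have [|[h1 h2] _] := Hd u.
    by move: Ku; rewrite /K /= /u0 /r; lra.
  by split; rewrite -E // h2; move: Ku; rewrite /K /= /r; lra.
have := compact_image_closed Uz Uy cK Kd nK; apply: filterS => w Hw.
rewrite /g; case: pselect => // dw; rewrite bump0 ?mul0r // leNgt; apply/negP => h.
by apply: (Hw (phi z w)); [rewrite /K /= ltW | rewrite cinvK].
Qed.

End one_manifold.
End manifold_calculus.

(** * Pull-back of functions, tangent maps and partial maps *)

Section manifold_maps.
Variable R : realType.

Definition smooth_map_at (T1 T2 : topologicalType) (U1 : set T1) (U2 : set T2) n1 n2
  (M1 : manifold_on R U1 n1) (M2 : manifold_on R U2 n2) (f : T1 -> T2) (x : T1) :=
  [/\ U2 (f x), {for x, continuous f} & smooth_at (local_rep M1 M2 f x) (chart_at M1 x x)].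

Section two_manifolds.
Variables (T1 T2 : topologicalType) (U1 : set T1) (U2 : set T2) (n1 n2 : nat).
Variables (M1 : manifold_on R U1 n1) (M2 : manifold_on R U2 n2).

Lemma near_local_rep (f : T1 -> T2) (g : T2 -> R) x : U1 x -> smooth_map_at M1 M2 f x ->
  \forall u \near (chart_at M1 x x), ((g \o cinv (chart_at M2 (f x))) \o local_rep M1 M2 f x) u =
    ((g \o f) \o cinv (chart_at M1 x)) u.
Proof.
move=> Ux [U2f cf _]; have d2 := chartP M2 U2f.
have := near_cinv (chartP M1 Ux) (for_near cf (near_cdom d2)).
by apply: filterS => u du; rewrite /local_rep /= cinvK.
Qed.

Lemma local_rep_base (f : T1 -> T2) x : U1 x -> local_rep M1 M2 f x (chart_at M1 x x) = chart_at M2 (f x) (f x).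
Proof. by move=> Ux; rewrite /local_rep /= cinvK //; exact: chartP. Qed.

Lemma sm_pull (f : T1 -> T2) (g : T2 -> R) x : U1 x -> smooth_map_at M1 M2 f x -> smooth_fun_at M2 g (f x)
    -> smooth_fun_at M1 (g \o f) x.
Proof.
move=> Ux Hf sg; apply: (smooth_near (near_local_rep g Ux Hf)).
have [U2f cf sf] := Hf; apply: smooth_comp => //; first exact: fin_basis_rV.
by rewrite local_rep_base.
Qed.

Lemma dfun_pull (f : T1 -> T2) (g : T2 -> R) x : U1 x -> smooth_map_at M1 M2 f x -> smooth_fun_at M2 g (f x) ->
  dfun M1 (g \o f) x = dfun M2 g (f x) *m (tmap M1 M2 f x)^T.
Proof.
move=> Ux Hf sg; have [U2f cf sf] := Hf.
apply/rowP => i; rewrite (dfun_diff i (sm_pull Ux Hf sg)).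
have E := near_local_rep g Ux Hf.
have dl := smooth_diff sf.
have dg : differentiable (g \o cinv (chart_at M2 (f x)) : _ -> R^o) (local_rep M1 M2 f x (chart_at M1 x x)).
  by rewrite local_rep_base //; exact: sm_diff.
have [_ E'] := @near_eq_diff R _ R^o _ _ (chart_at M1 x x) E (differentiable_comp dl dg).
have E2 := congr1 (@^~ (delta_mx 0 i)) E'; rewrite /= in E2; rewrite E2 {E E' E2}.
rewrite (diff_comp dl dg) /= (@linear_row R R^o n2 _ ('d (g \o cinv (chart_at M2 (f x)) : _ -> R^o)
    (local_rep M1 M2 f x (chart_at M1 x x)))).
rewrite mxE; apply: eq_bigr => j _; rewrite local_rep_base // (dfun_diff j sg) !mxE.
rewrite -[RHS]mulrC; congr (_ * _).
Qed.

(** Tangent maps are thereby determined by differentials of functions, which is how the chain rule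
    below is obtained. *)
Lemma tmapE (f : T1 -> T2) x i j : U1 x -> smooth_map_at M1 M2 f x ->
  tmap M1 M2 f x i j = dfun M1 (fun y => chart_at M2 (f x) (f y) 0 j) x 0 i.
Proof.
move=> Ux Hf; have [U2f cf sf] := Hf.
have sc := sm_coord j U2f (chartP M2 U2f).
by rewrite (dfun_pull Ux Hf sc) dfun_coord // -rowE !mxE.
Qed.

End two_manifolds.

Lemma smap_comp (T1 T2 T3 : topologicalType) (U1 : set T1) (U2 : set T2) (U3 : set T3) n1 n2 n3
  (M1 : manifold_on R U1 n1) (M2 : manifold_on R U2 n2) (M3 : manifold_on R U3 n3)
  (f : T1 -> T2) (g : T2 -> T3) x : U1 x -> smooth_map_at M1 M2 f x -> smooth_map_at M2 M3 g (f x) ->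
  smooth_map_at M1 M3 (g \o f) x /\ tmap M1 M3 (g \o f) x = tmap M1 M2 f x *m tmap M2 M3 g (f x).
Proof.
move=> Ux Hf Hg; have [U2f cf sf] := Hf; have [U3g cg sg] := Hg.
have S : smooth_map_at M1 M3 (g \o f) x.
  split => //; first exact: continuous_comp.
  apply: smooth_rV => j.
  have := sm_pull Ux Hf (sm_pull U2f Hg (sm_coord j U3g (chartP M3 U3g))); exact.
split => //; apply/matrixP => i j; rewrite (tmapE i j Ux S).
have sc := sm_coord j U3g (chartP M3 U3g).
have := dfun_pull Ux Hf (sm_pull U2f Hg sc).
rewrite (dfun_pull U2f Hg sc) dfun_coord // -mulmxA -rowE.
move/(congr1 (fun v : 'rV_n1 => v 0 i)); rewrite -trmx_mul !mxE => <-.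
by [].
Qed.

Lemma smooth_pair_cst (V W : normedModType R) (c : W) k (A : set V) : Ck k A (fun v : V => (v, c)).
Proof.
case: k => [x _|k]; first by apply: cvg_pair; [exact: cvg_id|exact: cvg_cst].
have H x : differentiable (fun v : V => (v, c)) x /\ 'd (fun v : V => (v, c)) x = (fun v => (v, 0)) :> (V
    -> V * W).
  have D := is_diff_pair (is_diff_id x) (is_diff_cst c x).
  by split; [exact: (@ex_diff _ _ _ _ _ _ _ D) | exact: (@diff_val _ _ _ _ _ _ _ D)].
split => [x _|v]; first by have [] := H x.
rewrite (_ : (fun x => _) = fun=> (v, 0)); first exact: Ck_cst.
by apply/funext => x; have [_ ->] := H x.
Qed.

Lemma smooth_cst_pair (V W : normedModType R) (c : V) k (A : set W) : Ck k A (fun v : W => (c, v)).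
Proof.
case: k => [x _|k]; first by apply: cvg_pair; [exact: cvg_cst|exact: cvg_id].
have H x : differentiable (fun v : W => (c, v)) x /\ 'd (fun v : W => (c, v)) x = (fun v => (0, v)) :> (W
    -> V * W).
  have D := is_diff_pair (is_diff_cst c x) (is_diff_id x).
  by split; [exact: (@ex_diff _ _ _ _ _ _ _ D) | exact: (@diff_val _ _ _ _ _ _ _ D)].
split => [x _|v]; first by have [] := H x.
rewrite (_ : (fun x => _) = fun=> (0, v)); first exact: Ck_cst.
by apply/funext => x; have [_ ->] := H x.
Qed.

Section smooth_map2.
Variables (T1 T2 T3 : topologicalType) (n1 n2 n3 : nat).
Variables (M1 : manifold_on R [set: T1] n1) (M2 : manifold_on R [set: T2] n2) (M3 : manifold_on R [set: T3] n3).
Variable f : T1 -> T2 -> T3.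
Hypothesis Hf : smooth_map2 M1 M2 M3 f.

Lemma smap2l x y : smooth_map_at M1 M3 (f^~ y) x.
Proof.
have [cf sf] := Hf x y; split => //.
  apply: (@continuous_comp _ _ _ (fun x => (x, y)) (fun z => f z.1 z.2)) => //.
  by apply: cvg_pair; [exact: cvg_id|exact: cvg_cst].
pose c := chart_at M2 y y.
have H : smooth_at (fun w : 'rV[R]_n1 => (w, c)) (chart_at M1 x x).
  by exists setT; split => //; [exact: openT|move=> k; exact: smooth_pair_cst].
have := smooth_comp_rV (fin_basis_prod (fin_basis_rV R n1) (fin_basis_rV R n2)) H sf.
congr (smooth_at _ _); apply/funext => w /=.
by rewrite /local_rep /= /c cinvK //; exact: chartP.
Qed.

Lemma smap2r x y : smooth_map_at M2 M3 (f x) y.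
Proof.
have [cf sf] := Hf x y; split => //.
  apply: (@continuous_comp _ _ _ (fun y => (x, y)) (fun z => f z.1 z.2)) => //.
  by apply: cvg_pair; [exact: cvg_cst|exact: cvg_id].
pose c := chart_at M1 x x.
have H : smooth_at (fun w : 'rV[R]_n2 => (c, w)) (chart_at M2 y y).
  by exists setT; split => //; [exact: openT|move=> k; exact: smooth_cst_pair].
have := smooth_comp_rV (fin_basis_prod (fin_basis_rV R n1) (fin_basis_rV R n2)) H sf.
congr (smooth_at _ _); apply/funext => w /=.
by rewrite /local_rep /= /c cinvK //; exact: chartP.
Qed.
End smooth_map2.
End manifold_maps.

(** * Hamiltonian curves *)

Section hamiltonian.
Variable R : realType.

Lemma near_and_top (X : topologicalType) (x : X) (A B : X -> Prop) :
  (\forall y \near x, A y) -> (\forall y \near x, B y) -> \forall y \near x, A y /\ B y.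
Proof. exact: filterI. Qed.

Lemma continuous_near_eq (X Y : topologicalType) (c d : X -> Y) t : (\forall s \near t, c s = d s) ->
  {for t, continuous c} -> {for t, continuous d}.
Proof.
move=> E cc A; rewrite -(nbhs_singleton E) => nA; have := near_and_top (for_near cc nA) E.
by apply: filterS => s [As Es]; rewrite /= -Es.
Qed.

Lemma bform_suml n (P : 'M[R]_n) (I : Type) (s : seq I) (c : I -> R) (a : I -> 'rV[R]_n) b :
  bform P (\sum_(i <- s) c i *: a i) b = \sum_(i <- s) c i * bform P (a i) b.
Proof.
rewrite /bform mulmx_suml mulmx_suml summxE; apply: eq_bigr => i _.
by rewrite -!scalemxAl mxE.
Qed.

Lemma bform_sumr n (P : 'M[R]_n) (I : Type) (s : seq I) (c : I -> R) a (b : I -> 'rV[R]_n) :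
  bform P a (\sum_(i <- s) c i *: b i) = \sum_(i <- s) c i * bform P a (b i).
Proof.
rewrite /bform linear_sum mulmx_sumr summxE; apply: eq_bigr => i _.
by rewrite linearZ -scalemxAr mxE.
Qed.

Lemma bform_delta n (P : 'M[R]_n) a j : bform P (delta_mx 0 j) a = sharp P a 0 j.
Proof.
rewrite -dotv_sharp dotvE (bigD1 j) //= mxE !eqxx mul1r big1 ?addr0 // => i ij.
by rewrite mxE eqxx (negbTE ij) mul0r.
Qed.

Section one.
Variables (T : topologicalType) (U : set T) (n : nat) (M : manifold_on R U n).
Local Notation phi := (chart_at M).
Variable P : T -> 'M[R]_n.
Hypothesis HP : bivector_field M P.

(* [bivector_field] only speaks of globally defined functions. *)
Lemma sm_ext f z : U z -> smooth_fun_at M f z -> exists2 g, smooth_fun M U g & \forall y \near z, f y = g y.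
Proof.
move=> Uz sf; have [V [[oV Vz] VH]] : exists V, open_nbhs z V /\ V `<=` [set y | U y /\ smooth_fun_at M f y].
  have := sm_open Uz sf; rewrite -[X in X -> _]/(nbhs z _) nbhsE => -[V ? ?]; by exists V.
by apply: (@extension R T U n M V f z oV _ Vz) => y /VH [].
Qed.

Lemma bracket_near (Q : T -> 'M[R]_n) f g f' g' z : U z -> smooth_fun_at M f z -> smooth_fun_at M g z ->
  (\forall y \near z, f y = f' y) -> (\forall y \near z, g y = g' y) ->
  bracket M Q f g z = bracket M Q f' g' z.
Proof.
by move=> Uz sf sg ff gg; rewrite /bracket (dfun_near Uz ff sf) (dfun_near Uz gg sg).
Qed.

Lemma sm_bracket f g z : U z -> smooth_fun_at M f z -> smooth_fun_at M g z -> smooth_fun_at M (bracket M P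
    f g) z.
Proof.
move=> Uz sf sg; have [f' sf' ff'] := sm_ext Uz sf; have [g' sg' gg'] := sm_ext Uz sg.
have H := HP.2 f' g' sf' sg' z Uz.
apply: (sm_near Uz _ H).
have := sm_open Uz sf; have := sm_open Uz sg.
have := nbhs_interior ff'; have := nbhs_interior gg'.
move=> h1 h2 h3 h4; have := near_and_top (near_and_top h1 h2) (near_and_top h3 h4).
apply: filterS => y [[gy fy] [[Uy sgy] [_ sfy]]].
by apply/esym; apply: bracket_near.
Qed.

Lemma dfun_sum m (a : 'I_m -> R) (f : 'I_m -> T -> R) z : U z -> (forall i, smooth_fun_at M (f i) z) ->
  dfun M (fun y => \sum_i a i * f i y) z = \sum_i a i *: dfun M (f i) z.
Proof.
move=> Uz sf; pose h y := \row_i f i y.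
have hE i : (fun y => h y 0 i) = f i by apply/funext => y; rewrite mxE.
have [L HL] : exists L : {linear 'rV[R]_m -> R^o}, L = (fun v => \sum_i a i * v 0 i) :> (_ -> _).
  apply: linear_pack => c u v; rewrite scaler_sumr -big_split /=; apply: eq_bigr => i _.
  by rewrite !mxE -[c *: _]/(c * _); ring.
have cL : continuous L.
  have [C C0 HC] := mulmx_bound (\col_i a i).
  apply: (@lip_continuous R _ R^o L C); first exact: ltW.
  move=> x y; rewrite -linearB HL; apply: le_trans (HC _).
  have -> : \sum_i a i * (x - y) 0 i = ((x - y) *m (\col_i a i)) 0 0.
    by rewrite [RHS]mxE; apply: eq_bigr => i _; rewrite [X in _ = _ * X]mxE mulrC.
  by apply: (rV_norm_le _ (normr_ge0 _)).1.
have -> : (fun y => \sum_i a i * f i y) = (L : _ -> R) \o h.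
  by apply/funext => y; rewrite /= HL; apply: eq_bigr => i _; rewrite mxE.
have sL : smooth_at (L : _ -> R^o) (h z).
  exists setT; split => //; [exact: openT|move=> k].
  by apply: (@Ck_lin R _ _ R^o k setT id L) => //; [exact: openT|exact: Ck_id].
rewrite (@dfun_comp R T U n M m h L z Uz) //; last by move=> j; rewrite hE.
apply: eq_bigr => i _; rewrite hE; congr (_ *: _).
have dL : differentiable (L : _ -> R^o) (h z) by exact: linear_differentiable.
rewrite deriveE // diff_lin // HL (bigD1 i) //= mxE !eqxx mulr1 big1 ?addr0 // => j ij.
by rewrite mxE eqxx (negbTE ij) mulr0.
Qed.

(** Hamilton's equation tested on functions. [has_velocity] uses a chart that changes with c t; this
    form does not depend on charts, and it passes directly through maps that respect the
    brackets. *)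
Definition ham_vel (F : T -> R) (c : R -> T) (t : R) :=
  {for t, continuous c} /\ forall g, smooth_fun_at M g (c t) ->
    is_derive (t : R^o) (1 : R^o) (g \o c : R^o -> R^o) (bracket M P g F (c t)).

Lemma ham_velP F c t : U (c t) -> has_velocity M c t (sharp (P (c t)) (dfun M F (c t))) <-> ham_vel F c t.
Proof.
move=> Uc; split=> [H|[cc H]].
  split; first by case: H.
  by move=> g sg; have := has_velocity_comp Uc H sg; rewrite dotv_sharp.
apply: has_velocity_coord => // j.
have := H _ (sm_coord j Uc (chartP M Uc)).
by rewrite /bracket dfun_coord // bform_delta.
Qed.

Lemma ham_vel_chart F x0 c u t : U x0 -> cdom (phi x0) (c t) ->
  (\forall s \near (t : R^o), c s = cinv (phi x0) (u s)) -> u t = phi x0 (c t) ->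
  (forall j, is_derive (t : R^o) (1 : R^o) (fun s => u s 0 j : R^o)
     (bracket M P (fun y => phi x0 y 0 j) F (c t))) -> ham_vel F c t.
Proof.
move=> Ux0 dct E Et Hu.
have Uc : U (c t) by exact: mf_dom dct.
have du : is_derive (t : R^o) (1 : R^o) (u : R^o -> 'rV[R]_n) (\row_j bracket M P (fun y => phi x0 y 0 j) F
    (c t)).
  by apply/is_derive_coord => j; rewrite mxE.
split.
  have cu := is_derive_cont du.
  have ci : {for u t, continuous (cinv (phi x0))}.
    by apply: cinv_continuous; exists (c t).
  apply: (@continuous_near_eq _ _ (cinv (phi x0) \o u)); last exact: continuous_comp cu ci.
  by apply: filterS E => s ->.
move=> g sg.
have E' : \forall s \near (t : R^o), ((g \o cinv (phi x0)) \o u) s = (g \o c) s.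
  by apply: filterS E => s /= ->.
apply: is_derive_near E' _.
have sg' : smooth_at (g \o cinv (phi x0) : _ -> R^o) (u t) by rewrite Et; apply/(sm_chart g Ux0 dct).
have := @is_derive_comp R _ R^o u (g \o cinv (phi x0)) t _ (smooth_diff sg') du.
rewrite (@linear_row R R^o n _ ('d (g \o cinv (phi x0) : _ -> R^o) (u t))) => H.
suff -> : bracket M P g F (c t) = \sum_i (\row_j bracket M P (fun y => phi x0 y 0 j) F (c t)) 0 i *: ('d (g
    \o cinv (phi x0) : _ -> R^o) (u t) (delta_mx 0 i)) by exact: H.
rewrite /bracket (dfun_chart Ux0 dct sg) bform_suml; apply: eq_bigr => j _.
rewrite mxE -Et deriveE; [exact: mulrC|exact: smooth_diff].
Qed.

End one.
End hamiltonian.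

(** * Flows of linear combinations of Hamiltonians *)

Section hamiltonian_flows.
Variable R : realType.
Variables (T : topologicalType) (U : set T) (n : nat) (M : manifold_on R U n).
Local Notation phi := (chart_at M).
Variable P : T -> 'M[R]_n.
Hypothesis HP : bivector_field M P.

Lemma near_and_all (X : topologicalType) (x : X) q (A : 'I_q -> X -> Prop) :
  (forall i, \forall y \near x, A i y) -> \forall y \near x, forall i, A i y.
Proof. exact: filter_forall. Qed.

Lemma bracket_sumr (Q : T -> 'M[R]_n) q (a : 'I_q -> R) (f : 'I_q -> T -> R) g z : U z -> (forall i,
    smooth_fun_at M (f i) z) ->
  bracket M Q g (fun y => \sum_i a i * f i y) z = \sum_i a i * bracket M Q g (f i) z.
Proof. by move=> Uz sf; rewrite /bracket dfun_sum // bform_sumr. Qed.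

(** Row i is the Hamiltonian vector of [f i] at y, read in the chart at z, which stays fixed while y
    varies. *)
Definition ham_mx q (f : 'I_q -> T -> R) z y : 'M[R]_(q, n) :=
  \matrix_(i, j) bracket M P (fun w => phi z w 0 j) (f i) y.

Lemma ham_mx_lip q (f : 'I_q -> T -> R) z : U z -> (forall i, smooth_fun_at M (f i) z) ->
  exists2 r : R, 0 < r & exists2 L : R, 0 < L & forall u v,
    `|u - phi z z| <= r -> `|v - phi z z| <= r ->
    `|ham_mx f z (cinv (phi z) u) - ham_mx f z (cinv (phi z) v)| <= L * `|u - v|.
Proof.
move=> Uz sf; have dz := chartP M Uz.
have S : smooth_at (fun u => mxvec (ham_mx f z (cinv (phi z) u))) (phi z z).
  apply: smooth_rV => k; case/mxvec_indexP: k => i j.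
  rewrite (_ : (fun u => _) = bracket M P (fun w => phi z w 0 j) (f i) \o cinv (phi z)); last first.
    by apply/funext => u; rewrite mxvecE mxE.
  by apply: sm_bracket => //; exact: sm_coord.
have [d d0 [C C0 H]] := sdiff_lip (smooth_sdiff S).
exists (d / 2); first by rewrite divr_gt0.
exists C => // u v ur vr; apply: mx_norm_le; first by rewrite mulr_ge0 // ltW.
move=> i j; have := H u v; rewrite -linearB => /(_ _ _).
have CC : 0 <= C * `|u - v| by rewrite mulr_ge0 // ltW.
move=> H'; have {H'} := H' (le_lt_trans ur _) (le_lt_trans vr _).
have d2 : d / 2 < d by lra.
by move=> /(_ d2 d2) /(rV_norm_le _ CC).1 /(_ (mxvec_index i j)); rewrite mxvecE.
Qed.

Lemma ham_flow q (f : 'I_q -> T -> R) z (W : set T) : U z -> (forall i, smooth_fun_at M (f i) z) ->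
  (\forall y \near z, W y) ->
  exists rho : R, exists c : 'rV[R]_q -> R -> T, [/\ 0 < rho,
    forall a, `|a| <= rho -> c a 0 = z /\ forall t, `|t| < 2 ->
      [/\ W (c a t), cdom (phi z) (c a t), (forall i, smooth_fun_at M (f i) (c a t)) &
          ham_vel M P (fun y => \sum_i a 0 i * f i y) (c a) t] &
    forall e : R, 0 < e -> exists2 rho', 0 < rho' & forall a b, `|a| <= rho' -> `|b| <= rho' ->
      `|phi z (c a 1) - phi z (c b 1) - (a - b) *m ham_mx f z z| <= e * `|a - b|].
Proof.
move=> Uz sf nW; have dz := chartP M Uz.
have [r r0 [L L0 HL]] := ham_mx_lip Uz sf.
have ns : \forall y \near z, forall i, U y /\ smooth_fun_at M (f i) y.
  by apply: near_and_all => i; exact: sm_open.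
have [d d0 Hd] := (near_dist _ _).1 (near_and (near_chart Uz dz) (near_cinv dz (near_and_top nW ns))).
have d2 : 0 < d / 2 by rewrite divr_gt0.
have [rho [c [rho0 Hc Hs]]] := @flow_sdiff R q n (fun u => ham_mx f z (cinv (phi z) u)) (phi z z) r L (d /
    2) r0 L0 d2 HL.
exists (Num.min rho 1), (fun a t => cinv (phi z) (c a t)).
have rho1 a : `|a| <= Num.min rho 1 -> `|a| <= rho by rewrite le_min => /andP[].
split; first by rewrite lt_min rho0 ltr01.
  move=> a /rho1 /Hc[ca0 Ha]; split; first by rewrite ca0 cinvK.
  move=> t t2; have [cd dc] := Ha t t2.
  have cd' : `|c a t - phi z z| < d by lra.
  have [[ct ctE] [Wt st]] := Hd _ cd'.
  split => //; first by move=> i; have [] := st i.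
  have Ut : U (cinv (phi z) (c a t)) by exact: mf_dom ct.
  apply: (@ham_vel_chart R T U n M P _ z _ (c a) t) => //.
  - by apply/near_dist; exists 1.
  move=> j; move/is_derive_coord: dc => /(_ j).
  rewrite (_ : (a *m _) 0 j = bracket M P (fun y => phi z y 0 j) (fun y => \sum_i a 0 i * f i y) (cinv (phi
      z) (c a t))) //.
  rewrite bracket_sumr //; last by move=> i; have [] := st i.
  by rewrite mxE; apply: eq_bigr => i _; rewrite mxE.
move=> e e0; have [rho' rho'0 H] := Hs e e0; exists (Num.min rho rho'); first by rewrite lt_min rho0.
move=> a b; rewrite !le_min => /andP[ar ar'] /andP[br br'].
have l2 : `|1 : R| < 2 by rewrite normr1 ltr1n.
have K (x : 'rV[R]_q) : `|x| <= rho -> phi z (cinv (phi z) (c x 1)) = c x 1.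
  move=> xr; have [_ /(_ 1 l2)[cd _]] := Hc x xr.
  by have [|[_ ->] _] := Hd (c x 1) => //; lra.
by rewrite !K //; have := H a b ar' br'; rewrite cinvK.
Qed.

Lemma linear_one (V : normedModType R) (L : {linear R^o -> V}) (s : R) : L s = s *: L 1.
Proof. by rewrite -linearZ /= /GRing.scale /= mulr1. Qed.

Lemma is_derive_affine (V : normedModType R) (c : R -> V) (s t0 t : R) v :
  is_derive (((t - t0) * s) : R^o) (1 : R^o) (c : R^o -> V) v ->
  is_derive (t : R^o) (1 : R^o) (fun t : R^o => c ((t - t0) * s)) (s *: v).
Proof.
move=> H.
have D : is_derive (t : R^o) (1 : R^o) (fun t : R^o => (t - t0) * s : R^o) s.
  have := is_derive_line ((- t0) * s : R^o) (s : R^o) t.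
  by congr (is_derive _ _ _ _); apply/funext => x /=; rewrite -[x *: s]/(x * s); ring.
move/is_derive_diff: H => [dc E].
have := @is_derive_comp R R^o V (fun t => (t - t0) * s) c t s dc D.
by rewrite (linear_one ('d c ((t - t0) * s : R^o)) s) E.
Qed.

Lemma ham_exists F z (t0 : R) (W : set T) : U z -> smooth_fun_at M F z -> (\forall y \near z, W y) ->
  exists2 e : R, 0 < e & exists c : R -> T, c t0 = z /\
    forall t, `|t - t0| < e -> W (c t) /\ ham_vel M P F c t.
Proof.
move=> Uz sF nW.
have [rho [c [rho0 Hc _]]] := @ham_flow 1 (fun=> F) z W Uz (fun=> sF) nW.
pose a : 'rV[R]_1 := const_mx rho.
have ar : `|a| <= rho by apply/rV_norm_le; [exact: ltW|move=> i; rewrite mxE gtr0_norm].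
have [ca0 Ha] := Hc a ar.
(* [ham_flow] handles the Hamiltonian rho F up to time 2; dividing time by rho restores F. *)
exists rho => //; exists (fun t => c a ((t - t0) * rho^-1)); split; first by rewrite subrr mul0r.
move=> t tt0; have t2 : `|(t - t0) * rho^-1| < 2.
  rewrite normrM normfV (gtr0_norm rho0) ltr_pdivrMr //; lra.
have [Wt ct sft [cc H]] := Ha _ t2; split => //; split.
  apply: (@continuous_comp _ _ _ (fun t => (t - t0) * rho^-1) (c a)) => //.
  by apply: cvgMl; apply: cvgB; [exact: cvg_id|exact: cvg_cst].
move=> g sg; have := is_derive_affine (H g sg).
have Ut : U (c a ((t - t0) / rho)) by exact: mf_dom ct.
rewrite bracket_sumr //= big_ord1 mxE -[rho^-1 *: _]/(rho^-1 * _) mulrA mulVf ?mul1r ?gt_eqF //.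
Qed.

Lemma ham_unique F c1 c2 (t0 e : R) : 0 < e -> U (c1 t0) -> smooth_fun_at M F (c1 t0) -> c1 t0 = c2 t0 ->
  (forall t, `|t - t0| < e -> ham_vel M P F c1 t) ->
  (forall t, `|t - t0| < e -> ham_vel M P F c2 t) ->
  exists2 e', 0 < e' & forall t, `|t - t0| < e' -> c1 t = c2 t.
Proof.
move=> e0 Uz sF E H1 H2; set z := c1 t0 in Uz sF E *; have dz := chartP M Uz.
have [r r0 [L L0 HL]] := @ham_mx_lip 1 (fun=> F) z Uz (fun=> sF).
have t00 : `|t0 - t0| < e by rewrite subrr normr0.
have n1 : \forall t \near (t0 : R^o), cdom (phi z) (c1 t).
  by apply: for_near (near_cdom dz); have [] := H1 _ t00.
have n2 : \forall t \near (t0 : R^o), cdom (phi z) (c2 t).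
  by apply: for_near; [have [] := H2 _ t00 | rewrite -E; exact: near_cdom dz].
have [d d0 Hd] := (near_dist _ _).1 (near_and n1 n2).
pose m := Num.min d e; have m0 : 0 < m by rewrite lt_min d0.
have Hm t : `|t - t0| < m -> [/\ `|t - t0| < e, cdom (phi z) (c1 t) & cdom (phi z) (c2 t)].
  by rewrite lt_min => /andP[/Hd [? ?] ?].
have D (c : R -> T) t : cdom (phi z) (c t) -> ham_vel M P F c t ->
  is_derive (t : R^o) (1 : R^o) (fun t => phi z (c t) : 'rV[R]_n) (row 0 (ham_mx (q := 1) (fun=> F) z (cinv
      (phi z) (phi z (c t))))).
  move=> dct [_ H]; apply/is_derive_coord => j; rewrite cinvK // !mxE.
  exact: H _ (sm_coord j Uz dct).
have [|||d' d'0 H] := @ode_unique R n (fun u => row 0 (ham_mx (q := 1) (fun=> F) z (cinv (phi z) u)))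
  (fun t => phi z (c1 t)) (fun t => phi z (c2 t)) t0 m r L m0 r0 L0 _ (congr1 (phi z) E).
- move=> u v ur vr; apply: le_trans (HL u v ur vr); apply/rV_norm_le => // i.
  rewrite !mxE [leRHS]/Num.Def.normr /= mx_normrE.
  apply: le_trans; last exact: (le_bigmax _ (fun ij : 'I_1 * 'I_n => `|(ham_mx (q := 1) (fun=> F) z (cinv
      (phi z) u) - ham_mx (q := 1) (fun=> F) z (cinv (phi z) v)) ij.1 ij.2|) (0, i)).
  by rewrite !mxE.
- by move=> t /Hm [te d1 d2]; apply: D => //; exact: H1.
- by move=> t /Hm [te d1 d2]; apply: D => //; exact: H2.
exists (Num.min m d'); first by rewrite lt_min m0.
move=> t; rewrite lt_min => /andP[/Hm [te h1 h2] td].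
by rewrite -(cinvK h1) (H t td) cinvK.
Qed.

End hamiltonian_flows.

(** * Lie groups and admissible complements *)

Section one_parameter_subgroups.
Variable R : realType.

Lemma smooth_d (V W : normedModType R) (f : V -> W) x v : smooth_at f x -> smooth_at (fun y => 'd f y v) x.
Proof. by case=> A [oA Ax Cf]; exists A; split => // k; have [_] := Cf k.+1; apply. Qed.

Lemma is_derive_pair_cst (V W : normedModType R) (u : V) (c : R -> W) (t : R) v :
  is_derive (t : R^o) (1 : R^o) (c : R^o -> W) v ->
  is_derive (t : R^o) (1 : R^o) (fun s : R^o => (u, c s)) (0, v).
Proof.
move=> /is_derive_diff[dc E]; apply/is_derive_diff.
have dc' : is_diff (t : R^o) (c : R^o -> W) ('d (c : R^o -> W) (t : R^o)) by exact/differentiableP.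
have D := is_diff_pair (is_diff_cst u (t : R^o)) dc'.
split; first exact: (@ex_diff _ _ _ _ _ _ _ D).
by rewrite (@diff_val _ _ _ _ _ _ _ D) /= E.
Qed.

Variables (n : nat) (D : spaceGroupType) (LD : lie_group R n D).
Local Notation phi := (chart_at LD).
Local Notation ops := (one_parameter_subgroup LD).

Lemma ops0 x c : ops x c -> c 0 = 1%g.
Proof.
by case=> H _ _; apply: (mulgI (c 0)); rewrite mulg1 -H addr0.
Qed.

Lemma ops_natmul x c s N : ops x c -> c (s *+ N) = (c s ^+ N)%g.
Proof.
move=> H; elim: N => [|N IH]; first by rewrite mulr0n expg0 (ops0 H).
by case: H => H _ _; rewrite mulrS H IH expgS.
Qed.

(** The left-invariant field of x in the chart at 1, as the partial differential of the
    multiplication in its second factor. Its smoothness in u is then inherited from the joint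
    smoothness of the product. *)
Definition ops_field (x u : 'rV[R]_n) : 'rV[R]_n :=
  'd (fun w : 'rV[R]_n * 'rV[R]_n => phi 1%g (cinv (phi 1%g) w.1 * cinv (phi 1%g) w.2)%g) (u, phi 1%g 1%g)
      (0, x).

Let m (w : 'rV[R]_n * 'rV[R]_n) : 'rV[R]_n := phi 1%g (cinv (phi 1%g) w.1 * cinv (phi 1%g) w.2)%g.
Let e := phi 1%g 1%g.
Let d1 : cdom (phi 1%g) 1%g. Proof. exact: chartP. Qed.

Lemma smooth_mul_chart : smooth_at m (e, e).
Proof. by have [_] := lie_mul_smooth LD 1%g 1%g; rewrite mulg1. Qed.

Lemma ops_field_smooth x : smooth_at (ops_field x) e.
Proof.
have H : smooth_at (fun u : 'rV[R]_n => (u, e)) e.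
  by exists setT; split => //; [exact: openT|move=> k; exact: smooth_pair_cst].
exact: (smooth_comp_rV (fin_basis_prod (fin_basis_rV R n) (fin_basis_rV R n)) H (smooth_d (0, x)
    smooth_mul_chart)).
Qed.

Lemma ops_ode x c : ops x c -> \forall t \near (0 : R^o),
  cdom (phi 1%g) (c t) /\ is_derive (t : R^o) (1 : R^o) (fun s : R^o => phi 1%g (c s) : 'rV[R]_n)
      (ops_field x (phi 1%g (c t))).
Proof.
move=> H; have c0 := ops0 H; have [hom sc [cc0 dc0]] := H.
have nc : \forall t \near (0 : R^o), cdom (phi 1%g) (c t).
  by apply: for_near => //; rewrite c0; exact: near_cdom d1.
have nd : \forall u \near e, differentiable m (u, e).
  have := smooth_at_open smooth_mul_chart.
  have cp : {for e, continuous (fun u : 'rV[R]_n => (u, e))}.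
    exact: (@smooth_pair_cst R _ _ e 0%N setT e Logic.I).
  by move=> /(for_near cp); apply: filterS => u; exact: smooth_diff.
have nd' : \forall t \near (0 : R^o), differentiable m (phi 1%g (c t), e).
  have := near_cmap d1 nd; rewrite -c0 => h.
  exact: for_near cc0 h.
have := near_and_top nc nd'; apply: filterS => t [dct dm]; split => //.
have D0 : is_derive (0 : R^o) (1 : R^o) (fun s : R^o => phi 1%g (c s) : 'rV[R]_n) x.
  by move: dc0; rewrite c0.
have me : differentiable m (phi 1%g (c t), phi 1%g (c 0)) by rewrite c0.
have := @is_derive_comp R _ _ (fun s => (phi 1%g (c t), phi 1%g (c s))) m 0 (0, x) me (is_derive_pair_cst
    (phi 1%g (c t)) D0).
rewrite c0 => D1.
have E : \forall s \near (0 : R^o), (m \o (fun s : R => (phi 1%g (c t), phi 1%g (c s)))) s = phi 1%g (c (t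
    + s)).
  apply: filterS nc => s dcs /=; by rewrite /m /= !cinvK // hom.
have D2 := is_derive_near E D1.
have D2' : is_derive (((t - t) * 1) : R^o) (1 : R^o) (fun s : R^o => phi 1%g (c (t + s)) : 'rV[R]_n) ('d m
    (phi 1%g (c t), e) (0, x)).
  by rewrite subrr mul0r.
have := is_derive_affine D2'; rewrite scale1r; congr (is_derive _ _ _ _).
by apply/funext => s /=; rewrite mulr1 addrC subrK.
Qed.

(** Near 0 both curves solve the equation of [ops_field]; any other t is a multiple of some small
    t/N, and c t is the N-th power of c (t/N). Hence the choice made in [lexp] is immaterial. *)
Lemma ops_unique x c1 c2 : ops x c1 -> ops x c2 -> forall t, c1 t = c2 t.
Proof.
move=> H1 H2.
have [d d0 [L L0 HL]] := sdiff_lip (smooth_sdiff (ops_field_smooth x)).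
have [r r0 Hr] := (near_dist _ _).1 (near_and (ops_ode H1) (ops_ode H2)).
have [|||||d' d'0 Hd'] := @ode_unique R n (ops_field x) (fun t => phi 1%g (c1 t)) (fun t => phi 1%g (c2 t))
    0 r (d / 2) L r0 _ L0.
- by rewrite divr_gt0.
- by move=> u v; rewrite (ops0 H1) => ur vr; apply: HL; lra.
- by rewrite (ops0 H1) (ops0 H2).
- by move=> t /Hr [[_ ?] _].
- by move=> t /Hr [_ [_ ?]].
move=> t.
have [N HN] : exists N : nat, `|t| < N.+1%:R * Num.min r d'.
  have m0 : 0 < Num.min r d' by rewrite lt_min r0.
  exists (Num.truncn (`|t| / Num.min r d')); rewrite -ltr_pdivrMr //; exact: truncnS_gt.
have -> : t = (t / N.+1%:R) *+ N.+1 by rewrite -[RHS]mulr_natr divfK.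
rewrite (ops_natmul _ _ H1) (ops_natmul _ _ H2); congr (_ ^+ _)%g.
have : `|t / N.+1%:R - 0| < Num.min r d'.
  by rewrite subr0 normrM normfV normr_nat ltr_pdivrMr // mulrC.
rewrite lt_min => /andP[tr td].
have [[dc1 _] [dc2 _]] := Hr _ tr.
by rewrite -(cinvK dc1) (Hd' _ td) cinvK.
Qed.

Lemma ops_scale x c s : ops x c -> ops (s *: x) (fun t => c (t * s)).
Proof.
move=> H; have [hom sc hv] := H; split.
- by move=> t t'; rewrite mulrDl hom.
- move=> t; have [ct st] := sc (t * s).
  have cs : {for t, continuous (fun t : R => t * s)}.
    by apply: cvgMl; exact: cvg_id.
  split; first exact: (continuous_comp cs ct).
  have S : smooth_at (fun t : R^o => t * s : R^o) t.
    exists setT; split => //; [exact: openT|move=> k].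
    by apply: (@Ck_M R R^o k setT id (fun=> s)); [exact: openT|exact: Ck_id|exact: Ck_cst].
  exact: (smooth_comp_rV (fin_basis_R R) S st).
- have [cc dc] := hv.
  have cs : {for (0 : R), continuous (fun t : R => t * s)}.
    by apply: cvgMl; exact: cvg_id.
  split.
    by apply: (continuous_comp cs); rewrite mul0r.
  rewrite mul0r.
  have dc' : is_derive (((0 - 0) * s) : R^o) (1 : R^o) (phi (c 0) \o c : R^o -> _) x by rewrite subrr mul0r.
  have := is_derive_affine dc'; congr (is_derive _ _ _ _).
  by apply/funext => t /=; rewrite subr0.
Qed.

Lemma lexp_ops x c s : ops x c -> lexp LD (s *: x) = c s.
Proof.
move=> H; have H2 := ops_scale s H; rewrite /lexp.
have := xgetPex (fun=> 1%g) (ex_intro _ _ H2) => /= H3.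
by rewrite (ops_unique H3 H2) mul1r.
Qed.

Lemma ops_zero : ops 0 (fun=> 1%g).
Proof.
split; first by move=> s t; rewrite mulg1.
- move=> t; split; first exact: cvg_cst.
  by exists setT; split => //; [exact: openT|move=> k; exact: Ck_cst].
- by split; [exact: cvg_cst|exact: is_derive_cst].
Qed.

(** By rescaling time, no nonzero multiple of x has a one-parameter subgroup either, so the default
    value 1 is taken along the whole line. *)
Lemma lexp_none x s : ~ (exists c, ops x c) -> lexp LD (s *: x) = 1%g.
Proof.
move=> nH; have [->|s0] := eqVneq s 0.
  by rewrite scale0r -[0](scale0r 0) (lexp_ops 0 ops_zero).
rewrite /lexp; have [[c Hc]|nE] := pselect (exists c, ops (s *: x) c).
  exfalso; apply: nH; exists (fun t => c (t * s^-1)).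
  by have := ops_scale s^-1 Hc; rewrite scalerA mulVf // scale1r.
by rewrite xgetPN // => c Hc; apply: nE; exists c.
Qed.

Variables (M : topologicalType) (k : nat) (MM : manifold_on R [set: M] k) (a : D -> M -> M).

Lemma generator_ops x p : a 1%g p = p -> smooth_map_at LD MM (a^~ p) 1%g -> (exists c, ops x c) ->
  generator LD MM a x p = - (x *m tmap LD MM (a^~ p) 1%g).
Proof.
move=> a1 Hs [c Hc]; rewrite /generator.
have -> : (fun t : R^o => chart_at MM p (a (lexp LD (- t *: x)) p)) = (fun t : R^o => chart_at MM p (a (c
    (- t)) p)).
  by apply/funext => t; rewrite (lexp_ops _ Hc).
have [Up ca sl] := Hs; have c0 := ops0 Hc; have [hom sc [cc dc]] := Hc.
have dl := smooth_diff sl.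
have D0 : is_derive (0 : R^o) (1 : R^o) (fun t : R^o => phi 1%g (c t)) x by move: dc; rewrite c0.
have dl' : differentiable (local_rep LD MM (a^~ p) 1%g) ((fun t => phi 1%g (c t)) 0) by rewrite /= c0.
have D1 := is_derive_comp dl' D0.
have E : \forall t \near (0 : R^o), (local_rep LD MM (a^~ p) 1%g \o (fun t => phi 1%g (c t))) t = chart_at
    MM p (a (c t) p).
  have : \forall t \near (0 : R^o), cdom (phi 1%g) (c t) by apply: for_near => //; rewrite c0; exact:
      near_cdom d1.
  by apply: filterS => t dct; rewrite /local_rep /= cinvK // a1.
have D2 : is_derive (((0 - 0) * -1) : R^o) (1 : R^o) (fun t : R^o => chart_at MM p (a (c t) p)) ('d
    (local_rep LD MM (a^~ p) 1%g) (phi 1%g (c 0)) x).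
  by rewrite subrr mul0r; exact: is_derive_near E D1.
have := is_derive_affine D2; rewrite c0 scaleN1r -mul_jacobian // => -[_ <-].
have Ef : (fun t : R^o => chart_at MM p (a (c (- t)) p)) = (fun t : R^o => chart_at MM p (a (c ((t - 0) *
    -1)) p)).
  by apply/funext => t; rewrite subr0 mulrN1.
by rewrite Ef.
Qed.

Lemma generator_none x p : a 1%g p = p -> ~ (exists c, ops x c) -> generator LD MM a x p = 0.
Proof.
move=> a1 nH; rewrite /generator.
have -> : (fun t : R^o => chart_at MM p (a (lexp LD (- t *: x)) p)) = (fun=> chart_at MM p p).
  by apply/funext => t; rewrite lexp_none // a1.
by rewrite derive_cst.
Qed.

End one_parameter_subgroups.

(** * Dressing action on D/G and the rank form of admissibility *)

Section dressing_action.
Variable R : realType.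

Lemma row_full_near m n (A : 'M[R]_(m, n)) : row_full A ->
  exists2 e, 0 < e & forall A' : 'M[R]_(m, n), (forall i j, `|A' i j - A i j| < e) -> row_full A'.
Proof.
case/row_fullP => B BA.
have [C C0 HC] : exists2 C, 0 < C & forall (X : 'M[R]_(m, n)) d, 0 <= d -> (forall i j, `|X i j| <= d) ->
    forall i j, `|(B *m X) i j| <= C * d.
  exists (1 + \sum_i \sum_j `|B i j|).
    by rewrite ltr_pwDl // sumr_ge0 // => i _; apply: sumr_ge0.
  move=> X d d0 HX i j; rewrite mxE; apply: le_trans (ler_norm_sum _ _ _) _.
  apply: (@le_trans _ _ (\sum_l `|B i l| * d)).
    by apply: ler_sum => l _; rewrite normrM ler_wpM2l.
  rewrite -mulr_suml ler_wpM2r //.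
  apply: (@le_trans _ _ (\sum_i \sum_j `|B i j|)); last by rewrite lerDr.
  by rewrite (bigD1 i) //= lerDl; apply: sumr_ge0 => ? _; apply: sumr_ge0.
(* With B a left inverse of A, this makes the entries of B A' - 1 at most 1/(2(n + 1)); a vector v
   killed by B A' then satisfies |v| <= |v|/2. *)
pose e := (2 * (n%:R + 1) * C)^-1.
have n1 : 0 < n%:R + 1 :> R by rewrite ltr_wpDl.
have e0 : 0 < e by rewrite invr_gt0 !mulr_gt0.
exists e => // A' HA'.
have E : `|B *m (A' - A)| <= C * e.
  apply: mx_norm_le; first by rewrite mulr_ge0 // ltW.
  by apply: HC; [exact: ltW | move=> i j; rewrite !mxE ltW].
have F : row_free (B *m A').
  rewrite -kermx_eq0; apply/eqP/row_matrixP => i; rewrite row0.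
  have : row i (kermx (B *m A')) *m (B *m A') = 0 by rewrite -row_mul mulmx_ker row0.
  move: (row i _) => v Hv; apply/eqP; rewrite -normr_le0.
  have : v = - (v *m (B *m (A' - A))) by rewrite mulmxBr mulmxBr Hv BA mulmx1 sub0r opprK.
  move=> Ev; have : `|v| <= n%:R * `|v| * (C * e).
    rewrite {1}Ev normrN; apply: le_trans (mulmx_norm _ _) _.
    by rewrite ler_wpM2l // mulr_ge0.
  have Ce : C * e = (2 * (n%:R + 1))^-1.
    by rewrite /e; field; rewrite !gt_eqF.
  rewrite Ce ler_pdivlMr ?mulr_gt0 //.
  have := normr_ge0 v; move: (`|v|) (n%:R : R) (ler0n R n) => x y y0 x0; nra.
rewrite /row_full eqn_leq rank_leq_col /=; move: F; rewrite /row_free => /eqP F.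
by rewrite -{1}F; exact: mxrankM_maxr.
Qed.

Variables (n : nat) (D G : spaceGroupType) (gp : group_pair R n D G) (MS : DG_manifold gp).
Local Notation LD := (gpD gp).
Local Notation incl := (gp_incl gp).
Local Notation q := (qproj (left_coset gp)).

Lemma incl1 : incl 1%g = 1%g.
Proof. by apply: (mulgI (incl 1%g)); rewrite -gp_inclM !mulg1. Qed.

Lemma qproj_class (T : topologicalType) (c : T -> set T) x y : qproj c x = qproj c y <-> c x = c y.
Proof.
split => [/eqquotP /asboolP //|H].
by apply/eqquotP/asboolP.
Qed.

Lemma qproj_repr (T : topologicalType) (c : T -> set T) (s : class_space c) : qproj c (repr s) = s.
Proof. exact: reprK. Qed.

Lemma qproj_continuous (T : topologicalType) (c : T -> set T) : continuous (qproj c).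
Proof. exact: pi_continuous. Qed.

Lemma qproj_open (T : topologicalType) (c : T -> set T) (A : set (class_space c)) :
  open A <-> open (qproj c @^-1` A).
Proof. by []. Qed.

Lemma left_cosetM d g : left_coset gp (d * incl g)%g = left_coset gp d.
Proof.
apply/seteqP; split => x /=.
  by move=> [g' _ <-]; exists (g * g')%g => //; rewrite gp_inclM mulgA.
by move=> [g' _ <-]; exists (g^-1 * g')%g => //; rewrite -mulgA -gp_inclM mulgA mulgV mul1g.
Qed.

Lemma q_mul d g : q (d * incl g)%g = q d.
Proof. by apply/qproj_class; exact: left_cosetM. Qed.

Lemma q_eq d d' : q d = q d' -> exists g, d = (d' * incl g)%g.
Proof.
move/qproj_class => E; have : left_coset gp d d by exists 1%g => //; rewrite incl1 mulg1.
by rewrite E => -[g _ <-]; exists g.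
Qed.

Lemma dressingE d d1 s : q d1 = s -> dressing d s = q (d * d1)%g.
Proof.
rewrite -[s]qproj_repr => E; rewrite /dressing qproj_repr.
have [g ->] := q_eq E.
by rewrite mulgA q_mul.
Qed.

Lemma dressing1 (s : DG gp) : dressing 1%g s = s.
Proof. by rewrite (dressingE _ (qproj_repr s)) mul1g qproj_repr. Qed.

Lemma mulr_continuous (d : D) : continuous (fun x : D => (x * d)%g).
Proof. by move=> x; have [] := smap2l (lie_mul_smooth LD) x d. Qed.

Lemma q_open (W : set D) : open W -> open (q @` W).
Proof.
move=> oW; apply/qproj_open.
have -> : q @^-1` (q @` W) = \bigcup_(g in [set: G]) (fun x : D => (x * incl g)%g) @^-1` W.
  apply/seteqP; split => x /=.
    by move=> [w Ww /q_eq [g E]]; exists g => //=; rewrite -E.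
  by move=> [g _ /= Wx]; exists (x * incl g)%g => //; rewrite q_mul.
apply: bigcup_open => g _; apply: open_comp oW => x _; exact: mulr_continuous.
Qed.

Lemma q_smap d : smooth_map_at LD MS q d.
Proof. by have [H _] := DG_submersion MS; exact: H. Qed.

Lemma dressing_fun s d1 : q d1 = s -> (dressing (gp := gp))^~ s = q \o (fun d => (d * d1)%g).
Proof. by move=> E; apply/funext => d; exact: dressingE. Qed.

Lemma dressing_smap s d : smooth_map_at LD MS ((dressing (gp := gp))^~ s) d.
Proof.
rewrite (dressing_fun (qproj_repr s)).
have S1 := smap2l (lie_mul_smooth LD) d (repr s).
have S2 := q_smap (d * repr s)%g.
by have [] := smap_comp (Logic.I : setT d) S1 S2.
Qed.

(** The infinitesimal dressing action at s, up to sign. It is linear in the Lie algebra element by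
    construction, which [generator] is not. *)
Definition dress_mx s : 'M[R]_(n + n, n) := tmap LD MS ((dressing (gp := gp))^~ s) 1%g.

Variable h : 'M[R]_(n + n).
Hypothesis Hh : gp_complement gp h.
Local Notation gen := (generator LD MS (dressing (gp := gp))).

Lemma E_free : row_free (gp_E gp).
Proof. by have [_ ? _ _ _] := gp_manin gp. Qed.

Lemma rank_h : \rank h = n.
Proof.
have [_ H1 H2] := Hh; have := mxrank_disjoint_sum H2.
have -> : \rank (gp_E gp + h)%MS = (n + n)%N.
  by apply/eqP; rewrite -[_ == _]/(row_full _) -sub1mx.
by move/eqP: E_free => -> /addnI.
Qed.

Lemma adm_full s : admissible MS h s ->
  (forall xi, (xi <= h)%MS -> exists c, one_parameter_subgroup LD xi c) /\ row_full (h *m dress_mx s).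
Proof.
move=> H.
have Hops xi : (xi <= h)%MS -> exists c, one_parameter_subgroup LD xi c.
  move=> xih; apply: contrapT => nH.
  have [xi0|xi0] := eqVneq xi 0; first by apply: nH; exists (fun=> 1%g); rewrite xi0; exact: ops_zero.
  have [x [_ U]] := H 0.
  (* Without a one-parameter subgroup, xi would have zero generator, and so has the vector 0: the
     uniqueness part of admissibility identifies them. *)
  have E1 : x = xi by apply: U; split => //; apply: generator_none => //; exact: dressing1.
  have E2 : x = 0.
    apply: U; split; first exact: sub0mx.
    rewrite (generator_ops (dressing1 s) (dressing_smap s 1%g)) ?mul0mx ?oppr0 //.
    by exists (fun=> 1%g); exact: ops_zero.
  by move: xi0; rewrite -E1 E2 eqxx.
split => //; rewrite -sub1mx; apply/row_subP => i; rewrite row1.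
have [xi [[xih Hxi] _]] := H (delta_mx 0 i); move: Hxi.
rewrite (generator_ops (dressing1 s) (dressing_smap s 1%g) (Hops _ xih)) => <-.
by rewrite -mulNmx; apply: submxMr; rewrite eqmx_opp.
Qed.

Lemma full_adm s : (forall xi, (xi <= h)%MS -> exists c, one_parameter_subgroup LD xi c) ->
  row_full (h *m dress_mx s) -> admissible MS h s.
Proof.
move=> Hops Hf v.
have gE xi : (xi <= h)%MS -> gen xi s = - (xi *m dress_mx s).
  by move=> /Hops; exact: (generator_ops (dressing1 s) (dressing_smap s 1%g)).
have /submxP[y Hy] : (v <= h *m dress_mx s)%MS by rewrite submx_full.
have yh : (- (y *m h) <= h)%MS by rewrite eqmx_opp submxMl.
exists (- (y *m h)); split.
  by split => //; rewrite gE // mulNmx opprK Hy mulmxA.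
move=> xi [xih Hxi].
(* The complement has dimension n, like D/G, so surjectivity on it forces injectivity. *)
have K0 : (h :&: kermx (dress_mx s))%MS = 0.
  apply/eqP; rewrite -mxrank_eq0; have := mxrank_mul_ker h (dress_mx s).
  by move/eqP: Hf => ->; rewrite rank_h => /(congr1 (subn^~ n)); rewrite addnC addnK subnn => ->.
have : (- (y *m h) - xi <= h :&: kermx (dress_mx s))%MS.
  rewrite sub_capmx; apply/andP; split.
    by apply: addmx_sub => //; rewrite eqmx_opp.
  apply/sub_kermxP; rewrite mulmxBl mulNmx -mulmxA -Hy.
  by move: Hxi; rewrite gE // => <-; rewrite opprK subrr.
by rewrite K0 submx0 subr_eq0 => /eqP.
Qed.

End dressing_action.

Section smooth_map2_functions.
Variable R : realType.

Lemma dotvC n (a v : 'rV[R]_n) : dotv a v = (v *m a^T) 0 0.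
Proof. by rewrite dotvE mxE; apply: eq_bigr => i _; rewrite mxE mulrC. Qed.

Lemma diff_dotv (T : topologicalType) (U : set T) n (M : manifold_on R U n) f z v : smooth_fun_at M f z ->
  'd (f \o cinv (chart_at M z) : _ -> R^o) (chart_at M z z) v = dotv (dfun M f z) v.
Proof.
move=> sf; rewrite (@linear_row R R^o n v) dotvE; apply: eq_bigr => i _.
by rewrite (dfun_diff i sf); exact: mulrC.
Qed.

Variables (T1 T2 T3 : topologicalType) (n1 n2 n3 : nat).
Variables (M1 : manifold_on R [set: T1] n1) (M2 : manifold_on R [set: T2] n2) (M3 : manifold_on R [set: T3] n3).
Variable f : T1 -> T2 -> T3.
Hypothesis Hf : smooth_map2 M1 M2 M3 f.

Lemma sm_map2 (g : T3 -> R) x y : smooth_fun_at M3 g (f x y) ->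
  smooth_at (fun w : 'rV[R]_n1 * 'rV[R]_n2 => g (f (cinv (chart_at M1 x) w.1) (cinv (chart_at M2 y) w.2)) : R^o)
    (chart_at M1 x x, chart_at M2 y y).
Proof.
move=> sg; have [cf sf] := Hf x y.
have dx := chartP M1 (Logic.I : setT x); have dy := chartP M2 (Logic.I : setT y).
have d3 := chartP M3 (Logic.I : setT (f x y)).
have E : \forall w \near (chart_at M1 x x, chart_at M2 y y),
  cdom (chart_at M3 (f x y)) (f (cinv (chart_at M1 x) w.1) (cinv (chart_at M2 y) w.2)).
  have nf : \forall z \near (x, y), cdom (chart_at M3 (f x y)) (f z.1 z.2) by exact: for_near cf (near_cdom d3).
  have [[A B] /= [nA nB] AB] := nf.
  exists ([set u | A (cinv (chart_at M1 x) u)], [set u | B (cinv (chart_at M2 y) u)]).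
    by split; [exact: near_cinv dx nA | exact: near_cinv dy nB].
  by move=> [u v] [/= Au Bv]; exact: (AB (_, _)).
have sg' : smooth_at (g \o cinv (chart_at M3 (f x y)) : _ -> R^o) ((fun w : 'rV[R]_n1 * 'rV[R]_n2 =>
    chart_at M3 (f x y) (f (cinv (chart_at M1 x) w.1) (cinv (chart_at M2 y) w.2))) (chart_at M1 x x,
    chart_at M2 y y)).
  by rewrite /= !cinvK.
have := smooth_comp (fin_basis_rV R n3) sf sg'; apply: smooth_near.
by apply: filterS E => w dw /=; rewrite cinvK.
Qed.

(** The left side is continuous in y', being a differential of one jointly smooth function. This is
    how the infinitesimal action is seen to vary continuously with the point. *)
Lemma diff_map2l (g : T3 -> R) x y v : smooth_fun_at M3 g (f x y) ->
  \forall y' \near y, 'd (fun w : 'rV[R]_n1 * 'rV[R]_n2 => g (f (cinv (chart_at M1 x) w.1) (cinv (chart_at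
      M2 y) w.2)) : R^o)
    (chart_at M1 x x, chart_at M2 y y') (v, 0) = dotv (dfun M1 (g \o f^~ y') x) v.
Proof.
move=> sg; have S := sm_map2 sg.
have dy := chartP M2 (Logic.I : setT y).
set F := (fun w : 'rV[R]_n1 * 'rV[R]_n2 => _) in S *.
have S' := smooth_at_open S.
have cp : {for chart_at M2 y y, continuous (fun u : 'rV[R]_n2 => (chart_at M1 x x, u))}.
  exact: (@smooth_cst_pair R _ _ (chart_at M1 x x) 0%N setT _ Logic.I).
have nsg : \forall y' \near y, smooth_fun_at M3 g (f x y').
  have [_ cf _] := smap2r Hf x y.
  have := for_near cf (sm_open (Logic.I : setT (f x y)) sg); apply: filterS => z [].
  by [].
have := near_and_top (near_and_top nsg (near_cdom dy)) (near_cmap dy (for_near cp S')).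
apply: filterS => y' [[sg' dy'] SF].
have sm1 := sm_pull (Logic.I : setT x) (smap2l Hf x y') sg'.
rewrite -(diff_dotv v sm1).
have dF : differentiable F (chart_at M1 x x, chart_at M2 y y') by exact: smooth_diff.
have D := is_diff_pair (is_diff_id (chart_at M1 x x)) (is_diff_cst (chart_at M2 y y') (chart_at M1 x x)).
have dp := @ex_diff _ _ _ _ _ _ _ D.
have dv := @diff_val _ _ _ _ _ _ _ D.
have -> : ((g \o f^~ y') \o cinv (chart_at M1 x) : 'rV[R]_n1 -> R^o) = F \o (fun u : 'rV[R]_n1 => (id u,
    cst (chart_at M2 y y') u)).
  by apply/funext => u; rewrite /F /= cinvK.
rewrite (diff_comp dp dF) /=.
by rewrite dv.
Qed.
End smooth_map2_functions.

Lemma near_abs_lt (R : realType) (T : topologicalType) (f : T -> R^o) x (e : R) :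
  {for x, continuous f} -> 0 < e -> \forall y \near x, `|(f y : R) - f x| < e.
Proof.
move=> cf e0; have e2 : 0 < e / 2 by rewrite divr_gt0.
have := for_near cf (for_continuous_near (V := R^o) (x := f x) (fun A => id) e2).
apply: filterS => y Hy; have ee : e / 2 < e by clear -e0; lra.
exact: (le_lt_trans (Hy : (_ <= e / 2 :> R)) ee).
Qed.

Section admissibility.
Variables (R : realType) (n : nat) (D G : spaceGroupType) (gp : group_pair R n D G) (MS : DG_manifold gp).
Local Notation LD := (gpD gp).
Local Notation q := (qproj (left_coset gp)).
Variable h : 'M[R]_(n + n).
Hypothesis Hh : gp_complement gp h.

(* The matrix whose rank decides admissibility is continuous in a representative of [s] in D, and
   D -> D/G is open. *)
Lemma adm_near s : admissible MS h s -> \forall s' \near s, admissible MS h s'.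
Proof.
move=> Hs; have [Hops Hf] := adm_full Hs.
pose d0 := repr s; have qd0 : q d0 = s by exact: qproj_repr.
pose sigma j (s' : DG gp) := chart_at MS s s' 0 j.
have s_sigma j : smooth_fun_at MS (sigma j) s by exact: (sm_coord j (Logic.I : setT s) (chartP MS (Logic.I
    : setT s))).
have sq j : smooth_fun_at LD (sigma j \o q) (1 * d0)%g.
  apply: (sm_pull (Logic.I : setT _) (q_smap MS (1 * d0)%g)).
  by rewrite mul1g qd0.
pose F j (w : 'rV[R]_(n + n) * 'rV[R]_(n + n)) : R^o := (sigma j \o q) (cinv (chart_at LD 1%g) w.1 * cinv
    (chart_at LD d0) w.2)%g.
pose H (d : D) : 'M[R]_(n + n, n) := \matrix_(i, j) 'd (F j) (chart_at LD 1%g 1%g, chart_at LD d0 d) (row i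
    h, 0).
(* [dress_mx] at q d uses the chart at q d, whereas [H] uses the fixed chart at s. T is the change
   of chart between them; it is the identity at d0, and full rank of the product gives full rank of
   its left factor. *)
pose T (s' : DG gp) : 'M[R]_n := \matrix_(l, j) dfun MS (sigma j) s' 0 l.
have HE : \forall d \near d0, H d = h *m dress_mx MS (q d) *m T (q d).
  have n1 : \forall d \near d0, forall j i, 'd (F j) (chart_at LD 1%g 1%g, chart_at LD d0 d) (row i h, 0) =
      dotv (dfun LD ((sigma j \o q) \o (fun x => x * d)%g) 1%g) (row i h).
    by apply: near_and_all => j; apply: near_and_all => i; exact: (diff_map2l (lie_mul_smooth LD) (row i h)
        (sq j)).
  have n2 : \forall d \near d0, forall j, smooth_fun_at MS (sigma j) (q d).
    have h2 : \forall s' \near s, forall j, smooth_fun_at MS (sigma j) s'.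
      apply: near_and_all => j; have := sm_open (Logic.I : setT s) (s_sigma j).
      by apply: filterS => ? [].
    have cq : {for d0, continuous q} by exact: qproj_continuous.
    by rewrite -qd0 in h2; exact: (for_near cq h2).
  have := near_and_top n1 n2; apply: filterS => d [E1 E2].
  apply/matrixP => i j; rewrite mxE E1.
  have -> : ((sigma j \o q) \o (fun x => x * d)%g) = sigma j \o (dressing (gp := gp))^~ (q d).
    by rewrite (dressing_fun (erefl (q d))).
  have E3 : smooth_fun_at MS (sigma j) (dressing 1%g (q d)) by rewrite dressing1.
  rewrite (dfun_pull (Logic.I : setT _) (dressing_smap MS (q d) 1%g) E3) dressing1.
  rewrite dotvC trmx_mul trmxK mulmxA -[tmap _ _ _ _]/(dress_mx MS (q d)) -row_mul !mxE.
  by apply: eq_bigr => l _; rewrite !mxE.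
have T1 : T (q d0) = 1%:M.
  apply/matrixP => l j; rewrite mxE qd0 (dfun_coord MS j (Logic.I : setT s)) !mxE eqxx /=.
  by rewrite eq_sym.
have Hd0 : H d0 = h *m dress_mx MS s by rewrite (nbhs_singleton HE) T1 mulmx1 qd0.
have [e e0 He] := row_full_near (eq_ind_r (fun X => row_full X) Hf Hd0).
have nH : \forall d \near d0, forall i j, `|H d i j - H d0 i j| < e.
  apply: near_and_all => i; apply: near_and_all => j.
  have S := smooth_d (row i h, 0) (sm_map2 (lie_mul_smooth LD) (sq j)).
  pose psi (w : 'rV[R]_(n + n) * 'rV[R]_(n + n)) : R^o := 'd (F j) w (row i h, 0).
  have c1 : {for (chart_at LD 1%g 1%g, chart_at LD d0 d0), continuous psi}.
    by have [A [oA Ax CA]] := S; exact: (CA 0%N _ Ax).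
  have HHE d : H d i j = psi (chart_at LD 1%g 1%g, chart_at LD d0 d) by rewrite mxE.
  clear S; move: psi c1 HHE => psi c1 HHE.
  have cp : {for chart_at LD d0 d0, continuous (fun u : 'rV[R]_(n + n) => (chart_at LD 1%g 1%g, u))}.
    exact: (@smooth_cst_pair R _ _ (chart_at LD 1%g 1%g) 0%N setT _ Logic.I).
  have HHE' : (fun d => H d i j) = (fun d => psi (chart_at LD 1%g 1%g, chart_at LD d0 d)) by apply/funext.
  have N2 := near_cmap (chartP LD (Logic.I : setT d0)) (for_near cp (near_abs_lt c1 e0)).
  have K (H' : D -> R) : H' = (fun d => psi (chart_at LD 1%g 1%g, chart_at LD d0 d)) -> \forall y \near d0,
      `|H' y - H' d0| < e.
    by move=> ->; exact: N2.
  exact: (K (fun d => H d i j) HHE').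
have nW : \forall d \near d0, row_full (h *m dress_mx MS (q d)).
  have := near_and_top HE nH; apply: filterS => d [E1 /He]; rewrite E1.
  rewrite /row_full !eqn_leq !rank_leq_col /= => h1.
  exact: leq_trans h1 (mxrankM_maxl _ _).
have [W [oW Wd0] HW] : exists2 W, open_nbhs d0 W & W `<=` [set d | row_full (h *m dress_mx MS (q d))].
  by move: nW; rewrite -[X in X -> _]/(nbhs d0 _) nbhsE => -[W]; exists W.
have : nbhs s (q @` W) by apply: open_nbhs_nbhs; split; [exact: q_open|exists d0].
apply: filterS => _ [d Wd <-].
exact: (full_adm Hh Hops (HW d Wd)).
Qed.

End admissibility.

Lemma dfun_cst (R : realType) (T : topologicalType) (U : set T) n (M : manifold_on R U n) (c : R) z :
  dfun M (fun=> c) z = 0.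
Proof.
apply/rowP => i; rewrite !mxE.
exact: (@derive_cst _ _ R^o c).
Qed.

Lemma qproj_orbit (R : realType) n k (D G : spaceGroupType) (gp : group_pair R n D G)
    (M : topologicalType) (MM : manifold_on R [set: M] k) (a : lie_action (gpG gp) MM) g m :
  qproj (G_orbit a) (a g m) = qproj (G_orbit a) m.
Proof.
apply/qproj_class/seteqP; split => x /= [g' _ <-].
  by exists (g' * g)%g => //; rewrite actM.
by exists (g' * g^-1)%g => //; rewrite -actM -mulgA mulVg mulg1.
Qed.

Lemma qproj_orbit_eq (R : realType) n k (D G : spaceGroupType) (gp : group_pair R n D G)
    (M : topologicalType) (MM : manifold_on R [set: M] k) (a : lie_action (gpG gp) MM) m m' :
  qproj (G_orbit a) m = qproj (G_orbit a) m' -> exists g, m = a g m'.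
Proof.
move/qproj_class => E; have : G_orbit a m m by exists 1%g => //; rewrite act1.
by rewrite E => -[g _ <-]; exists g.
Qed.

(** * Every covector at an admissible point is a hat form *)

Section hat_forms.
Variables (R : realType) (n : nat) (D G : spaceGroupType) (gp : group_pair R n D G) (MS : DG_manifold gp).
Variable h : 'M[R]_(n + n).
Hypothesis Hh : gp_complement gp h.

Lemma hat_form_onto s (l : 'rV[R]_n) : admissible MS h s -> exists x, hat_form MS h x s = l.
Proof.
move=> Hs; have [Hops Hf] := adm_full Hs.
set K := dress_mx MS s in Hf.
have gE xi : (xi <= h)%MS -> generator (gpD gp) MS (dressing (gp := gp)) xi s = - (xi *m K).
  by move=> /Hops; exact: (generator_ops (dressing1 s) (dressing_smap MS s 1%g)).
have [[Bs Bu _ _] _ _ iE _] := gp_manin gp.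
have [ih fh _] := Hh; set B := gp_form gp in ih.
set E := gp_E gp in fh.
(* The pairing of g with the complement. A vector of g orthogonal to the complement is also
   orthogonal to g, by isotropy, hence to all of d, hence zero. By equality of dimensions, every
   linear form on the complement comes from g. *)
pose X := E *m B *m h^T.
have Xf : row_free X.
  rewrite -kermx_eq0; apply/eqP/row_matrixP => i; rewrite row0.
  have : row i (kermx X) *m X = 0 by rewrite -row_mul mulmx_ker row0.
  move: (row i _) => v Hv.
  have [u [w Euw]] : exists u w, 1%:M = u *m E + w *m h.
    by have /sub_addsmxP[[u w] /= ->] := fh; exists u, w.
  have : v *m E *m B *m (1%:M : 'M[R]_(n + n))^T = 0.
    rewrite Euw linearD /= mulmxDr !trmx_mul.
    have -> : v *m E *m B *m (h^T *m w^T) = v *m X *m w^T by rewrite /X !mulmxA.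
    have -> : v *m E *m B *m (E^T *m u^T) = v *m (E *m B *m E^T) *m u^T by rewrite !mulmxA.
    by rewrite Hv -[E *m B *m E^T]/(gp_E gp *m gp_metric gp 1%g *m (gp_E gp)^T) iE mulmx0 !mul0mx addr0.
  rewrite trmx1 mulmx1 => /(congr1 (mulmx^~ (invmx B))); rewrite mulmxK // mul0mx.
  by move/(congr1 (mulmx^~ (pinvmx E))); rewrite mulmxKp ?E_free // mul0mx.
have hX : (h^T <= X)%MS.
  have XH : (X <= h^T)%MS by exact: submxMl.
  rewrite -(mxrank_leqif_sup XH) mxrank_tr (rank_h Hh).
  by move: Xf; rewrite /row_free.
have /submxP[x Hx] : (l *m K^T *m h^T <= X)%MS by apply: submx_trans hX; exact: submxMl.
exists x; rewrite /hat_form.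
have Hl : forall xi : 'rV[R]_(n + n), (xi <= h)%MS ->
    dotv l (generator (gpD gp) MS (dressing (gp := gp)) xi s) = - bform B (x *m E) xi.
  move=> xi xih; rewrite gE // /dotv /bform linearN mulmxN [LHS]mxE; congr (- _).
  have /submxP[c ->] := xih.
  rewrite -[X in l *m X]/((c *m h *m K)^T) !trmx_mul.
  have -> : l *m (K^T *m (h^T *m c^T)) = l *m K^T *m h^T *m c^T by rewrite !mulmxA.
  by rewrite Hx /X !mulmxA.
(* The defining property of [hat_form] has only one solution, because generators of the complement
   fill the tangent space; so the chosen covector is l. *)
set S := [set _ | _]; have H2 : S (xget 0 S) by apply: xgetPex; exists l.
set y := xget _ _ in H2 *.
have Hy v : dotv y v = dotv l v.
  by have [xi [[xih <-] _]] := Hs v; rewrite H2 // Hl.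
apply/rowP => j; have := Hy (delta_mx 0 j).
by rewrite !dotvC -!rowE !mxE.
Qed.

End hat_forms.

(** * Hamiltonian fields of functions pulled back by p *)

Section infinitesimal.
Variables (R : realType) (n k q : nat) (D G : spaceGroupType) (gp : group_pair R n D G) (MS : DG_manifold gp).
Variables (M : topologicalType) (MM : manifold_on R [set: M] k) (a : lie_action (gpG gp) MM).
Variables (h0 : 'M[R]_(n + n)) (P : M -> 'M[R]_k) (mu : M -> DG gp).
Hypothesis HM : quasi_hamiltonian MS a h0 P mu.
Hypothesis Hnondeg : forall m, nondegenerate_at MS a h0 P mu m.
Variables (U : set (MG a)) (MU : manifold_on R U q).
Local Notation p := (qproj (G_orbit a)).
Hypothesis Hp : submersion MM MU (p @^-1` U) p.
Local Notation tmu := (tmap MM MS mu).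
Local Notation tp := (tmap MM MU p).

Lemma mu_smap m : smooth_map_at MM MS mu m.
Proof. by have [_ _ [H _ _]] := HM; exact: H. Qed.

Lemma p_smap m : U (p m) -> smooth_map_at MM MU p m.
Proof. by move=> Um; have [H _] := Hp; exact: H. Qed.

Lemma generator_tp x m : U (p m) -> generator (gpG gp) MM a x m *m tp m = 0.
Proof.
move=> Um; have [Hx|Hx] := pselect (exists c, one_parameter_subgroup (gpG gp) x c); last first.
  by rewrite (generator_none MM (act1 a m) Hx) mul0mx.
have Sa : smooth_map_at (gpG gp) MM (a^~ m) 1%g by exact: (smap2l (act_smooth a)).
rewrite (generator_ops (act1 a m) Sa Hx) mulNmx -mulmxA.
have Sp : smooth_map_at MM MU p (a 1%g m) by rewrite act1; exact: p_smap.
have [Sc E] := smap_comp (Logic.I : setT (1%g : G)) Sa Sp.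
have : tmap (gpG gp) MU (p \o a^~ m) 1%g = 0.
  apply/matrixP => i j; rewrite (tmapE _ _ (Logic.I : setT (1%g : G)) Sc).
  have -> : (fun y : G => chart_at MU ((p \o a^~ m) 1%g) ((p \o a^~ m) y) 0 j) = fun=> chart_at MU (p m) (p
      m) 0 j.
    by apply/funext => g /=; rewrite !qproj_orbit.
  by rewrite dfun_cst !mxE.
by rewrite E act1 => ->; rewrite mulmx0 oppr0.
Qed.

(* The bivectors attached to two complements differ by a combination of orbit directions, which
   [tmap p] kills; so the one for which the moment map equation holds at [m] can replace [P]. *)
Lemma field_facts m : U (p m) -> exists Ph : 'M[R]_k,
  [/\ row_free Ph^T, Ph *m tp m = P m *m tp m, Ph^T *m tp m = (P m)^T *m tp m &
      (tmu m)^T *m Ph^T *m tp m = 0].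
Proof.
move=> Um; have [h [Hh Hadm bij]] := Hnondeg m; exists (twisted_bivector a h0 P h m).
have G0 : generator_mx (gpG gp) MM a m *m tp m = 0.
  by apply/row_matrixP => i; rewrite row_mul rowK generator_tp // row0.
split.
- case: bij => g gK _; rewrite -kermx_eq0; apply/eqP/row_matrixP => i; rewrite row0.
  set Q := _^T; have : row i (kermx Q) *m Q = 0 by rewrite -row_mul mulmx_ker row0.
  move: (row i _) => v Hv; apply: (can_inj gK); rewrite /sharp mul0mx; exact: Hv.
- rewrite /twisted_bivector /tensor2_M; move: (generator_mx _ _ _ m) G0 => Gm G0.
  by rewrite mulmxBl -[_ *m Gm *m _]mulmxA G0 mulmx0 subr0.
- rewrite /twisted_bivector /tensor2_M; move: (generator_mx _ _ _ m) G0 => Gm G0.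
  by rewrite linearB /= mulmxBl !trmx_mul trmxK mulmxA -[_ *m Gm *m _]mulmxA G0 mulmx0 subr0.
apply/row_matrixP => i; rewrite row0 !row_mul.
have [_ _ [_ _ Hmm]] := HM.
(* The moment map equation needs an open set around m; openness of admissibility and continuity of
   mu provide it. *)
pose O := interior [set m' | admissible MS h (mu m')].
have Om : O m by have [_ cmu _] := mu_smap m; exact: (for_near cmu (adm_near Hh Hadm)).
have OA s : (mu @` O) s -> admissible MS h s by move=> [m' Om' <-]; exact: (interior_subset Om').
have [x Hx] := hat_form_onto Hh (delta_mx 0 i) Hadm.
have := Hmm O h (@open_interior _ _) Hh OA x m Om.
by rewrite Hx /sharp -rowE => ->; exact: generator_tp.
Qed.

Lemma P_anti m : (P m)^T = - P m.
Proof. by have [_ [[H _] _ _] _] := HM; exact: H. Qed.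

Lemma mu_p_orthogonal m : U (p m) -> (tmu m)^T *m P m *m tp m = 0.
Proof.
move=> Um; have [Ph [_ _ E3 E4]] := field_facts Um.
by move: E4; rewrite -mulmxA E3 P_anti mulNmx mulmxN mulmxA => /eqP; rewrite oppr_eq0 => /eqP.
Qed.

Lemma row_full_tp m : U (p m) -> row_full (tp m).
Proof. by move=> Um; have [_ H] := Hp; exact: H. Qed.

(** P itself may be degenerate at m. On covectors pulled back by p, however, it agrees with the
    bivector of an admissible complement, which is invertible. *)
Lemma row_free_field m : U (p m) -> row_free ((tp m)^T *m (P m)^T).
Proof.
move=> Um; have [Ph [F E2 _ _]] := field_facts Um.
rewrite -trmx_mul -E2 trmx_mul /row_free mxrankMfree // mxrank_tr.
exact: row_full_tp.
Qed.

Lemma field_mu m : U (p m) -> (tp m)^T *m (P m)^T *m tmu m = 0.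
Proof.
move=> Um; have := congr1 trmx (mu_p_orthogonal Um).
by rewrite !trmx_mul trmxK trmx0 mulmxA.
Qed.

Lemma field_ker m : U (p m) -> row_full (tmu m) -> (k <= n + q)%N ->
  ((tp m)^T *m (P m)^T :=: kermx (tmu m))%MS.
Proof.
move=> Um Fm kn; have S : ((tp m)^T *m (P m)^T <= kermx (tmu m))%MS by apply/sub_kermxP; exact: field_mu.
apply/eqmxP; rewrite S /= -(mxrank_leqif_sup S).
move/eqP: (row_free_field Um) => ->; rewrite mxrank_ker; move/eqP: Fm => E.
rewrite eqn_leq; apply/andP; split.
  by have := mxrankS S; rewrite mxrank_ker E; move/eqP: (row_free_field Um) => ->.
by rewrite E leq_subLR.
Qed.

End infinitesimal.

(** * Dimension of the orbits *)

Section fibre_dimension.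
Variable R : realType.

(** The Lindelöf property: for each index of a basic open set contained in some O g, one such g is
    selected. *)
Lemma second_countable_cover (T : topologicalType) (O : T -> set T) (good : set T) : @second_countable T ->
  good !=set0 -> (forall g, good g -> nbhs g (O g)) ->
  exists s : nat -> T, (forall i, good (s i)) /\ forall g, good g -> exists i, O (s i) g.
Proof.
move=> [B /countable_injP[f finj] [oB bB]] [g0 Gg0] HO.
have /choice[s Hs] : forall i, exists g, good g /\ forall b, B b -> f b = i ->
    (exists2 g', good g' & b `<=` O g') -> b `<=` O g.
  move=> i; have [[b [Bb fb [g Gg bg]]]|nH] := pselect (exists b, [/\ B b, f b = i & exists2 g', good g' &
      b `<=` O g']).
    by exists g; split => // b' Bb' fb' _; have -> : b' = b by apply: finj; rewrite ?inE // fb.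
  by exists g0; split => // b Bb fb H; exfalso; apply: nH; exists b.
exists s; split => [i|g Gg]; first by have [] := Hs i.
have [b [/= Bb bg] bO] := bB g _ (HO g Gg).
exists (f b); have [_ H] := Hs (f b).
by apply: H bg => //; exists g.
Qed.

Lemma manifold_cover (T : topologicalType) n (M : manifold_on R [set: T] n) (O : T -> set T) (good : set T) :
  good !=set0 -> (forall g, good g -> nbhs g (O g)) ->
  exists s : nat -> T, (forall i, good (s i)) /\ forall g, good g -> exists i, O (s i) g.
Proof.
move=> [g0 Gg0] HO; pose j (t : T) : set_type [set: T] := exist _ t (mem_set (Logic.I : setT t)).
have [|g Gg|s [Hs1 Hs2]] := @second_countable_cover (set_type [set: T]) (fun x => set_val @^-1` (O (set_val
    x))) (set_val @^-1` good) (mf_second_countable M).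
- by exists (j g0).
- by apply: (@initial_continuous _ _ (set_val : set_type [set: T] -> T)); exact: HO.
exists (set_val \o s); split => // g Gg; exact: (Hs2 (j g) Gg).
Qed.

(** V is a basis of ker T, A a section of T, and W reads the coordinates along V parallel to A. *)
Lemma kernel_splitting k q (T : 'M[R]_(k, q)) : row_full T ->
  exists (V : 'M[R]_(k - q, k)) (A : 'M[R]_(q, k)) (W : 'M[R]_(k, k - q)),
    [/\ V *m T = 0, A *m T = 1%:M, V *m W = 1%:M & A *m W = 0].
Proof.
move=> FT; have [A AT] := row_fullP FT.
have rk : \rank (kermx T) = (k - q)%N by rewrite mxrank_ker; move/eqP: FT => ->.
suff [V Vf VK] : exists2 V : 'M[R]_(k - q, k), row_free V & (V :=: kermx T)%MS.
  have VT : V *m T = 0 by apply/sub_kermxP; rewrite VK.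
  have /submxP[W HW] : (1%:M - T *m A <= V)%MS.
    by rewrite VK; apply/sub_kermxP; rewrite mulmxBl mul1mx -mulmxA AT mulmx1 subrr.
  exists V, A, W; split => //; apply: (row_free_inj Vf); rewrite -mulmxA -HW mulmxBr mulmx1 mulmxA ?VT ?AT.
    by rewrite mul0mx subr0 mul1mx.
  by rewrite mul1mx subrr mul0mx.
rewrite -rk; exists (row_base (kermx T)); [exact: row_base_free|exact: eq_row_base].
Qed.

(** The existence half of the implicit function theorem: at u0 + yV + aA with y prescribed, a is
    found by [local_inverse], since p has derivative 1 in a. W recovers y, so the fibre covers a (k
    - q)-dimensional ball. *)
Lemma fibre_section (T1 T2 : topologicalType) (U1 : set T1) (U2 : set T2) k q
    (M1 : manifold_on R U1 k) (M2 : manifold_on R U2 q) (p : T1 -> T2) z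
    (V : 'M[R]_(k - q, k)) (A : 'M[R]_(q, k)) (W : 'M[R]_(k, k - q)) :
  U1 z -> smooth_map_at M1 M2 p z -> V *m tmap M1 M2 p z = 0 -> A *m tmap M1 M2 p z = 1%:M ->
  V *m W = 1%:M -> A *m W = 0 ->
  exists2 rho : R, 0 < rho & forall y, `|y| < rho ->
    exists x, [/\ cdom (chart_at M1 z) x, p x = p z & (chart_at M1 z x - chart_at M1 z z) *m W = y].
Proof.
move=> Uz Hp VT AT VW AW; have [U2z cp sr] := Hp.
have dz := chartP M1 Uz; have d2 := chartP M2 U2z.
pose r := local_rep M1 M2 p z; pose u0 := chart_at M1 z z.
have [CA CA0 HA] := mulmx_bound A; have [CV CV0 HV] := mulmx_bound V.
pose e := (2 * CA)^-1; have e0 : 0 < e by rewrite invr_gt0 mulr_gt0.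
have [d1 d10 Hd1] := smooth_sdiff sr e0.
have N : \forall u \near u0, [/\ cdom (chart_at M1 z) (cinv (chart_at M1 z) u),
    chart_at M1 z (cinv (chart_at M1 z) u) = u & cdom (chart_at M2 (p z)) (p (cinv (chart_at M1 z) u))].
  have N1 := near_cinv dz (for_near cp (near_cdom d2)); have := near_and N1 (near_chart Uz dz).
  by apply: filterS => u [? [? ?]].
have [d3 d30 Hd3] := (near_dist _ _).1 N.
pose d := Num.min d1 d3; have d0 : 0 < d by rewrite lt_min d10.
pose ra := d / (4 * CA); have ra0 : 0 < ra by rewrite divr_gt0 // mulr_gt0.
(* Together with [ra], the first term keeps u within d of u0. The second makes the initial error at
   most ra/2: moving along V changes p only by the remainder e|yV|. *)
pose rho := Num.min (d / (4 * CV)) (ra / (2 * (e * CV))).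
have rho0 : 0 < rho by rewrite lt_min !divr_gt0 // !mulr_gt0.
exists rho => // y; rewrite lt_min => /andP[y1 y2].
pose u a := u0 + (y *m V + a *m A).
have ud a : `|a| <= ra -> `|u a - u0| < d.
  move=> ar; rewrite /u addrC addKr; apply: le_lt_trans (ler_normD _ _) _.
  have h1 : `|y *m V| <= d / 4.
    apply: le_trans (HV y) _; rewrite -ler_pdivlMl // mulrC.
    by apply: le_trans (ltW y1) _; rewrite invfM mulrA.
  have h2 : `|a *m A| <= d / 4.
    apply: le_trans (HA a) _; rewrite -ler_pdivlMl // mulrC.
    by apply: le_trans ar _; rewrite /ra invfM mulrA.
  by clear -h1 h2 d0; lra.
have [a b ha hb||a ha Ea] := @local_inverse R q (fun a => r (u a)) 0 (r u0) ra ra0.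
- rewrite subr0 in ha; rewrite subr0 in hb.
  have := Hd1 (u a) (u b); rewrite -/u0 -/r.
  have Eu : u a - u b = (a - b) *m A by rewrite /u mulmxBl opprD addrACA subrr add0r opprD addrACA subrr add0r.
  rewrite Eu -mulmxA -[jacobian _ _]/(tmap M1 M2 p z) AT mulmx1 => H.
  apply: le_trans (H _ _) _.
  + by apply: lt_le_trans (ud a ha) _; rewrite ge_min lexx.
  + by apply: lt_le_trans (ud b hb) _; rewrite ge_min lexx.
  apply: (@le_trans _ _ (e * (CA * `|a - b|))); first by rewrite ler_pM2l.
  have eCA : e * CA = 1 / 2 by rewrite /e; move: (CA) CA0 => c c0; field; rewrite gt_eqF.
  by rewrite mulrA eCA.
- have u00 : `|u0 - u0| < d1 by rewrite subrr normr0.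
  have h0 : `|0 : 'rV[R]_q| <= ra by rewrite normr0 ltW.
  have := Hd1 u0 (u 0) u00; rewrite -/u0 -/r.
  have -> : u0 - u 0 = - (y *m V) by rewrite /u mul0mx addr0 opprD addrA subrr add0r.
  rewrite mulNmx -mulmxA -[jacobian _ _]/(tmap M1 M2 p z) VT mulmx0 oppr0 subr0 normrN => H.
  apply: le_trans (H _) _; first by apply: lt_le_trans (ud 0 h0) _; rewrite ge_min lexx.
  apply: (@le_trans _ _ (e * (CV * `|y|))); first by rewrite ler_pM2l.
  rewrite mulrA -ler_pdivlMl ?mulr_gt0 // mulrC.
  by apply: le_trans (ltW y2) _; rewrite invfM mulrA.
rewrite subr0 in ha.
have [|c1 c2 c3] := Hd3 (u a); first by apply: lt_le_trans (ud a ha) _; rewrite ge_min lexx orbT.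
exists (cinv (chart_at M1 z) (u a)); split => //.
  rewrite -(cinvK c3) -[LHS]/(cinv (chart_at M2 (p z)) (r (u a))) Ea.
  by rewrite /r /u0 (local_rep_base M1 M2 p Uz) cinvK.
by rewrite c2 -/u0 /u addrC addKr mulmxDl -!mulmxA VW AW mulmx1 mulmx0 addr0.
Qed.

Variables (n k q : nat) (D G : spaceGroupType) (gp : group_pair R n D G).
Variables (M : topologicalType) (MM : manifold_on R [set: M] k) (a : lie_action (gpG gp) MM).
Variables (U : set (MG a)) (MU : manifold_on R U q).
Local Notation p := (qproj (G_orbit a)).
Hypothesis Hp : submersion MM MU (p @^-1` U) p.
Local Notation LG := (gpG gp).

(* The fibre of [p] through [z] is an orbit, hence a countable union of Lipschitz images of
   n-dimensional balls; in suitable coordinates it contains a ball of dimension k - q. *)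
Lemma dim_le z : U (p z) -> (k - q <= n)%N.
Proof.
move=> Uz; have [Hs Hf] := Hp.
have Sp : smooth_map_at MM MU p z by exact: Hs.
have [V [A [W [VT AT VW AW]]]] := kernel_splitting (Hf z Uz).
have [rho rho0 Hrho] := fibre_section (Logic.I : setT z) Sp VT AT VW AW.
have dz := chartP MM (Logic.I : setT z).
pose u0 := chart_at MM z z.
pose F g w : 'rV[R]_(k - q) := (chart_at MM z (a (cinv (chart_at LG g) w) z) - u0) *m W.
(* Outside this set the chart at z is meaningless and F carries no information; the points supplied
   by [fibre_section] lie in the chart. *)
pose good : set G := [set g | cdom (chart_at MM z) (a g z)].
have good1 : good 1%g by rewrite /good /= act1.
have /choice[rC HrC] : forall g, exists rC : R * R, good g -> [/\ 0 < rC.1, 0 < rC.2 &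
    forall x y, `|x - chart_at LG g g| <= rC.1 -> `|y - chart_at LG g g| <= rC.1 -> `|F g x - F g y| <=
        rC.2 * `|x - y|].
  move=> g; have [Gg|nG] := pselect (good g); last by exists (0, 0).
  have sf : smooth_at (fun w => chart_at MM z (a (cinv (chart_at LG g) w) z)) (chart_at LG g g).
    apply: smooth_rV => j.
    exact: (sm_pull (Logic.I : setT g) (smap2l (act_smooth a) g z) (sm_coord j (Logic.I : setT z) Gg)).
  have [d d0 [L L0 HL]] := sdiff_lip (smooth_sdiff sf).
  have [CW CW0 HW] := mulmx_bound W.
  exists (d / 2, CW * L) => _; split => [||x y hx hy] /=; [by rewrite divr_gt0|by rewrite mulr_gt0|].
  have d2 : d / 2 < d by rewrite ltr_pdivrMr // ltr_pMr // ltr1n.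
  rewrite /F -mulmxBl opprB addrA subrK.
  apply: le_trans (HW _) _; rewrite -mulrA ler_pM2l //.
  by apply: HL; [exact: le_lt_trans hx d2|exact: le_lt_trans hy d2].
pose O g := [set g' | cdom (chart_at LG g) g' /\ `|chart_at LG g g' - chart_at LG g g| <= (rC g).1].
have HO g : good g -> nbhs g (O g).
  move=> Gg; have [r0 _ _] := HrC g Gg; have dg := chartP LG (Logic.I : setT g).
  apply: near_and_top (near_cdom dg) _.
  apply: (@near_cmap _ _ _ _ LG g g [set u | `|u - chart_at LG g g| <= (rC g).1] dg).
  by apply/near_dist; exists (rC g).1 => // y /ltW.
have [s [Gs Hcov]] := manifold_cover LG (ex_intro _ _ good1) HO.
rewrite leqNgt; apply/negP => nkq.
have [|||y yr Hy] := @lipschitz_not_cover R n (k - q) (fun i => F (s i)) (fun i => chart_at LG (s i) (s i))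
    (fun i => (rC (s i)).1) (fun i => (rC (s i)).2) 0 rho nkq rho0.
- by move=> i; have [] := HrC _ (Gs i).
- by move=> i; have [] := HrC _ (Gs i).
- by move=> i; have [] := HrC _ (Gs i).
rewrite subr0 in yr; have [x [dx px Hx]] := Hrho y yr.
have [g Eg] := qproj_orbit_eq px.
have Gg : good g by rewrite /good /= -Eg.
have [i [di ri]] := Hcov g Gg.
apply: (Hy i _ ri); rewrite /F cinvK // -Eg; exact: Hx.
Qed.

End fibre_dimension.

(** * Leaves and level sets of the moment map *)

Section lifting.
Variables (R : realType) (n k q : nat) (D G : spaceGroupType) (gp : group_pair R n D G) (MS : DG_manifold gp).
Variables (M : topologicalType) (MM : manifold_on R [set: M] k) (a : lie_action (gpG gp) MM).
Variables (h0 : 'M[R]_(n + n)) (P : M -> 'M[R]_k) (mu : M -> DG gp).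
Hypothesis HM : quasi_hamiltonian MS a h0 P mu.
Hypothesis Hnondeg : forall m, nondegenerate_at MS a h0 P mu m.
Variables (U : set (MG a)) (MU : manifold_on R U q).
Local Notation p := (qproj (G_orbit a)).
Hypothesis Hp : submersion MM MU (p @^-1` U) p.
Variable PU : MG a -> 'M[R]_q.
Hypothesis HPU : reduced_bivector P MU PU.

Lemma P_field : bivector_field MM P. Proof. by have [_ [] ] := HM. Qed.

Lemma U_open : open U. Proof. exact: mf_open MU. Qed.

Lemma near_U m : U (p m) -> \forall y \near m, U (p y).
Proof.
move=> Um; apply: (for_near (@qproj_continuous _ (G_orbit a) m)).
by apply: open_nbhs_nbhs; split => //; exact: U_open.
Qed.

Lemma reduced_bracket F H m : U (p m) -> smooth_fun_at MU F (p m) -> smooth_fun_at MU H (p m) ->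
  bracket MU PU F H (p m) = bracket MM P (F \o p) (H \o p) m.
Proof.
move=> Um sF sH; have [F' sF' FF'] := sm_ext Um sF; have [H' sH' HH'] := sm_ext Um sH.
have Sp := p_smap Hp Um.
rewrite (bracket_near PU Um sF sH FF' HH') (HPU.2 _ _ sF' sH' m Um).
have cp := @qproj_continuous _ (G_orbit a) m.
apply/esym; apply: (bracket_near P (Logic.I : setT m)).
- exact: (sm_pull (Logic.I : setT m) Sp sF).
- exact: (sm_pull (Logic.I : setT m) Sp sH).
- exact: (for_near cp FF').
- exact: (for_near cp HH').
Qed.

Lemma bracket_mu_p (l : DG gp -> R) F m : U (p m) -> smooth_fun_at MS l (mu m) -> smooth_fun_at MU F (p m) ->
  bracket MM P (l \o mu) (F \o p) m = 0.
Proof.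
move=> Um sl sF; rewrite /bracket (dfun_pull (Logic.I : setT m) (mu_smap HM m) sl).
rewrite (dfun_pull (Logic.I : setT m) (p_smap Hp Um) sF) /bform trmx_mul trmxK !mulmxA.
have := mu_p_orthogonal HM Hnondeg Hp Um.
rewrite -!mulmxA => E; rewrite [_ *m (P m *m _)]mulmxA [_ *m P m *m (_ *m _)]mulmxA.
by rewrite -[_ *m P m *m _]mulmxA E mul0mx mulmx0 mxE.
Qed.

Lemma ham_vel_push F c t : U (p (c t)) -> smooth_fun_at MU F (p (c t)) ->
  ham_vel MM P (F \o p) c t -> ham_vel MU PU F (p \o c) t.
Proof.
move=> Ut sF [cc H]; split.
  by apply: continuous_comp => //; exact: qproj_continuous.
move=> g sg; rewrite /= (reduced_bracket Ut sg sF).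
exact: (H (g \o p) (sm_pull (Logic.I : setT _) (p_smap Hp Ut) sg)).
Qed.

Lemma mu_ham_cst F c s (t0 t1 : R) :
  (forall t, `|t - t0| <= `|t1 - t0| -> [/\ U (p (c t)), smooth_fun_at MU F (p (c t)), cdom (chart_at MS s)
      (mu (c t)) &
    ham_vel MM P (F \o p) c t]) -> mu (c t1) = mu (c t0).
Proof.
move=> H.
have [_ _ d1 _] := H t1 (lexx _).
have [|_ _ d0 _] := H t0; first by rewrite subrr normr0.
rewrite -(cinvK d1) -(cinvK d0); congr (cinv _ _).
pose phi t := chart_at MS s (mu (c t)).
have dphi t : `|t - t0| <= `|t1 - t0| -> is_derive (t : R^o) (1 : R^o) (phi : R^o -> _) 0.
  move=> Ht; have [Ut sF dt [_ hv]] := H t Ht.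
  apply/is_derive_coord => j; rewrite mxE.
  have sl := sm_coord j (Logic.I : setT s) dt.
  rewrite -(bracket_mu_p Ut sl sF).
  exact: (hv _ (sm_pull (Logic.I : setT _) (mu_smap HM _) sl)).
have E0 t : `|t - t0| <= `|t1 - t0| -> `|(fun=> 0) t - 0 : 'rV[R]_n| <= 0 by move=> _; rewrite subrr normr0.
have := curve_mvt_abs (lexx 0) dphi E0.
by rewrite scaler0 subr0 mul0r normr_le0 subr_eq0 => /eqP.
Qed.

Lemma lift_ham F t0 x : U (p x) -> smooth_fun_at MU F (p x) -> exists2 e : R, 0 < e & exists c : R -> M, c
    t0 = x /\
  forall t, `|t - t0| < e -> [/\ mu (c t) = mu x, {for t, continuous c} & ham_vel MU PU F (p \o c) t].
Proof.
move=> Ux sF.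
have nW : \forall y \near x, [/\ U (p y), smooth_fun_at MU F (p y) & cdom (chart_at MS (mu x)) (mu y)].
  have h1 := for_near (@qproj_continuous _ (G_orbit a) x) (sm_open Ux sF).
  have [_ cmu _] := mu_smap HM x.
  have h2 := for_near cmu (near_cdom (chartP MS (Logic.I : setT (mu x)))).
  by have := near_and_top h1 h2; apply: filterS => y [[? ?] ?].
have [e e0 [c [c0 Hc]]] := ham_exists P_field t0 (Logic.I : setT x) (sm_pull (Logic.I : setT x) (p_smap Hp
    Ux) sF) nW.
exists e => //; exists c; split => // t Ht; have [[Ut st dt] hv] := Hc t Ht; split.
- rewrite -c0; apply: (@mu_ham_cst F c (mu x)) => t' Ht'.
  by have [[? ? ?] ?] := Hc t' (le_lt_trans Ht' Ht).
- by case: hv.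
exact: ham_vel_push.
Qed.

Variable s : DG gp.
Local Notation N := (mu @^-1` [set s]).
Local Notation FS := (final_space p N).

Lemma mu_equiv g x : mu (a g x) = dressing (gp_incl gp g) (mu x).
Proof. by have [_ _ [_ H _]] := HM. Qed.

(* [c] is continuous for the final topology because it locally lifts to a curve in [N], the topology
   induced by M/G being too coarse for this. *)
Lemma local_lift F c (t0 e : R) : 0 < e -> U (c t0) -> smooth_fun_at MU F (c t0) ->
  (forall t, `|t - t0| < e -> ham_vel MU PU F c t) ->
  exists2 d : R, 0 < d & forall t, `|t - t0| < d -> ((p @` N) (c t0) <-> (p @` N) (c t)) /\
    ((p @` N) (c t0) -> {for t0, continuous (c : R -> FS)}).
Proof.
move=> e0 Uc sF Hc; pose x := repr (c t0).
have px : p x = c t0 by exact: qproj_repr.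
(* Any point over c t0 starts a lift: the projection of the lifted Hamiltonian curve solves the same
   equation as c, so it coincides with c for a short time. *)
have key y : p y = c t0 -> exists2 d : R, 0 < d & exists c' : R -> M, c' t0 = y /\
   forall t, `|t - t0| < d -> [/\ mu (c' t) = mu y, {for t, continuous c'} & p (c' t) = c t].
  move=> py; have Uy : U (p y) by rewrite py.
  have sFy : smooth_fun_at MU F (p y) by rewrite py.
  have [e1 e10 [c' [c'0 Hc']]] := lift_ham t0 Uy sFy.
  have e20 : 0 < Num.min e e1 by rewrite lt_min e0.
  have [|||t Ht|t Ht|d d0 Hd] := @ham_unique R _ U q MU PU HPU.1 F (p \o c') c t0 (Num.min e e1) e20.
  - by rewrite /= c'0.
  - by rewrite /= c'0.
  - by rewrite /= c'0.
  - by move: Ht; rewrite lt_min => /andP[_ /Hc'[]].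
  - by apply: Hc; move: Ht; rewrite lt_min => /andP[].
  exists (Num.min d e1); first by rewrite lt_min d0.
  exists c'; split => // t; rewrite lt_min => /andP[td /Hc'[? ? _]]; split => //.
  exact: Hd.
have [d d0 [c' [c'0 Hc']]] := key x px.
(* The lift starts at an arbitrary representative x. If one end has some representative in N, a
   group element takes the point of the lift there onto the level s; by equivariance and constancy
   of mu, it takes the other end there too. *)
exists d => // t td; have [mc _ pc] := Hc' t td; split.
  split.
    move=> [y Ny py]; have [g Eg] := qproj_orbit_eq (etrans px (esym py)).
    exists (a g^-1%g (c' t)); last by rewrite qproj_orbit.
    by rewrite /= mu_equiv mc Eg -mu_equiv -actM mulVg act1.
  move=> [y Ny py]; have [g Eg] := qproj_orbit_eq (etrans pc (esym py)).
  exists (a g^-1%g x); last by rewrite qproj_orbit.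
  by rewrite /= mu_equiv -mc Eg -mu_equiv -actM mulVg act1.
(* For continuity the lift has to start in N: it then stays in N, where openness in the final
   topology is tested. *)
move=> [y Ny py]; have [d1 d10 [c1 [c10 Hc1]]] := key y py.
move=> A nA; have [B [oB Bc] BA] : exists2 B, open_nbhs (c t0 : FS) B & B `<=` A.
  by move: nA; rewrite -[X in X -> _]/(nbhs (c t0 : FS) A) nbhsE.
have [Q oQ EQ] : exists2 Q : set M, open Q & set_val @^-1` Q = ((p \o set_val : set_type N -> MG a) @^-1` B).
  by case: oB => Q oQ <-; exists Q.
have inN z : N z -> Q z <-> B (p z).
  move=> Nz; pose z' : set_type N := exist _ z (mem_set Nz).
  have : (set_val @^-1` Q) z' <-> ((p \o set_val : set_type N -> MG a) @^-1` B) z' by rewrite EQ.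
  by [].
have Qy : Q y by apply/inN => //; rewrite py.
have [mc1 cc1 pc1] := Hc1 t0 (eq_ind_r (fun x => x < d1) d10 (eq_ind_r (fun x => `|x| = 0) (normr0 _)
    (subrr t0))).
have nO : \forall t \near t0, Q (c1 t).
  by apply: (for_near cc1); rewrite c10; apply: open_nbhs_nbhs.
have nd : \forall t \near (t0 : R^o), `|t - t0| < d1 by apply/near_dist; exists d1.
have := near_and_top nO nd; apply: filterS => t' [Ot Ht]; apply: BA.
have [m1 _ <-] := Hc1 t' Ht; apply/inN => //.
by rewrite /= m1.
Qed.

End lifting.

Lemma between_dist (R : realType) (l r t t' : R) : `|t' - t| < Num.min (t - l) (r - t) -> l < t' /\ t' < r.
Proof. by rewrite lt_min !ltr_norml => /andP[/andP[h1 h2] /andP[h3 h4]]; split; lra. Qed.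

(** * The leaf lies in the component *)

Section leaf_component.
Variables (R : realType) (n k q : nat) (D G : spaceGroupType) (gp : group_pair R n D G) (MS : DG_manifold gp).
Variables (M : topologicalType) (MM : manifold_on R [set: M] k) (a : lie_action (gpG gp) MM).
Variables (h0 : 'M[R]_(n + n)) (P : M -> 'M[R]_k) (mu : M -> DG gp).
Hypothesis HM : quasi_hamiltonian MS a h0 P mu.
Hypothesis Hnondeg : forall m, nondegenerate_at MS a h0 P mu m.
Variables (U : set (MG a)) (MU : manifold_on R U q).
Local Notation p := (qproj (G_orbit a)).
Hypothesis Hp : submersion MM MU (p @^-1` U) p.
Variable PU : MG a -> 'M[R]_q.
Hypothesis HPU : reduced_bivector P MU PU.

Variable s : DG gp.
Local Notation N := (mu @^-1` [set s]).
Local Notation C := (p @` N `&` U : set (final_space p N)).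
Local Notation FS := (final_space p N).

Lemma step_local y v : hamiltonian_step MU PU y v ->
  exists c : R -> MG a, exists e : R, [/\ 0 < e, c 0 = y, c 1 = v,
    forall t, - e < t -> t < 1 + e -> U (c t) &
    forall t, - e < t -> t < 1 + e -> exists2 d : R, 0 < d & forall t', `|t' - t| < d ->
      ((p @` N) (c t) <-> (p @` N) (c t')) /\ ((p @` N) (c t) -> {for t, continuous (c : R -> FS)})].
Proof.
move=> [V [f [c [e [oV VU sf e0 [c0 c1 Hc]]]]]].
have cU t : - e < t -> t < 1 + e -> U (c t) by move=> t1 t2; have [/VU] := Hc t t1 t2.
exists c, e; split => // t t1 t2.
have d0 : 0 < Num.min (t - - e) (1 + e - t) by rewrite lt_min !subr_gt0 t1.
have [Vt _] := Hc t t1 t2.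
apply: (local_lift HM Hnondeg Hp HPU s d0 (VU _ Vt) (sf _ Vt)) => t' /between_dist[h5 h6].
have [_ hv] := Hc t' h5 h6.
by apply/ham_velP => //; exact: cU.
Qed.

Lemma step_component y v : C y -> hamiltonian_step MU PU y v -> connected_component C y v.
Proof.
move=> [Ny Uy] /step_local[c [e [e0 c0 c1 cU Hc]]].
pose I01 := `[0, 1]%classic : set R.
have I01e t : I01 t -> - e < t /\ t < 1 + e.
  rewrite /I01 /= in_itv /= => /andP[h1 h2].
  by split; [apply: lt_le_trans h1; rewrite oppr_lt0|apply: le_lt_trans h2 _; rewrite ltrDl].
have oI (t : R) : - e < t -> t < 1 + e -> \forall t' \near t, - e < t' /\ t' < 1 + e.
  move=> t1 t2; have := near_and_top (open_near (@open_gt R (- e)) t1) (open_near (@open_lt R (1 + e)) t2).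
  by [].
(* The equivalence in [step_local] makes both membership in the image of N and its negation open in
   t, so connectedness of [0, 1] spreads membership from t = 0. *)
have all_in : forall t, I01 t -> (p @` N) (c t).
  pose S := I01 `&` [set t | (p @` N) (c t)].
  suff E : S = I01 by move=> t; rewrite -E => -[].
  apply: segment_connected.
  - by exists 0; split; [rewrite /I01 /= in_itv /= lexx ler01|rewrite /= c0].
  - exists [set t | [/\ - e < t, t < 1 + e & (p @` N) (c t)]].
      rewrite openE => t [t1 t2 Nt]; have [d d0 Hd] := Hc t t1 t2.
      have nd : \forall t' \near (t : R^o), `|t' - t| < d by apply/near_dist; exists d.
      have := near_and_top (oI t t1 t2) nd; apply: filterS => t' [[? ?] /Hd[H _]]; split => //.
      exact/H.
    by apply/seteqP; split => t; [move=> [/[dup] It /I01e[? ?] Nt]|move=> [It [_ _ Nt]]].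
  exists (~` [set t | [/\ - e < t, t < 1 + e & ~ (p @` N) (c t)]]).
    apply: open_closedC; rewrite openE => t [t1 t2 Nt]; have [d d0 Hd] := Hc t t1 t2.
    have nd : \forall t' \near (t : R^o), `|t' - t| < d by apply/near_dist; exists d.
    have := near_and_top (oI t t1 t2) nd; apply: filterS => t' [[? ?] /Hd[H _]]; split => //.
    by move=> /H.
  apply/seteqP; split => t; first by move=> [It Nt]; split => // -[].
  move=> [/[dup] It /I01e[t1 t2] Nt]; split => //.
  by apply: contrapT => H; apply: Nt.
have cI : connected (c @` I01 : set FS).
  apply: connected_continuous_connected; first exact: segment_connected.
  apply: continuous_in_subspaceT => t /set_mem It; have [t1 t2] := I01e t It.
  have [d d0 Hd] := Hc t t1 t2; have [|_ H] := Hd t; first by rewrite subrr normr0.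
  exact: (H (all_in t It)).
exists (c @` I01); last by exists 1; rewrite // /I01 /= in_itv /= lexx ler01.
split => //; first by exists 0; rewrite // /I01 /= in_itv /= lexx ler01.
by move=> _ [t It <-]; split; [exact: all_in|have [? ?] := I01e t It; exact: cU].
Qed.

Lemma leaf_sub_component x : C x -> symplectic_leaf MU PU x `<=` connected_component C x.
Proof.
rewrite /symplectic_leaf => + v /= H; elim: H => [y z Hyz Cy|y Cy|y z w _ IH1 _ IH2 Cy].
- exact: step_component.
- exact: connected_component_refl.
apply: connected_component_trans (IH1 Cy) (IH2 _).
exact: (connected_component_sub (IH1 Cy)).
Qed.

End leaf_component.

Lemma norm_lt2 (R : realType) (t : R) : - (1 / 2) < t -> t < 1 + 1 / 2 -> `|t| < 2.
Proof. by move=> t1 t2; rewrite ltr_norml; apply/andP; split; lra. Qed.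

Lemma half_contraction (R : realType) (c w : R) : 0 < c -> w <= c * ((2 * c)^-1 * w) -> w <= 0.
Proof.
move=> c0; have -> : c * ((2 * c)^-1 * w) = w / 2 by field; rewrite gt_eqF.
lra.
Qed.

(** The kernel of X is a complement of ker T, on which T is injective, hence bounded below. With T
    the differential of mu, X serves as coordinates along the level sets. *)
Lemma transverse_bound (R : realType) q k n (A : 'M[R]_(q, k)) (T : 'M[R]_(k, n)) :
  row_free A -> (A :=: kermx T)%MS -> exists2 X : 'M[R]_(k, q), A *m X = 1%:M &
    exists2 C, 0 < C & forall v : 'rV[R]_k, v *m X = 0 -> `|v| <= C * `|v *m T|.
Proof.
move=> /row_freeP[X AX] AT; exists X => //.
have /row_freeP[K XTK] : row_free (row_mx X T).
  rewrite -kermx_eq0; apply/eqP/row_matrixP => i; rewrite row0.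
  have : row i (kermx (row_mx X T)) *m row_mx X T = 0 by rewrite -row_mul mulmx_ker row0.
  move: (row i _) => v; rewrite mul_mx_row -[0]row_mx0 => /eq_row_mx[vX vT].
  have /submxP[w Ew] : (v <= A)%MS by rewrite AT; apply/sub_kermxP.
  by move: vX; rewrite Ew -mulmxA AX mulmx1 => ->; rewrite mul0mx.
have [C C0 HC] := mulmx_bound (dsubmx K).
exists C => // v vX; have {1}-> : v = v *m T *m dsubmx K; last exact: HC.
by rewrite -[LHS]mulmx1 -XTK mulmxA mul_mx_row vX -{1}[K]vsubmxK mul_row_col mul0mx add0r.
Qed.

(* Reverse time and change the sign of the Hamiltonian. *)
Lemma hamiltonian_step_sym (R : realType) (T : topologicalType) (U : set T) n (M : manifold_on R U n)
    (P : T -> 'M[R]_n) u v : hamiltonian_step M P u v -> hamiltonian_step M P v u.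
Proof.
move=> [V [f [c [e [oV VU sf e0 [c0 c1 Hc]]]]]].
have sf' z : V z -> smooth_fun_at M (fun y => - f y) z.
  move=> Vz; have -> : (fun y => - f y) = (fun y => -1 * f y) by apply/funext => y; rewrite mulN1r.
  by apply: sm_M; [exact: sm_cst|exact: sf].
have df z : V z -> dfun M (fun y => - f y) z = - dfun M f z.
  move=> Vz; apply/rowP => i; rewrite !mxE.
  have d := sm_diff (sf z Vz).
  exact: (deriveN (@diff_derivable _ _ _ _ _ (delta_mx 0 i) d)).
exists V, (fun y => - f y), (fun t => c ((t - 1) * -1)), e; split => //.
have E0 : (0 - 1) * -1 = 1 :> R by rewrite sub0r mulrNN mulr1.
split; [by rewrite E0|by rewrite subrr mul0r|].
move=> t t1 t2; have t'1 : - e < (t - 1) * -1 by lra.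
have t'2 : (t - 1) * -1 < 1 + e by lra.
have [Vt [cc dc]] := Hc _ t'1 t'2; split => //; split.
  have cr : {for (t : R), continuous (fun t : R => (t - 1) * -1 : R)}.
    by apply: cvgMl; apply: cvgB; [exact: cvg_id|exact: cvg_cst].
  by move=> A nA; exact: cr (cc A nA).
have -> : sharp (P (c ((t - 1) * -1))) (dfun M (fun y => - f y) (c ((t - 1) * -1))) =
   -1 *: sharp (P (c ((t - 1) * -1))) (dfun M f (c ((t - 1) * -1))).
  by rewrite df // /sharp mulNmx scaleN1r.
exact: (is_derive_affine dc).
Qed.

(** * The component lies in the leaf *)

Section local_steps.
Variables (R : realType) (n k q : nat) (D G : spaceGroupType) (gp : group_pair R n D G) (MS : DG_manifold gp).
Variables (M : topologicalType) (MM : manifold_on R [set: M] k) (a : lie_action (gpG gp) MM).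
Variables (h0 : 'M[R]_(n + n)) (P : M -> 'M[R]_k) (mu : M -> DG gp).
Hypothesis HM : quasi_hamiltonian MS a h0 P mu.
Hypothesis Hnondeg : forall m, nondegenerate_at MS a h0 P mu m.
Variables (U : set (MG a)) (MU : manifold_on R U q).
Local Notation p := (qproj (G_orbit a)).
Hypothesis Hp : submersion MM MU (p @^-1` U) p.
Variable PU : MG a -> 'M[R]_q.
Hypothesis HPU : reduced_bivector P MU PU.
Local Notation tmu := (tmap MM MS mu).
Local Notation tp := (tmap MM MU p).

(* Let y_i be coordinates around [p x]. The time-one maps a |-> c a 1 of the flows of the functions
   sum_i a_i (y_i o p) stay in the level set of [mu], which near [x] is injected by [X]; and
   a |-> c a 1 followed by [X] is close to the identity, hence onto a neighbourhood. *)
Lemma local_step x : U (p x) -> row_full (tmu x) -> (k <= n + q)%N ->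
  \forall y \near x, mu y = mu x -> hamiltonian_step MU PU (p x) (p y).
Proof.
move=> Ux Fx knq; have dx := chartP MM (Logic.I : setT x); have dp := chartP MU Ux.
have Sp := p_smap Hp Ux; have Smu := mu_smap HM x.
pose yc i z := chart_at MU (p x) z 0 i.
pose f i := yc i \o p.
have sf i : smooth_fun_at MM (f i) x by exact: (sm_pull (Logic.I : setT x) Sp (sm_coord i Ux dp)).
have Y0 : ham_mx MM P f x x = (tp x)^T *m (P x)^T.
  apply/matrixP => i j; rewrite mxE /bracket (dfun_coord MM j (Logic.I : setT x)).
  rewrite (dfun_pull (Logic.I : setT x) Sp (sm_coord i Ux dp)) (dfun_coord MU i Ux) bform_delta /sharp.
  by rewrite -mulmxA -rowE mxE.
have [X AX [C C0 HC]] := transverse_bound (row_free_field HM Hnondeg Hp Ux) (field_ker HM Hnondeg Hp Ux Fx knq).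
have [CX CX0 HX] := mulmx_bound X.
pose u0 := chart_at MM x x.
have e0 : 0 < (2 * C)^-1 by rewrite invr_gt0 mulr_gt0.
have [d1 d10 Hd1] : exists2 d, 0 < d & forall y z, `|y - u0| < d -> `|z - u0| < d ->
    `|local_rep MM MS mu x y - local_rep MM MS mu x z - (y - z) *m tmu x| <= (2 * C)^-1 * `|y - z|.
  by have [_ _ sr] := Smu; have := smooth_sdiff sr e0.
pose W y := [/\ U (p y), cdom (chart_at MU (p x)) (p y), cdom (chart_at MS (mu x)) (mu y),
   cdom (chart_at MM x) y & `|chart_at MM x y - u0| < d1].
have nball d : 0 < d -> \forall y \near x, `|chart_at MM x y - u0| < d.
  move=> d0; apply: (@near_cmap _ _ _ _ MM x x [set u | `|u - u0| < d] dx).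
  by apply/near_dist; exists d.
have nW : \forall y \near x, W y.
  have cp := @qproj_continuous _ (G_orbit a) x.
  have [_ cmu _] := Smu.
  have h1 := near_and_top (near_U MU Ux) (for_near cp (near_cdom dp)).
  have h2 := near_and_top (for_near cmu (near_cdom (chartP MS (Logic.I : setT (mu x))))) (near_cdom dx).
  have := near_and_top (near_and_top h1 h2) (nball d1 d10).
  by apply: filterS => y [[[? ?] [? ?]] ?].
have [rho [c [rho0 Hc Hs]]] := ham_flow (P_field HM) (Logic.I : setT x) sf nW.
(* Applying X multiplies the error by at most CX, which leaves the factor 1/2 required by
   [local_inverse]. *)
have e1 : 0 < (2 * CX)^-1 by rewrite invr_gt0 mulr_gt0.
have [rho' rho'0 Hrho'] := Hs _ e1.
pose ra := Num.min rho rho'; have ra0 : 0 < ra by rewrite lt_min rho0.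
have rar (b : 'rV[R]_q) : `|b| <= ra -> `|b| <= rho by rewrite le_min => /andP[].
have rar' (b : 'rV[R]_q) : `|b| <= ra -> `|b| <= rho' by rewrite le_min => /andP[].
have one2 : `|1 : R| < 2 by rewrite normr1 ltr1n.
have c01 : c 0 1 = x.
  have z0 : `|0 : 'rV[R]_q| <= rho by rewrite normr0 ltW.
  have [c00 Hc0] := Hc 0 z0.
  have dphi t : `|t - 0| <= `|1 - 0| -> is_derive (t : R^o) (1 : R^o) ((fun t => chart_at MM x (c 0 t)) :
      R^o -> _) 0.
    rewrite !subr0 => Ht; have [_ dt st [_ hv]] := Hc0 t (le_lt_trans Ht one2).
    apply/is_derive_coord => j; rewrite mxE.
    have := hv _ (sm_coord j (Logic.I : setT x) dt).
    rewrite bracket_sumr // big1 // => i _; by rewrite mxE mul0r.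
  have E0 (t : R) : `|t - 0| <= `|1 - 0| -> `|(fun=> 0) t - 0 : 'rV[R]_k| <= 0 by move=> _; rewrite subrr
      normr0.
  have := @curve_mvt_abs R k (fun t => chart_at MM x (c 0 t)) (fun=> 0) 0 1 0 0 (lexx 0) dphi E0.
  rewrite scaler0 subr0 mul0r normr_le0 subr_eq0 c00 => /eqP E.
  have [_ d01 _ _] := Hc0 1 one2.
  by rewrite -(cinvK d01) E cinvK.
(* For y this close to x, the value at y of the chart followed by X is within ra/2 of its value at x
   = c 0 1. *)
have r20 : 0 < ra / (2 * CX) by rewrite divr_gt0 // mulr_gt0.
have := near_and_top nW (nball _ r20); apply: filterS => y [[_ _ dmy dy yd1] yr] Ny.
have [b b' hb hb'||b hb Eb] := @local_inverse R q (fun b => chart_at MM x (c b 1) *m X) 0 (chart_at MM x y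
    *m X) ra ra0.
- rewrite subr0 in hb; rewrite subr0 in hb'.
  have := Hrho' b b' (rar' _ hb) (rar' _ hb'); rewrite Y0 => H.
  have -> : chart_at MM x (c b 1) *m X - chart_at MM x (c b' 1) *m X - (b - b') =
    (chart_at MM x (c b 1) - chart_at MM x (c b' 1) - (b - b') *m ((tp x)^T *m (P x)^T)) *m X.
    by rewrite mulmxBl -[(b - b') *m _ *m X]mulmxA AX mulmx1 mulmxBl.
  apply: le_trans (HX _) _; rewrite -ler_pdivlMl //; apply: le_trans H _.
  by rewrite mulrA div1r invfM mulrC [CX^-1 * _]mulrC mulrC.
- rewrite c01 -mulmxBl; apply: le_trans (HX _) _; rewrite -ler_pdivlMl //; apply: le_trans (ltW yr) _.
  by rewrite invfM mulrA mulrC.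
rewrite subr0 in hb; have [cb0 Hcb] := Hc b (rar _ hb).
pose F z := \sum_i b 0 i * yc i z.
have sF z : cdom (chart_at MU (p x)) z -> smooth_fun_at MU F z.
  by move=> dz; apply: sm_sum => i; apply: sm_M; [exact: sm_cst|exact: sm_coord].
have [[Ub db dmb dMb bd1] _ _ _] := Hcb 1 one2.
have mub : mu (c b 1) = mu x.
  rewrite -cb0; apply: (mu_ham_cst HM Hnondeg Hp (F := F) (s := mu x)) => t.
  rewrite !subr0 => Ht; have [[Ut dt dmt _ _] _ _ hv] := Hcb t (le_lt_trans Ht one2).
  by split => //; exact: sF.
(* The two points have the same mu and the same image under X. Their difference v is thus killed by
   X, so |v| <= C|v tmu|, while strict differentiability of mu gives |v tmu| <= |v|/(2C); hence v =
   0. *)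
have Ey : c b 1 = y.
  have HH := Hd1 _ _ bd1 yd1; move: HH; rewrite /local_rep /= !cinvK // mub Ny subrr sub0r normrN => HH.
  have Ev : (chart_at MM x (c b 1) - chart_at MM x y) *m X = 0 by rewrite mulmxBl Eb subrr.
  have := HC _ Ev; move: HH; set v := _ - _ => HH Hv.
  have v0 : v = 0.
    apply/eqP; rewrite -normr_le0.
    by apply: (half_contraction C0); apply: le_trans Hv _; rewrite ler_pM2l.
  by rewrite -(cinvK dMb) -(cinvK dy); congr (cinv _ _); apply/eqP; rewrite -subr_eq0 -/v v0.
exists (cdom (chart_at MU (p x))), F, (p \o c b), (1 / 2); split.
- exact: cdom_open.
- exact: mf_dom.
- by move=> z /sF.
- by rewrite divr_gt0.
split; [by rewrite /= cb0|by rewrite /= Ey|move=> t t1 t2].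
have t3 := norm_lt2 t1 t2.
have [[Ut dt _ _ _] _ _ hv] := Hcb t t3; split => //.
by apply/ham_velP => //; apply: (ham_vel_push Hp HPU) => //; exact: sF.
Qed.

Lemma component_sub_leaf s x : U (p x) -> mu x = s -> regular_value MM MS mu s ->
  connected_component (p @` (mu @^-1` [set s]) `&` U : set (final_space p (mu @^-1` [set s]))) (p x)
    `<=` symplectic_leaf MU PU (p x).
Proof.
set N := mu @^-1` [set s]; set C : set (final_space p N) := p @` N `&` U => Ux Nx Hreg.
set L := symplectic_leaf MU PU (p x).
have steps y : U (p y) -> N y -> \forall z \near y, N z -> hamiltonian_step MU PU (p y) (p z).
  move=> Uy Ny; have Fy : row_full (tmu y) by apply: Hreg.
  have knq : (k <= n + q)%N by rewrite addnC -leq_subLR; exact: (dim_le Hp Uy).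
  by have := local_step Uy Fy knq; apply: filterS => z H Nz; apply: H; rewrite Nz Ny.
(* Openness in the final topology is tested on N, which is where [local_step] gives information; no
   neighbourhood in M/G is involved. *)
have fopen (B : set (final_space p N)) : (forall y, N y -> B (p y) -> \forall z \near y, N z -> B (p z)) ->
    open B.
  move=> HB; rewrite /open /= /final_open openE => -[y Ny] /= By.
  have Ny' : N y by apply: set_mem.
  have := HB y Ny' By => nB.
  have cs := @initial_continuous _ _ (set_val : set_type N -> M) (exist _ y Ny).
  by have := for_near cs nB; apply: filterS => -[z Nz] /= H; apply: H; exact: set_mem.
have oL : @open (final_space p N) (L `&` C).
  apply: fopen => y Ny [Ly [_ Uy]]; have := near_and_top (near_U MU Uy) (steps y Uy Ny).
  apply: filterS => z [Uz Hz] Nz; split; first by apply: rt_trans Ly _; apply: rt_step; exact: Hz.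
  by split => //; exists z.
have oL' : @open (final_space p N) (C `\` L).
  apply: fopen => y Ny [[_ Uy] Ly]; have := near_and_top (near_U MU Uy) (steps y Uy Ny).
  apply: filterS => z [Uz Hz] Nz; split; first by split => //; exists z.
  move=> Lz; apply: Ly; apply: rt_trans Lz _; apply: rt_step; apply: hamiltonian_step_sym; exact: Hz.
have Cx : C (p x) by split => //; exists x.
(* The leaf and its complement within C are both open, the latter by symmetry of the steps; so the
   leaf cuts the component in a nonempty clopen part. *)
suff <- : connected_component C (p x) `&` L = connected_component C (p x) by move=> ? [].
apply: (@component_connected _ C (p x)).
- by exists (p x); split; [exact: connected_component_refl|exact: rt_refl].
- exists (L `&` C) => //; apply/seteqP; split => y.
    by move=> [cy Ly]; split => //; split => //; exact: connected_component_sub cy.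
  by move=> [cy [Ly _]].
exists (~` (C `\` L)); first exact: open_closedC.
apply/seteqP; split => y.
  by move=> [cy Ly]; split => // -[].
move=> [cy H]; split => //; apply: contrapT => Ly; apply: H; split => //.
exact: connected_component_sub cy.
Qed.

End local_steps.

Theorem theorem5p5p5
  (R : realType) (n k q : nat) (D G : spaceGroupType)
  (gp : group_pair R n D G) (MS : DG_manifold gp)
  (M : topologicalType) (MM : manifold_on R [set: M] k)
  (a : lie_action (gpG gp) MM)
  (h : 'M[R]_(n + n)) (P : M -> 'M[R]_k) (mu : M -> DG gp)
  (HM : quasi_hamiltonian MS a h P mu)
  (Hnondeg : forall m, nondegenerate_at MS a h P mu m)
  (x0 : M) (U : set (MG a)) (MU : manifold_on R U q)
  (Ux0 : U (qproj (G_orbit a) x0))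
  (Hp : submersion MM MU (qproj (G_orbit a) @^-1` U) (qproj (G_orbit a)))
  (PU : MG a -> 'M[R]_q) (HPU : reduced_bivector P MU PU)
  (m : M) (s : DG gp) (Um : U (qproj (G_orbit a) m)) (Hs : s = mu m)
  (Hreg : regular_value MM MS mu s) :
  symplectic_leaf MU PU (qproj (G_orbit a) m)
  = connected_component
      (qproj (G_orbit a) @` (mu @^-1` [set s]) `&` U
         : set (final_space (qproj (G_orbit a)) (mu @^-1` [set s])))
      (qproj (G_orbit a) m).

Proof.
have Cm : (qproj (G_orbit a) @` (mu @^-1` [set s]) `&` U) (qproj (G_orbit a) m).
  by split => //; exists m.
apply/seteqP; split; first exact: (leaf_sub_component HM Hnondeg Hp HPU Cm).
exact: (component_sub_leaf HM Hnondeg Hp HPU Um (esym Hs) Hreg).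
Qed.
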